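(* Assume that the summability exponent of the sequence $\boldsymbol b$ satisfies $p\in(0,\min\{\frac23,\frac1\beta\}]$, $p\ne\frac1\beta$, fix $\boldsymbol\xi\in\Xi$, and let $\delta\in(0,\frac12)$. Let the generating vectors of the inner rules $Q^{(2)}_\ell$ be obtained by the CBC algorithm with input weights $$ \gamma_{2,\mathfrak u}=\bigg((|\mathfrak u|!)^\beta\prod_{j\in\mathfrak u}\frac{c_j}{\sqrt{2\zeta(2\lambda)/(2\pi^2)^\lambda}}\bigg)^{\frac2{1+\lambda}},\qquad \lambda=\frac1{2-2\delta},\qquad c_j=\frac{2^\beta C}{\sqrt{\mu_{\min}}}b_j,\qquad \mathfrak u\subseteq\{1,\dots,s\}. $$ Let the outer rules $Q^{(1)}_\ell$ be $k$-dimensional randomly shifted lattice rules scaled to $[-K,K]^k$ which are constructed by the CBC algorithm and attain the rate $2^{-(1-\delta)\ell}$, as specified in the context. Then the full tensor product approximation of $\mathcal I_K=\int_{[-K,K]^k}g\big(\int_{\Theta_s}f(\boldsymbol\theta,\boldsymbol y)\,{\rm d}\boldsymbol\theta\big){\rm d}\boldsymbol y$ satisfies $$ \sqrt{\mathbb E\big[|\mathcal I_K-Q^{(1)}_\ell g(Q^{(2)}_\ell f)|^2\big]}\le C'(2^\ell)^{-\frac12+\delta}\quad\text{for all }\ell\ge 0 $$ with a constant $C'>0$ that is independent of the dimension $s$ (and of $\ell$); the expectation is over the random shifts.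
   Context: Notation: $g(x)=x\log x$; $f(\boldsymbol\theta,\boldsymbol y)=C_{k,\Gamma}{\rm e}^{-\frac12\|\boldsymbol y-G_s(\boldsymbol\theta,\boldsymbol\xi)\|_{\Gamma^{-1}}^2}$, $C_{k,\Gamma}=(\det(2\pi\Gamma))^{-1/2}$, $\|\boldsymbol x\|_{\Gamma^{-1}}=\sqrt{\boldsymbol x^{\rm T}\Gamma^{-1}\boldsymbol x}$; $\|\cdot\|$ is the Euclidean norm; $|\boldsymbol\nu|=\sum_j\nu_j$, $\boldsymbol b^{\boldsymbol\nu}=\prod_jb_j^{\nu_j}$; $\zeta$ is the Riemann zeta function. Standing assumptions: $k,s\in\mathbb N$, $K>0$; $\Xi$ is a compact subset of a Euclidean space; $\Theta_s=[-\frac12,\frac12]^s$. $\Gamma\in\mathbb R^{k\times k}$ is symmetric positive definite and $0<\mu_{\min}\le1$ is a lower bound on its smallest eigenvalue. $C\ge1$, $\beta\ge1$ are constants and $\boldsymbol b=(b_j)_{j\ge1}\in\ell^p(\mathbb N)$, $p\in(0,1)$, is a sequence of nonnegative reals, all independent of $s$ and $\boldsymbol\xi$. The forward models $G_s:\Theta_s\times\Xi\to\mathbb R^k$ are smooth in $\boldsymbol\theta$ and satisfy $\|\partial^{\boldsymbol\nu}_{\boldsymbol\theta}G_s(\boldsymbol\theta,\boldsymbol\xi)\|\le C(|\boldsymbol\nu|!)^\beta\boldsymbol b^{\boldsymbol\nu}$ for all $\boldsymbol\theta\in\Theta_s$, $\boldsymbol\nu\in\mathbb N_0^s$, $\boldsymbol\xi\in\Xi$.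 Cubature: $Q^{(1)}_\ell F=(2K)^k2^{-\ell}\sum_{i=1}^{2^\ell}F\big(2K\{i\boldsymbol z/2^\ell+\boldsymbol\Delta\}-K\mathbf 1\big)$, with $\boldsymbol z\in\mathbb N^k$, $\{\cdot\}$ the componentwise fractional part, $\boldsymbol\Delta\sim\mathcal U([0,1]^k)$; $Q^{(2)}_\ell F=2^{-\ell}\sum_{i=1}^{2^\ell}F\big(\{i\boldsymbol z'/2^\ell+\boldsymbol\Delta'\}-\tfrac12\mathbf 1\big)$ with $\boldsymbol z'\in\mathbb N^s$ and an independent shift $\boldsymbol\Delta'\sim\mathcal U([0,1]^s)$. $Q^{(2)}_\ell$ acts on $\boldsymbol\theta$ for fixed $\boldsymbol y$. The rate assumption on the outer rules is: there are positive weights $\boldsymbol\gamma_1$ and a constant $C_1$, both independent of $s$, with $\big(\mathbb E_{\boldsymbol\Delta}|\int_{[0,1]^k}F-2^{-\ell}\sum_iF(\{i\boldsymbol z/2^\ell+\boldsymbol\Delta\})|^2\big)^{1/2}\le C_12^{-(1-\delta)\ell}\|F\|_{\mathcal W_{k,\boldsymbol\gamma_1}}$ for all $F\in\mathcal W_{k,\boldsymbol\gamma_1}$ and $\ell\ge0$. Here $\mathcal W_{m,\boldsymbol\gamma}$ is the unanchored weighted Sobolev space on $[0,1]^m$ with norm $\|F\|^2_{\mathcal W_{m,\boldsymbol\gamma}}=\sum_{\mathfrak u\subseteq\{1,\dots,m\}}\gamma_{\mathfrak u}^{-1}\int_{[0,1]^{|\mathfrak u|}}\big(\int_{[0,1]^{m-|\mathfrak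 u|}}\partial_{\mathfrak u}F\,{\rm d}\boldsymbol y_{-\mathfrak u}\big)^2{\rm d}\boldsymbol y_{\mathfrak u}$, $\partial_{\mathfrak u}=\partial^{|\mathfrak u|}/\prod_{j\in\mathfrak u}\partial y_j$. CBC algorithm: given weights $(\gamma_{\mathfrak u})_{\mathfrak u\subseteq\{1,\dots,d\}}$ and $n=2^m$ points, put $z_1=1$ and for $j=2,\dots,d$ successively choose $z_j\in\{1,\dots,n\}$ coprime to $n$ minimizing, with $z_1,\dots,z_{j-1}$ fixed, the squared shift-averaged worst-case error $\sum_{\varnothing\ne\mathfrak u\subseteq\{1,\dots,j\}}\gamma_{\mathfrak u}\frac1n\sum_{i=1}^n\prod_{l\in\mathfrak u}B_2(\{iz_l/n\})$, $B_2(x)=x^2-x+\frac16$. *)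

(* Defs.v *)
From HB Require Import structures.
From mathcomp Require Import all_boot all_order all_algebra.
From mathcomp Require Import all_classical all_reals all_analysis.

Set Implicit Arguments.
Unset Strict Implicit.
Unset Printing Implicit Defensive.

Import Order.TTheory GRing.Theory Num.Theory.
Import numFieldNormedType.Exports.

Local Open Scope classical_set_scope.
Local Open Scope ring_scope.

(* Points of R^n are column vectors. MathComp-Analysis has no n-dimensional
   Lebesgue measure, so 'cV[R]_n is given the product (Borel) sigma-algebra and
   the measure is built by recursion from R^(n+1) = R x R^n. *)

Definition vec_display : measure_display -> measure_display.
Proof. exact. Qed.

Section vec_measurable.
Context {R : realType} {n : nat}.

Let coord (i : 'I_n) (x : 'cV[R]_n) : measurableTypeR R := x i 0.

Let vec_set0 : g_sigma_preimage coord set0.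
Proof. exact: sigma_algebra0. Qed.

Let vec_setC A : g_sigma_preimage coord A -> g_sigma_preimage coord (~` A).
Proof. exact: sigma_algebraC. Qed.

Let vec_bigcup (F : _^nat) : (forall i, g_sigma_preimage coord (F i)) ->
  g_sigma_preimage coord (\bigcup_i (F i)).
Proof. exact: sigma_algebra_bigcup. Qed.

HB.instance Definition _ := @isMeasurable.Build
  (vec_display default_measure_display)
  'cV[R]_n (g_sigma_preimage coord) vec_set0 vec_setC vec_bigcup.

Lemma measurable_coord (i : 'I_n) :
  measurable_fun [set: 'cV[R]_n] (fun x => x i 0 : measurableTypeR R).
Proof.
move=> _ Y mY; rewrite setTI; apply: sub_sigma_algebra => /=.
rewrite -bigcup_seq/=; exists i => /=; first by rewrite mem_index_enum.
by exists Y => //; rewrite setTI.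
Qed.

Lemma measurable_vecP d (T : measurableType d) (f : T -> 'cV[R]_n) :
  (forall i, measurable_fun setT (fun t => f t i 0 : measurableTypeR R)) ->
  measurable_fun setT f.
Proof.
move=> mf _ A; rewrite setTI.
have -> : (f @^-1` A) = ([set: T] `&` f @^-1` A) by rewrite setTI.
suff : g_sigma_preimage (fun i => coord i \o f) `<=` measurable.
  by rewrite g_sigma_preimage_comp => + mA; apply; exists A.
apply: smallest_sub; first exact: sigma_algebra_measurable.
apply: (big_ind (fun X : set_system T => X `<=` measurable)) => //.
  by move=> X Y mX mY B [/mX|/mY].
by move=> i _ B [C mC <-]; exact: mf.
Qed.

End vec_measurable.

Section vec_lebesgue.
Context {R : realType}.

Definition vcons n (x : measurableTypeR R * 'cV[R]_n) : 'cV[R]_n.+1 :=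
  col_mx (x.1%:M : 'cV_1) x.2.

Definition vuncons n (x : 'cV[R]_n.+1) : measurableTypeR R * 'cV[R]_n :=
  (x 0 0, dsubmx (x : 'cV_(1 + n))).

Lemma vunconsK n : cancel (@vuncons n) (@vcons n).
Proof.
move=> x; apply/matrixP => i j; rewrite /vcons /vuncons /= ord1.
have [i' ->|i' ->] := @split_ordP 1 n i.
  rewrite (@col_mxEu _ 1 n 1) mxE !ord1 mulr1n.
  by congr (x _ _); apply/val_inj.
by rewrite (@col_mxEd _ 1 n 1) mxE.
Qed.

Lemma vconsK n : cancel (@vcons n) (@vuncons n).
Proof.
move=> [a y]; rewrite /vcons /vuncons /= (@col_mxKd _ 1 n 1); congr pair.
have -> : (0 : 'I_n.+1) = lshift n (0 : 'I_1) by apply/val_inj.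
by rewrite (@col_mxEu _ 1 n 1) mxE eqxx mulr1n.
Qed.

Lemma measurable_vcons n : measurable_fun setT (@vcons n).
Proof.
apply: measurable_vecP => i.
have [j ->|j ->] := @split_ordP 1 n i.
  rewrite (_ : (fun _ => _) = fst); first exact: measurable_fst.
  by apply/funext => t; rewrite /vcons (@col_mxEu _ 1 n 1) mxE !ord1 mulr1n.
rewrite (_ : (fun _ => _) = (fun y : 'cV[R]_n => y j 0) \o snd).
  by apply: measurableT_comp; [exact: measurable_coord|exact: measurable_snd].
by apply/funext => t; rewrite /vcons (@col_mxEd _ 1 n 1).
Qed.

Lemma measurable_vuncons n : measurable_fun setT (@vuncons n).
Proof.
apply: measurable_fun_pair; first exact: measurable_coord.
apply: measurable_vecP => i.
under eq_fun do rewrite mxE.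
exact: measurable_coord.
Qed.

Section step.
Variables (n : nat) (mu : {sigma_finite_measure set 'cV[R]_n -> \bar R}).

Definition leb_step : set 'cV[R]_n.+1 -> \bar R :=
  pushforward (@lebesgue_measure R \x mu)%E (@vcons n).

Let leb_step0 : leb_step set0 = 0%E.
Proof. by rewrite /leb_step /pushforward preimage_set0 measure0. Qed.

Let leb_step_ge0 A : (0 <= leb_step A)%E.
Proof. exact: (measure_ge0 (@lebesgue_measure R \x mu)%E). Qed.

Let leb_step_sigma_additive : semi_sigma_additive leb_step.
Proof.
move=> F mF tF mUF; rewrite /leb_step /pushforward preimage_bigcup.
apply: measure_semi_sigma_additive.
- by move=> i; rewrite -[X in measurable X]setTI; exact: measurable_vcons.
- apply/trivIsetP => /= i j _ _ ij; rewrite -preimage_setI.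
  by move/trivIsetP : tF => /(_ _ _ _ _ ij) ->//; rewrite preimage_set0.
- rewrite -preimage_bigcup -[X in measurable X]setTI.
  exact: measurable_vcons.
Qed.

HB.instance Definition _ := isMeasure.Build _ _ _ leb_step
  leb_step0 leb_step_ge0 leb_step_sigma_additive.

Let leb_step_sigma_finite : sigma_finite setT leb_step.
Proof.
have /sigma_finiteP[F [TF ndF Foo]] := sigma_finiteT (@lebesgue_measure R).
have /sigma_finiteP[H [TH ndH Hoo]] := sigma_finiteT mu.
exists (fun i => @vuncons n @^-1` (F i `*` H i)).
  rewrite -preimage_bigcup (_ : \bigcup_i _ = setT) ?preimage_setT//.
  rewrite -subTset => -[x y] _.
  have [i _ Fx] : (\bigcup_i F i) x by rewrite -TF.
  have [j _ Hy] : (\bigcup_i H i) y by rewrite -TH.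
  exists (maxn i j) => //; split.
  - by move: x Fx; exact/subsetPset/ndF/leq_maxl.
  - by move: y Hy; exact/subsetPset/ndH/leq_maxr.
move=> i; have [mF Fi] := Foo i; have [mH Hi] := Hoo i; split.
  rewrite -[X in measurable X]setTI.
  by apply: measurable_vuncons => //; exact: measurableX.
rewrite /leb_step /pushforward -comp_preimage.
rewrite (_ : _ \o _ = id) ?preimage_id//.
  by rewrite product_measure1E// lte_mul_pinfty// ge0_fin_numE.
by apply/funext => x /=; rewrite vconsK.
Qed.

HB.instance Definition _ := Measure_isSigmaFinite.Build _ _ _ leb_step
  leb_step_sigma_finite.
End step.

(* n-dimensional Lebesgue measure *)
Fixpoint leb n : {sigma_finite_measure set 'cV[R]_n -> \bar R} :=
  match n with
  | 0 => \d_ (0 : 'cV[R]_0)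
  | m.+1 => leb_step (leb m)
  end.

End vec_lebesgue.

Definition cube (R : realType) n (a b : R) : set 'cV[R]_n :=
  [set x | forall i, a <= x i 0 <= b].
Arguments cube {R} n a b.

Definition enorm (R : realType) n (x : 'cV[R]_n) : R :=
  Num.sqrt (\sum_i x i 0 ^+ 2).

(* Partial derivatives relative to a set D: at boundary points of a cube they
   are one-sided. Only the values at points of D are meaningful. *)
Section derivatives.
Context {R : realType} {n : nat} {V : normedModType R}.
Variable D : set 'cV[R]_n.

Definition diff_quotient (j : 'I_n) (F : 'cV[R]_n -> V) (x : 'cV[R]_n) (h : R)
  : V := h^-1 *: (F (x + h *: delta_mx j 0) - F x).

Definition dir_nbhs (j : 'I_n) (x : 'cV[R]_n) : set_system R :=
  within [set h : R | D (x + h *: delta_mx j 0)] 0^'.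

Definition pderiv (j : 'I_n) (F : 'cV[R]_n -> V) (x : 'cV[R]_n) : V :=
  lim (diff_quotient j F x @ dir_nbhs j x).

Definition pderivs (js : seq 'I_n) (F : 'cV[R]_n -> V) : 'cV[R]_n -> V :=
  foldr pderiv F js.

Definition mderiv (nu : 'I_n -> nat) : ('cV[R]_n -> V) -> 'cV[R]_n -> V :=
  pderivs (flatten [seq nseq (nu j) j | j <- enum 'I_n]).

(* F is C^oo on D: all iterated partial derivatives exist and are continuous,
   up to the boundary. *)
Definition smooth_on (F : 'cV[R]_n -> V) : Prop :=
  forall js : seq 'I_n,
    {within D, continuous (pderivs js F)} /\
    (forall j x, D x -> cvg (diff_quotient j (pderivs js F) x @ dir_nbhs j x)).

End derivatives.

(* The unanchored weighted Sobolev space on [0,1]^m *)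
Section sobolev.
Context {R : realType} {m : nat}.
Local Notation I01 := (cube m 0 1 : set 'cV[R]_m).

(* test functions in C_c^oo((0,1)^m) *)
Definition test_fun (phi : 'cV[R]_m -> R) : Prop :=
  smooth_on setT phi /\
  exists2 e : R, 0 < e & forall x, phi x != 0 -> cube m e (1 - e) x.

(* d is the weak derivative of F with respect to the variables in u, once
   each. *)
Definition weak_deriv (u : {set 'I_m}) (F d : 'cV[R]_m -> R) : Prop :=
  forall phi, test_fun phi ->
    \int[leb m]_(y in I01) (F y * pderivs setT (enum u) phi y) =
    (-1) ^+ #|u| * \int[leb m]_(y in I01) (d y * phi y).

(* F belongs to the space, with square integrable mixed weak derivatives
   D u, u \subset {1..m}. The elements of this space have a unique continuous
   representative; as cubature rules evaluate F at points, F denotes it. *)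
Definition sobolev (F : 'cV[R]_m -> R) (D : {set 'I_m} -> 'cV[R]_m -> R)
    : Prop :=
  {within I01, continuous F} /\
  forall u : {set 'I_m},
    [/\ measurable_fun I01 (D u),
        (leb m).-integrable I01 (fun y => (D u y ^+ 2)%:E)
      & weak_deriv u F (D u)].

(* the point with coordinates y_i for i in u and z_i for i not in u *)
Definition glue (u : {set 'I_m}) (y z : 'cV[R]_m) : 'cV[R]_m :=
  \col_i (if i \in u then y i 0 else z i 0).

(* Both integrals run over all of [0,1]^m instead of [0,1]^|u| and
   [0,1]^(m-|u|): the integrands do not depend on the extra variables, which
   range over a set of measure 1. *)
Definition sobolev_norm (gamma : {set 'I_m} -> R)
    (D : {set 'I_m} -> 'cV[R]_m -> R) : R :=
  Num.sqrt (\sum_(u : {set 'I_m}) (gamma u)^-1 *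
    \int[leb m]_(y in I01) (\int[leb m]_(z in I01) D u (glue u y z)) ^+ 2).

End sobolev.

Section lattice_rules.
Context {R : realType}.

Definition fracpart (x : R) : R := x - (Num.floor x)%:~R.

(* { i z / N + Delta } *)
Definition lattice_pt d (N : nat) (z : 'I_d -> nat) (Delta : 'cV[R]_d)
    (i : nat) : 'cV[R]_d :=
  \col_j fracpart ((i * z j)%:R / N%:R + Delta j 0).

Definition lattice_rule d (N : nat) (z : 'I_d -> nat) (Delta : 'cV[R]_d)
    (F : 'cV[R]_d -> R) : R :=
  N%:R^-1 * \sum_(1 <= i < N.+1) F (lattice_pt N z Delta i).

Definition Q1 k (K : R) (l : nat) (z : 'I_k -> nat) (Delta : 'cV[R]_k)
    (F : 'cV[R]_k -> R) : R :=
  (2 * K) ^+ k *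
  lattice_rule (2 ^ l) z Delta (fun x => F ((2 * K) *: x - const_mx K)).

Definition Q2 s (l : nat) (z : 'I_s -> nat) (Delta : 'cV[R]_s)
    (F : 'cV[R]_s -> R) : R :=
  lattice_rule (2 ^ l) z Delta (fun x => F (x - const_mx (2^-1))).

Definition B2 (x : R) : R := x ^+ 2 - x + 6^-1.

(* squared shift-averaged worst-case error in the first j.+1 dimensions
   (coordinates are numbered from 0) *)
Definition cbc_error d (gamma : {set 'I_d} -> R) (N : nat) (z : 'I_d -> nat)
    (j : 'I_d) : R :=
  \sum_(u : {set 'I_d} | (u != finset.set0) && [forall l in u, (l <= j)%N])
    gamma u * (N%:R^-1 * \sum_(1 <= i < N.+1)
                 \prod_(l in u) B2 (fracpart ((i * z l)%:R / N%:R))).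

Definition cbc_candidate (N c : nat) : bool :=
  [&& (0 < c)%N, (c <= N)%N & coprime c N].

(* z is a possible output of the CBC algorithm (ties are broken arbitrarily) *)
Definition cbc d (gamma : {set 'I_d} -> R) (N : nat) (z : 'I_d -> nat) : Prop :=
  forall j : 'I_d,
    if (j : nat) == 0%N then z j = 1%N
    else cbc_candidate N (z j) /\
      forall c, cbc_candidate N c ->
        cbc_error gamma N z j <=
        cbc_error gamma N (fun l => if l == j then c else z l) j.

(* root mean square error, over the random shift, of the rule on [0,1]^d *)
Definition rms_error d (N : nat) (z : 'I_d -> nat) (F : 'cV[R]_d -> R)
    : \bar R :=
  sqrte (\int[leb d]_(Delta in cube d 0 1)
    ((`| (\int[leb d]_(x in cube d 0 1) F x) - lattice_rule N z Delta F | ^+ 2)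
       %:E)).

End lattice_rules.

Section model.
Context {R : realType}.

Definition xlogx (x : R) : R := x * ln x.

Definition zeta (x : R) : R := limn (series (fun j => (j.+1%:R `^ x)^-1)).

Definition weighted_norm k (Gamma : 'M[R]_k) (x : 'cV[R]_k) : R :=
  Num.sqrt ((x^T *m invmx Gamma *m x) 0 0).

Definition normconst k (Gamma : 'M[R]_k) : R :=
  (\det ((2 * pi) *: Gamma)) `^ (- 2^-1).

(* Gs is the forward model at a fixed xi. *)
Definition likelihood k s (Gamma : 'M[R]_k) (Gs : 'cV[R]_s -> 'cV[R]_k)
    (theta : 'cV[R]_s) (y : 'cV[R]_k) : R :=
  normconst Gamma * expR (- 2^-1 * weighted_norm Gamma (y - Gs theta) ^+ 2).

Definition Theta s : set 'cV[R]_s := cube s (- 2^-1) (2^-1).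
Arguments Theta s : clear implicits.

Definition I_K k s (K : R) (f : 'cV[R]_s -> 'cV[R]_k -> R) : R :=
  \int[leb k]_(y in cube k (- K) K)
    xlogx (\int[leb s]_(theta in Theta s) f theta y).

Definition tensor_rule k s (K : R) (l : nat) (z1 : 'I_k -> nat)
    (z2 : 'I_s -> nat) (f : 'cV[R]_s -> 'cV[R]_k -> R)
    (Delta1 : 'cV[R]_k) (Delta2 : 'cV[R]_s) : R :=
  Q1 K l z1 Delta1 (fun y => xlogx (Q2 l z2 Delta2 (fun theta => f theta y))).

(* The law of the pair of independent uniform shifts is the Lebesgue measure on
   [0,1]^k x [0,1]^s. *)
Definition rms_full_error k s (K : R) (l : nat) (z1 : 'I_k -> nat)
    (z2 : 'I_s -> nat) (f : 'cV[R]_s -> 'cV[R]_k -> R) : \bar R :=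
  sqrte (\int[(leb k \x leb s)%E]_(D in cube k 0 1 `*` cube s 0 1)
    ((`| I_K K f - tensor_rule K l z1 z2 f D.1 D.2 | ^+ 2)%:E)).

Definition spd k (Gamma : 'M[R]_k) : Prop :=
  Gamma^T = Gamma /\
  forall x : 'cV[R]_k, x != 0 -> 0 < (x^T *m Gamma *m x) 0 0.

(* b lists the sequence (b_j), j >= 1, from index 0. *)
Definition ellp (p : R) (b : nat -> R) : Prop :=
  cvgn (series (fun j => `|b j| `^ p)).

Definition gevrey_bound k s (C beta : R) (b : nat -> R)
    (Gs : 'cV[R]_s -> 'cV[R]_k) : Prop :=
  forall (nu : 'I_s -> nat) (theta : 'cV[R]_s), Theta s theta ->
    enorm (mderiv (Theta s) nu Gs theta) <=
    C * ((\sum_(j < s) nu j)`!)%N%:R `^ beta * \prod_(j < s) b j ^+ nu j.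

Definition inner_weight s (mu_min C beta delta : R) (b : nat -> R)
    (u : {set 'I_s}) : R :=
  let lambda := (2 - 2 * delta)^-1 in
  let c (j : nat) := 2 `^ beta * C / Num.sqrt mu_min * b j in
  ((#|u| `!)%N%:R `^ beta *
   \prod_(j in u) (c j / Num.sqrt (2 * zeta (2 * lambda) /
                                   (2 * pi ^+ 2) `^ lambda)))
    `^ (2 / (1 + lambda)).

End model.
Arguments Theta {R} s.

(* Main.v *)
(* Only the rate [N^(-1/2)] with [N = 2^l] is needed, so inner and outer rules can be treated
   alike, by the CBC bound for lambda = 1: comparing the CBC choice with the average over all
   odd candidates gives the squared worst-case error
   [e^2 <= (2 / N) * \sum_(u <> set0) gamma_u 6^-|u|].

   Derivatives are replaced by mixed differences. All rules and integrals are first moved to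
   the grid of mesh [1 / N]: a shifted lattice point does not cross a grid cell as the shift
   moves inside one, hence this costs [O(1/N)], uniformly in the shift. On the grid, Abel
   summation in each variable expands a function in products of the kernel
   [kap x y = y / N - 1_(x < y)] and its mixed differences, and the average of
   [kap (t + x) y * kap x y] is [B2 (t / N) - 1 / (6 N^2)]. Cauchy-Schwarz then bounds the
   variance of the lattice rule by [e^2 * \sum_u B_u^2 / gamma_u], where [B_u] bounds the mixed
   differences in the directions [u].

   The bounds [B_u] come from a discrete Leibniz rule: the class
   [B_u = M r^|u| (|u|!)^beta \prod_(j in u) b_j] is stable under products up to doubling [r],
   which gives the Gaussian likelihood through the exponential series (in [theta] for the inner
   rule, in [y] for the outer one); the entropy integrand [x ln x] follows from the logarithmic
   series. The sums over [u] are bounded independently of [s] because [beta p < 1] and both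
   exponents [2 / (1 + lambda)] and [2 lambda / (1 + lambda)] are at least [2 / 3 >= p]. *)
From HB Require Import structures.
Require Import Defs.
From mathcomp Require Import all_boot all_order all_algebra.
From mathcomp Require Import all_classical all_reals all_analysis.
From mathcomp Require Import measurable_realfun.
From mathcomp Require Import ring lra zify.
Set Implicit Arguments.
Unset Strict Implicit.
Unset Printing Implicit Defensive.
Import Order.TTheory GRing.Theory Num.Theory.
Import numFieldNormedType.Exports.
Local Open Scope classical_set_scope.
Local Open Scope ring_scope.

(** * Averages over finite types *)

(** Two calculi for products are in use. In the class [gev] every multiplication costs a factor 2 in
    the constant, so a power series has to converge at twice the size of its argument. The
    exponential series does, in any dimension. The logarithmic series would need [2 q < 1], while
    its argument [1 - a / M0] may come close to 1. It is therefore treated in the fixed dimension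
    [k], with a weighted sum norm that is submultiplicative without a factor and stays below 1 once
    its weight is small; the resulting constant depends on [k] but not on the mesh.

    For a nonnegative integrand the integral is a supremum over simple functions below it, hence
    monotone for arbitrary functions. Uniform closeness to a step function on grid cells then
    controls all integrals, and measurability has to be checked only for boxes built from cells.

    Both shifts enter the entropy integrand. The error is split at the outer rule applied to the
    exact inner grid averages, so that each variance involves one shift only. *)

Section average.
Context {R : realType}.

Definition avg (T : finType) (F : T -> R) : R := #|T|%:R^-1 * \sum_x F x.

Lemma avg_const (T : finType) (c : R) : (0 < #|T|)%N -> avg (fun _ : T => c) = c.
Proof.
move=> T0; rewrite /avg sumr_const -[c *+ _]mulr_natl mulrA.
by rewrite mulVf ?mul1r// pnatr_eq0 -lt0n.
Qed.

Lemma eq_avg (T : finType) (F G : T -> R) : F =1 G -> avg F = avg G.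
Proof. by move=> FG; congr (_ * _); apply: eq_bigr => i _. Qed.

Lemma avgZ (T : finType) (c : R) (F : T -> R) : avg (fun x => c * F x) = c * avg F.
Proof. by rewrite /avg -mulr_sumr mulrCA. Qed.

Lemma avgZr (T : finType) (c : R) (F : T -> R) : avg (fun x => F x * c) = avg F * c.
Proof. by rewrite /avg -mulr_suml mulrA. Qed.

Lemma avgD (T : finType) (F G : T -> R) : avg (fun x => F x + G x) = avg F + avg G.
Proof. by rewrite /avg big_split mulrDr. Qed.

Lemma avgB (T : finType) (F G : T -> R) : avg (fun x => F x - G x) = avg F - avg G.
Proof. by rewrite /avg sumrB mulrBr. Qed.

Lemma avg_sum (T I : finType) (P : pred I) (F : I -> T -> R) :
  avg (fun x => \sum_(i | P i) F i x) = \sum_(i | P i) avg (F i).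
Proof. by rewrite /avg exchange_big mulr_sumr. Qed.

Lemma ler_avg (T : finType) (F G : T -> R) : (forall x, F x <= G x) -> avg F <= avg G.
Proof.
by move=> FG; rewrite /avg ler_wpM2l ?invr_ge0// ler_sum.
Qed.

Lemma avg_ge0 (T : finType) (F : T -> R) : (forall x, 0 <= F x) -> 0 <= avg F.
Proof. by move=> F0; rewrite /avg mulr_ge0 ?invr_ge0// sumr_ge0. Qed.

Lemma exchange_avg (T U : finType) (F : T -> U -> R) :
  avg (fun x => avg (F x)) = avg (fun y => avg (fun x => F x y)).
Proof.
rewrite /avg -mulr_sumr -[X in _ = _ * X]mulr_sumr exchange_big/=.
by rewrite mulrCA.
Qed.

Lemma reindex_avg (T U : finType) (h : T -> U) (F : U -> R) : bijective h ->
  avg (fun x => F (h x)) = avg F.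
Proof.
move=> bh; rewrite /avg (bij_eq_card bh); congr (_ * _).
by rewrite [RHS](reindex h)//; exact: onW_bij.
Qed.

Lemma ler_norm_avg (T : finType) (F : T -> R) : `|avg F| <= avg (fun x => `|F x|).
Proof.
rewrite /avg normrM ger0_norm ?invr_ge0// ler_wpM2l ?invr_ge0//.
exact: ler_norm_sum.
Qed.

Lemma avg_prod (d : nat) (T : finType) (F : 'I_d -> T -> R) :
  avg (fun m : {ffun 'I_d -> T} => \prod_l F l (m l)) = \prod_l avg (F l).
Proof.
rewrite /avg -bigA_distr_bigA big_split/= prodr_const card_ffun !card_ord.
by rewrite natrX exprVn.
Qed.

(** Lagrange's identity: the defect is half the sum of all [(x i * y j - x j * y i) ^+ 2]. *)
Lemma cauchy_schwarz_sum (I : finType) (P : pred I) (x y : I -> R) :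
  (\sum_(i | P i) x i * y i) ^+ 2 <=
  (\sum_(i | P i) x i ^+ 2) * (\sum_(i | P i) y i ^+ 2).
Proof.
have key : 0 <= \sum_(i | P i) \sum_(j | P j) (x i * y j - x j * y i) ^+ 2.
  by apply: sumr_ge0 => i _; apply: sumr_ge0 => j _; exact: sqr_ge0.
have E1 : \sum_(i | P i) \sum_(j | P j) (x i ^+ 2 * y j ^+ 2) =
    (\sum_(i | P i) x i ^+ 2) * (\sum_(i | P i) y i ^+ 2).
  by rewrite mulr_suml; apply: eq_bigr => i _; rewrite mulr_sumr.
have E2 : \sum_(i | P i) \sum_(j | P j) (x i * y i * (x j * y j)) =
    (\sum_(i | P i) x i * y i) ^+ 2.
  by rewrite expr2 mulr_suml; apply: eq_bigr => i _; rewrite mulr_sumr.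
have E3 : \sum_(i | P i) \sum_(j | P j) (x i * y j - x j * y i) ^+ 2 =
  \sum_(i | P i) \sum_(j | P j) (x i ^+ 2 * y j ^+ 2) +
  \sum_(i | P i) \sum_(j | P j) (x j ^+ 2 * y i ^+ 2) -
  2 * \sum_(i | P i) \sum_(j | P j) (x i * y i * (x j * y j)).
  rewrite mulr_sumr -big_split/= -sumrB; apply: eq_bigr => i _.
  rewrite mulr_sumr -big_split/= -sumrB; apply: eq_bigr => j _.
  by ring.
move: key; rewrite E3 [X in _ + X - _]exchange_big/= E1 E2.
by lra.
Qed.

Lemma avg_sqr_le (T : finType) (F : T -> R) : (0 < #|T|)%N ->
  (avg F) ^+ 2 <= avg (fun x => F x ^+ 2).
Proof.
move=> T0.
have T1 : #|T|%:R != 0 :> R by rewrite pnatr_eq0 -lt0n.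
rewrite /avg exprMn exprVn.
rewrite -(ler_pM2l (x := #|T|%:R ^+ 2)); last by rewrite exprn_gt0// ltr0n.
rewrite mulrA mulfV ?mul1r ?expf_neq0//.
have := cauchy_schwarz_sum xpredT (fun _ : T => 1) F.
rewrite sumr_const expr1n; under eq_bigr do rewrite mul1r.
by move/le_trans; apply; rewrite expr2 -!mulrA mulVKf.
Qed.

End average.

(** * The variance of a randomly shifted lattice rule on the grid *)

Section abel.
Context {R : realType} (n : nat).
Local Notation N := (n.+1%:R : R).

(** Discrete form of the kernel [y - 1_(x < y)], for which the integral of [f y + kap x y * f' y]
    over the unit interval is [f x]. *)
Definition kap (x y : 'I_n.+1) : R := y%:R / N - (x < y)%N%:R.

(** [opred 0 = 0]: the backward difference at 0 vanishes instead of wrapping around. *)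
Definition opred (y : 'I_n.+1) : 'I_n.+1 := inord y.-1.

Let N0 : N != 0. Proof. by rewrite pnatr_eq0. Qed.

Lemma abel_weight (A : nat -> R) (m : nat) :
  \sum_(y < m.+1) y%:R * (A y - A y.-1) = m%:R * A m - \sum_(y < m) A y.
Proof.
elim: m => [|m IH]; first by rewrite big_ord_recl !big_ord0 /= !mul0r subr0 addr0.
rewrite big_ord_recr IH [X in _ = _ - X]big_ord_recr/=.
by rewrite -natr1; ring.
Qed.

Lemma abel_tail (A : nat -> R) (x m : nat) : (x <= m)%N ->
  \sum_(y < m.+1) (x < y)%N%:R * (A y - A y.-1) = A m - A x.
Proof.
move=> xm; elim: m xm => [|m IH] xm.
  move: xm; rewrite leqn0 => /eqP ->.
  by rewrite big_ord_recl big_ord0 /= mul0r subrr addr0.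
rewrite big_ord_recr/=; move: xm; rewrite leq_eqVlt => /predU1P[->|xm].
  rewrite ltnn mul0r addr0 subrr big1// => i _.
  by rewrite ltnNge (ltnW (ltn_ord i))/= mul0r.
by rewrite IH// xm mul1r; ring.
Qed.

(** Summation by parts, once with the weight [y / N] and once with the jump at [x]. The boundary
    values at [n] and the sum of [a] cancel, and [a x] remains. *)
Lemma abel_identity (a : 'I_n.+1 -> R) (x : 'I_n.+1) :
  a x = N^-1 * \sum_y (a y + kap x y * (N * (a y - a (opred y)))).
Proof.
pose A (m : nat) := a (inord m).
have aA y : a y = A y by rewrite /A inord_val.
have E (y : 'I_n.+1) : a y + kap x y * (N * (a y - a (opred y))) =
    A y + y%:R * (A y - A y.-1) - N * ((x < y)%N%:R * (A y - A y.-1)).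
  rewrite aA (_ : a (opred y) = A y.-1)// /kap.
  move: (A y) (A y.-1) (x < y)%N%:R N N0 => p q r M M0.
  by field.
under eq_bigr do rewrite E.
rewrite sumrB big_split/= abel_weight -mulr_sumr abel_tail; last by rewrite -ltnS.
rewrite big_ord_recr/= aA.
have -> : n%:R = N - 1 :> R by rewrite -natr1 addrK.
move: (\sum_(i < n) _) (A n) (A x) N N0 => p q r M M0.
by field.
Qed.
End abel.
Arguments kap {R n}.

Section decomposition.
Context {R : realType} (n d : nat).
Local Notation N := (n.+1%:R : R).
Local Notation X := {ffun 'I_d -> 'I_n.+1}.
Implicit Types (u v w : {set 'I_d}) (x y : X) (F : X -> R).

Definition lower w y : X := [ffun l => if l \in w then opred (y l) else y l].

Definition mdiff u F y : R :=
  N ^+ #|u| * \sum_(w : {set 'I_d} | w \subset u) (-1) ^+ #|w| * F (lower w y).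

(** Point masses are products of functions of one variable; by linearity the expansion in [d]
    variables reduces to the one-variable Abel identity. *)
Lemma delta_expand F x : F x = \sum_c F c * \prod_l (c l == x l)%:R.
Proof.
rewrite (bigD1 x)//= [X in _ + X]big1 ?addr0.
  by rewrite big1 ?mulr1// => l _; rewrite eqxx.
move=> c /eqP cx; rewrite (_ : \prod_l _ = 0) ?mulr0//.
apply/eqP; rewrite prodf_seq_eq0; apply/hasP.
have /existsP[l cl] : [exists l, c l != x l].
  by apply: contra_notT cx => /existsPn cx; apply/ffunP => l; move: (cx l) => /negPn/eqP.
by exists l; rewrite ?mem_index_enum//= (negbTE cl).
Qed.

Lemma prod_ifin u (g : 'I_d -> R) : \prod_l (if l \in u then g l else 1) = \prod_(l in u) g l.
Proof. by rewrite -big_mkcond. Qed.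

(** In the expanded product, [w] is the set of coordinates where the lowered point mass is chosen;
    this is the alternating sum of [mdiff]. *)
Lemma prod_mdiff u x y (c : X) :
  \prod_l (if l \in u then
    kap (x l) (y l) * (N * ((c l == y l)%:R - (c l == opred (y l))%:R))
    else (c l == y l)%:R) =
  (\prod_(l in u) kap (x l) (y l)) *
  (N ^+ #|u| * \sum_(w : {set 'I_d} | w \subset u)
     (-1) ^+ #|w| * \prod_l (c l == lower w y l)%:R).
Proof.
transitivity (\prod_l (if l \in u then kap (x l) (y l) else 1) *
    (\prod_l (if l \in u then N else 1) *
     \prod_l ((if l \in u then - (c l == opred (y l))%:R else 0) +
       (c l == y l)%:R))).
  rewrite -!big_split/=; apply: eq_bigr => l _; case: ifPn => lu.
    by rewrite [X in _ = _ * (_ * X)]addrC.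
  by rewrite !mul1r add0r.
rewrite !prod_ifin prodr_const; congr (_ * (_ * _)).
rewrite bigA_distr/= [RHS]big_mkcond/=; apply: eq_bigr => w _.
case: ifPn => [wu|/subsetPn[l lw lu]]; last first.
  by rewrite (bigD1 l)//= lw (negbTE lu) mul0r.
rewrite -prodr_const -prod_ifin -big_split/=; apply: eq_bigr => l _.
rewrite ffunE; case: ifPn => lw; last by rewrite mul1r.
by rewrite (fintype.subsetP wu _ lw) mulN1r.
Qed.

Lemma anova_expand F x :
  F x = avg (fun y => \sum_(u : {set 'I_d})
     (\prod_(l in u) kap (x l) (y l)) * mdiff u F y).
Proof.
rewrite [LHS]delta_expand.
have E (c : X) : \prod_l (c l == x l)%:R = avg (fun y : X => \sum_(u : {set 'I_d})
    (\prod_(l in u) kap (x l) (y l)) * (N ^+ #|u| *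
     \sum_(w : {set 'I_d} | w \subset u) (-1) ^+ #|w| *
       \prod_l (c l == lower w y l)%:R)).
  under eq_bigr => l _ do rewrite (abel_identity (fun b => (c l == b)%:R)).
  rewrite big_split/= prodr_const card_ord /avg card_ffun !card_ord natrX exprVn.
  congr (_ * _); rewrite bigA_distr_bigA/=; apply: eq_bigr => y _.
  under eq_bigr do rewrite addrC.
  by rewrite bigA_distr/=; apply: eq_bigr => u _; rewrite prod_mdiff.
under eq_bigr do rewrite E -avgZ.
rewrite -avg_sum; apply: eq_avg => y.
under eq_bigr do rewrite mulr_sumr.
rewrite exchange_big/=; apply: eq_bigr => u _.
under eq_bigr do rewrite mulrCA.
rewrite -mulr_sumr; congr (_ * _).
under eq_bigr do rewrite mulrCA.
rewrite -mulr_sumr /mdiff; congr (_ * _).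
under eq_bigr do rewrite mulr_sumr.
rewrite exchange_big/=; apply: eq_bigr => w _.
under eq_bigr do rewrite mulrCA.
by rewrite -mulr_sumr -delta_expand.
Qed.
End decomposition.

(** * Correlation of the kernel under translations modulo [N] *)

Section correlation.
Context {R : realType} (n : nat).
Local Notation N := (n.+1%:R : R).
Local Notation kap := (@kap R n).

Let N0 : N != 0. Proof. by rewrite pnatr_eq0. Qed.

Lemma sum_ltn (m k : nat) : (k <= m)%N -> \sum_(x < m) (x < k)%N%:R = k%:R :> R.
Proof.
elim: m k => [|m IH] k.
  by rewrite leqn0 => /eqP ->; rewrite big_ord0.
rewrite leq_eqVlt => /predU1P[->|km]; last first.
  by rewrite big_ord_recr/= IH// ltnNge -ltnS km/= addr0.
under eq_bigr => i _ do rewrite ltn_ord.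
by rewrite sumr_const card_ord.
Qed.

Lemma sum_gtn (m k : nat) : (k <= m)%N ->
  \sum_(x < m.+1) (k < x)%N%:R = m%:R - k%:R :> R.
Proof.
elim: m => [|m IH] km.
  by move: km; rewrite leqn0 => /eqP ->; rewrite big_ord_recr big_ord0 /= !add0r oppr0.
rewrite big_ord_recr/=; move: km; rewrite leq_eqVlt => /predU1P[->|km].
  rewrite ltnn addr0 subrr big1// => i _.
  by rewrite ltnNge (ltnW (ltn_ord i)).
by rewrite IH// km /= -natr1; ring.
Qed.

(** The summand is 1 for the [y] that separate the two points and 0 otherwise. *)
Lemma sum_separated (x x' : 'I_n.+1) :
  \sum_(y < n.+1) ((x' < y)%N%:R - (x < y)%N%:R) ^+ 2 = `|x'%:R - x%:R| :> R.
Proof.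
wlog xx' : x x' / (x <= x')%N.
  move=> H; case/orP: (leq_total x x') => h; first exact: H.
  by rewrite distrC -H//; apply: eq_bigr => y _; rewrite -sqrrN opprB.
rewrite ger0_norm ?subr_ge0 ?ler_nat//.
rewrite -[RHS](_ : \sum_(y < n.+1) ((x < y)%N%:R - (x' < y)%N%:R) = _); last first.
  by rewrite sumrB !sum_gtn ?leq_ord//; ring.
apply: eq_bigr => y _; case: (ltnP x' y) => h /=.
  by rewrite (leq_ltn_trans xx' h)/=; ring.
by case: (x < y)%N => /=; ring.
Qed.

(** Translation by [t] modulo [N] moves [N - t] points up by [t] and the other [t] points down by
    [N - t]. *)
Lemma avg_displacement (t : 'I_n.+1) :
  avg (fun x : 'I_n.+1 => `|((t + x)%R : nat)%:R - x%:R|) =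
  2 * t%:R * (N - t%:R) / N :> R.
Proof.
rewrite /avg card_ord mulrC; congr (_ / _).
have E (x : 'I_n.+1) : `|((t + x)%R : nat)%:R - x%:R| =
   (N - t%:R) + (2 * t%:R - N) * (x < n.+1 - t)%N%:R.
  rewrite /=; have [h|h] := ltnP x (n.+1 - t).
    rewrite modn_small ?natrD; last by have := ltn_ord t; lia.
    by rewrite addrK ger0_norm//=; ring.
  have -> : ((t + x) %% n.+1 = t + x - n.+1)%N.
    rewrite -[in LHS](@subnK n.+1 (t + x)); last by lia.
    by rewrite modnDr modn_small//; have := ltn_ord t; have := ltn_ord x; lia.
  rewrite natrB ?natrD; last by lia.
  rewrite mulr0 addr0 -opprB normrN ger0_norm; first by ring.
  have : t%:R <= N by rewrite ler_nat ltnW.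
  by lra.
under eq_bigr do rewrite E.
rewrite big_split/= sumr_const card_ord -mulr_sumr sum_ltn ?leq_subr//.
rewrite natrB; last by rewrite ltnW.
rewrite -mulr_natr; ring.
Qed.

Lemma sum_nat_sqr (m : nat) :
  \sum_(y < m) y%:R ^+ 2 = m%:R * (m%:R - 1) * (2 * m%:R - 1) / 6 :> R.
Proof.
elim: m => [|m IH]; first by rewrite big_ord0 !mul0r.
by rewrite big_ord_recr IH/= -natr1; field.
Qed.

Lemma sum_nat_id (m : nat) : \sum_(y < m) y%:R = m%:R * (m%:R - 1) / 2 :> R.
Proof.
elim: m => [|m IH]; first by rewrite big_ord0 !mul0r.
by rewrite big_ord_recr IH/= -natr1; field.
Qed.

Lemma avg_kap_sqr (y : 'I_n.+1) :
  avg (fun x => kap x y ^+ 2) = y%:R / N * (1 - y%:R / N).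
Proof.
have E x : kap x y ^+ 2 = (y%:R / N) ^+ 2 + (1 - 2 * (y%:R / N)) * (x < y)%N%:R.
  by rewrite /kap; case: (x < y)%N => /=; ring.
under eq_avg do rewrite E.
rewrite avgD avg_const ?card_ord// avgZ /avg card_ord sum_ltn; last by rewrite ltnW.
by move: N N0 => M M0; field.
Qed.

(** Polarisation, [a b = (a^2 + b^2 - (a - b)^2) / 2]. By translation invariance both squares
    average to the variance of a Bernoulli variable of mean [y / N]; the squared difference counts
    the points that separate [x] and [t + x], so its average is a mean displacement. *)
Lemma kap_correlation (t : 'I_n.+1) :
  avg (fun y => avg (fun x => kap (t + x) y * kap x y)) =
  B2 (t%:R / N) - (6 * N ^+ 2)^-1.
Proof.
have E x y : kap (t + x) y * kap x y = 2^-1 * (kap (t + x) y ^+ 2 + kap x y ^+ 2 -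
    (((t + x)%R < y)%N%:R - (x < y)%N%:R) ^+ 2).
  by rewrite /kap; move: N N0 => M M0; field.
under eq_avg => y.
  under eq_avg do rewrite E.
  rewrite avgZ avgB avgD (@reindex_avg _ _ _ (fun x => t + x) (fun x => kap x y ^+ 2)).
    over.
  by exists (fun x => - t + x) => x; rewrite addrA ?addNr ?subrr add0r.
rewrite avgZ avgB exchange_avg.
rewrite [X in _ * (_ - X)](_ : _ = N^-1 * avg (fun x : 'I_n.+1 => `|((t + x)%R : nat)%:R - x%:R|)).
  rewrite avg_displacement; under eq_avg do rewrite avg_kap_sqr.
  have -> : avg (fun x : 'I_n.+1 => x%:R / N * (1 - x%:R / N) + x%:R / N * (1 - x%:R / N)) =
    2 / N * N^-1 * \sum_(x < n.+1) x%:R - 2 / N ^+ 2 * N^-1 * \sum_(x < n.+1) x%:R ^+ 2.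
    rewrite /avg card_ord !mulr_sumr -sumrB.
    by apply: eq_bigr => i _; move: N N0 => M M0; field.
  rewrite sum_nat_sqr sum_nat_id /B2; move: (t%:R) N N0 => x M M0.
  by field.
by rewrite -avgZ; apply: eq_avg => x; rewrite -sum_separated /avg card_ord.
Qed.
End correlation.

Section lattice_variance.
Context {R : realType} (n d : nat).
Local Notation N := (n.+1%:R : R).
Local Notation X := {ffun 'I_d -> 'I_n.+1}.
Local Notation kap := (@kap R n).
Variable z : 'I_d -> 'I_n.+1.
Implicit Types (u v w : {set 'I_d}) (m y : X) (F : X -> R).

(** Arithmetic in ['I_n.+1] is modulo [n.+1], which takes the place of the fractional part. *)
Definition lat m (i : 'I_n.+1) : X := [ffun l => z l *+ i + m l].

Let X0 : (0 < #|{: X}|)%N.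
Proof. by rewrite card_ffun !card_ord expn_gt0. Qed.

Definition kernel_corr (t : 'I_n.+1) : R := 
  avg (fun b : 'I_n.+1 => avg (fun a => kap (t + a) b * kap a b)).

Lemma mulrn_ordB (a i j : 'I_n.+1) : a *+ (i - j)%R = a *+ i - a *+ j.
Proof.
apply/(addIr (a *+ j)); rewrite subrK -mulrnDr.
have mod0 (b : 'I_n.+1) : b *+ n.+1 = 0.
  by apply/val_inj; rewrite Zp_mulrn /= modnMl.
have modE (b : 'I_n.+1) k : b *+ (k %% n.+1) = b *+ k.
  by rewrite [in RHS](divn_eq k n.+1) mulrnDr mulnC mulrnA mod0 mul0rn add0r.
have /(congr1 val) /= ij := subrK j i.
by rewrite -[LHS]modE; congr (a *+ _); exact: ij.
Qed.

(** The square is a double average over [i] and [j]. The averages over [m] and [y] factor over the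
    coordinates, and translation invariance in the shift leaves a function of [i - j] only. *)
Lemma avg_lat_kernel_sqr u :
  avg (fun m => avg (fun y => (avg (fun i => \prod_(l in u) kap (lat m i l) (y l))) ^+ 2)) =
  avg (fun i : 'I_n.+1 => \prod_(l in u) kernel_corr (z l *+ i)).
Proof.
have E m y : (avg (fun i => \prod_(l in u) kap (lat m i l) (y l))) ^+ 2 =
  avg (fun i => avg (fun j => \prod_(l in u) (kap (lat m i l) (y l) * kap (lat m j l) (y l)))).
  rewrite expr2 -avgZr; apply: eq_avg => i; rewrite -avgZ; apply: eq_avg => j.
  by rewrite big_split.
under eq_avg do under eq_avg do rewrite E.
under eq_avg do rewrite exchange_avg.
rewrite exchange_avg.
transitivity (avg (fun i : 'I_n.+1 => avg (fun j : 'I_n.+1 =>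
    \prod_(l in u) kernel_corr (z l *+ (i - j)%R)))).
  apply: eq_avg => i.
  under eq_avg do rewrite exchange_avg.
  rewrite exchange_avg; apply: eq_avg => j.
  transitivity (avg (fun m : X => \prod_l avg (fun a => if l \in u then
      kap (z l *+ i + m l) a * kap (z l *+ j + m l) a else 1))).
    apply: eq_avg => m; rewrite -avg_prod; apply: eq_avg => y.
    by rewrite -prod_ifin; apply: eq_bigr => l _; rewrite !ffunE.
  rewrite (@avg_prod _ _ _ (fun l b => avg (fun a => if l \in u then
      kap (z l *+ i + b) a * kap (z l *+ j + b) a else 1))).
  rewrite -prod_ifin; apply: eq_bigr => l _; case: ifP => lu; last first.
    by rewrite !avg_const// ?card_ord//; under eq_avg do rewrite avg_const ?card_ord//; rewrite avg_const ?card_ord.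
  rewrite /kernel_corr exchange_avg; apply: eq_avg => a.
  rewrite -[RHS](@reindex_avg _ _ _ (fun b => z l *+ j + b)); last first.
    by exists (fun x => - (z l *+ j) + x) => x; rewrite addrA ?addNr ?subrr add0r.
  by apply: eq_avg => b; rewrite mulrn_ordB addrA subrK.
have av j : avg (fun i : 'I_n.+1 => \prod_(l in u) kernel_corr (z l *+ (i - j)%R)) =
    avg (fun i : 'I_n.+1 => \prod_(l in u) kernel_corr (z l *+ i)).
  rewrite (@reindex_avg _ _ _ (fun i => i - j) (fun i : 'I_n.+1 => \prod_(l in u) kernel_corr (z l *+ i)))//.
  by exists (fun x => x + j) => x; rewrite ?subrK ?addrK.
rewrite exchange_avg; under eq_avg do rewrite av.
by rewrite avg_const ?card_ord.
Qed.

Lemma avg_prod_corr_ge0 u : 0 <= avg (fun i : 'I_n.+1 => \prod_(l in u) kernel_corr (z l *+ i)).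
Proof.
rewrite -avg_lat_kernel_sqr; apply: avg_ge0 => m; apply: avg_ge0 => y.
exact: sqr_ge0.
Qed.

(* [kernel_corr t] is [B2 (t / N)] up to a constant [(6 N^2)^-1 >= 0], and all the
   lattice averages of products of [kernel_corr] are nonnegative. *)
Lemma avg_prod_corr_le u :
  avg (fun i : 'I_n.+1 => \prod_(l in u) kernel_corr (z l *+ i)) <=
  avg (fun i : 'I_n.+1 => \prod_(l in u) B2 ((z l *+ i)%R%:R / N)).
Proof.
set c : R := (6 * N ^+ 2)^-1.
have c0 : 0 <= c by rewrite invr_ge0 mulr_ge0// exprn_ge0.
have B2E (t : 'I_n.+1) : B2 (t%:R / N) = kernel_corr t + c.
  by rewrite /kernel_corr kap_correlation subrK.
have -> : avg (fun i : 'I_n.+1 => \prod_(l in u) B2 ((z l *+ i)%R%:R / N)) =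
  \sum_(w : {set 'I_d} | w \subset u) c ^+ #|u :\: w| *
     avg (fun i : 'I_n.+1 => \prod_(l in w) kernel_corr (z l *+ i)).
  under [RHS]eq_bigr do rewrite -avgZ.
  rewrite -avg_sum; apply: eq_avg => i; under eq_bigr do rewrite B2E.
  rewrite -prod_ifin.
  transitivity (\prod_l ((if l \in u then kernel_corr (z l *+ i) else 0) +
                         (if l \in u then c else 1))).
    by apply: eq_bigr => l _; case: ifP => _; rewrite ?add0r.
  rewrite bigA_distr/= [RHS]big_mkcond/=; apply: eq_bigr => w _.
  case: ifPn => [wu|/subsetPn[l lw lu]]; last first.
    by rewrite (bigD1 l)//= lw (negbTE lu) mul0r.
  rewrite -prodr_const -!prod_ifin -big_split/=; apply: eq_bigr => l _.
  rewrite inE; case: ifPn => lw /=; last by rewrite mulr1.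
  by rewrite (fintype.subsetP wu _ lw) mul1r.
rewrite (bigD1 u)//= finset.setDv cards0 expr0 mul1r lerDl.
apply: sumr_ge0 => w _; apply: mulr_ge0; first exact: exprn_ge0.
exact: avg_prod_corr_ge0.
Qed.

Lemma kap0 (x : 'I_n.+1) : kap x 0 = 0.
Proof. by rewrite /kap mul0r subr0. Qed.

(** A weight [gam u] may be 0, as happens for the inner weights when some [b j] vanishes. The
    quotient is then 0 by convention, and [B u = 0] ensures that no contribution is lost with it. *)
Theorem lattice_variance F (B gam : {set 'I_d} -> R) :
  (forall u, 0 <= gam u) -> (forall u, gam u = 0 -> B u = 0) ->
  (forall u y, u != finset.set0 -> (forall l, l \in u -> y l != 0) ->
     `|mdiff u F y| <= B u) ->
  avg (fun m => (avg (fun i => F (lat m i)) - avg F) ^+ 2) <=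
  (\sum_(u : {set 'I_d} | u != finset.set0) B u ^+ 2 / gam u) *
  \sum_(u : {set 'I_d} | u != finset.set0)
     gam u * avg (fun i : 'I_n.+1 => \prod_(l in u) B2 ((z l *+ i)%R%:R / N)).
Proof.
move=> g0 gB HB.
set S := \sum_(u | _) B u ^+ 2 / gam u.
have S0 : 0 <= S by apply: sumr_ge0 => u _; rewrite divr_ge0// sqr_ge0.
pose k u m y := avg (fun i => \prod_(l in u) kap (lat m i l) (y l)).
have E m : avg (fun i => F (lat m i)) - avg F =
    avg (fun y => \sum_(u : {set 'I_d} | u != finset.set0) k u m y * mdiff u F y).
  under eq_avg do rewrite anova_expand.
  rewrite exchange_avg -avgB; apply: eq_avg => y.
  rewrite avg_sum (bigD1 finset.set0)//= [X in X + _ - _](_ : _ = F y).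
    by rewrite addrC addKr; apply: eq_bigr => u _; rewrite avgZr.
  rewrite -[RHS](@avg_const _ 'I_n.+1) ?card_ord//; apply: eq_avg => i.
  rewrite big_set0 mul1r /mdiff cards0 expr0 mul1r.
  rewrite (bigD1 finset.set0) ?finset.sub0set//= big1 ?addr0; last first.
    by move=> w /andP[]; rewrite finset.subset0 => /eqP ->; rewrite eqxx.
  rewrite cards0 expr0 mul1r; congr F; apply/ffunP => l.
  by rewrite ffunE inE.
have key m y : (\sum_(u : {set 'I_d} | u != finset.set0) k u m y * mdiff u F y) ^+ 2 <=
    S * \sum_(u : {set 'I_d} | u != finset.set0) gam u * k u m y ^+ 2.
  pose t u := Num.sqrt (gam u) * k u m y.
  (* The indicator removes the [y] with a zero coordinate in [u], where [mdiff u F y] is not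
     controlled; there the kernel factor [k u m y] is 0. *)
  pose s u := mdiff u F y * (if [forall (l | l \in u), y l != 0] then 1 else 0) / Num.sqrt (gam u).
  have bad u : ~~ [forall (l | l \in u), y l != 0] -> k u m y = 0.
    rewrite negb_forall => /existsP[l]; rewrite negb_imply negbK => /andP[lu /eqP yl].
    rewrite /k -[RHS](@avg_const _ 'I_n.+1) ?card_ord//; apply: eq_avg => i.
    by rewrite (bigD1 l)//= yl kap0 mul0r.
  have -> : \sum_(u : {set 'I_d} | u != finset.set0) k u m y * mdiff u F y =
            \sum_(u : {set 'I_d} | u != finset.set0) s u * t u.
    apply: eq_bigr => u u0; rewrite /s /t; case: ifPn => [/forall_inP yu|/bad ->]; last by rewrite mul0r !mulr0.
    rewrite mulr1; have [gu|gu] := eqVneq (gam u) 0.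
      have := HB u y u0 yu; rewrite gB// normr_le0 => /eqP ->.
      by rewrite mulr0 !mul0r.
    by rewrite mulrC -[in RHS]mulrA mulKf// sqrtr_eq0 -ltNge lt_neqAle eq_sym gu g0.
  apply: (le_trans (cauchy_schwarz_sum _ _ _)).
  apply: ler_pM; [by apply: sumr_ge0 => u _; exact: sqr_ge0|by apply: sumr_ge0 => u _; exact: sqr_ge0| |].
    apply: ler_sum => u u0; rewrite /s exprMn exprVn sqr_sqrtr//.
    rewrite ler_wpM2r ?invr_ge0//; case: ifPn => [/forall_inP yu|_]; last by rewrite mulr0 expr0n/= sqr_ge0.
    rewrite mulr1 -[X in X <= _]real_normK ?num_real// ler_sqr ?nnegrE//; first exact: HB.
    by apply: le_trans (HB _ _ u0 yu).
  by apply: ler_sum => u _; rewrite /t exprMn sqr_sqrtr.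
apply: (@le_trans _ _ (avg (fun m => avg (fun y => S * \sum_(u : {set 'I_d} | u != finset.set0) gam u * k u m y ^+ 2)))).
  apply: ler_avg => m; rewrite E; apply: (le_trans (avg_sqr_le _ _)) => //.
  by apply: ler_avg => y; exact: key.
under eq_avg => m.
  under eq_avg => y do under eq_bigr do rewrite -/(k _ _ _).
  rewrite avgZ avg_sum; under eq_bigr do rewrite avgZ.
  over.
rewrite avgZ avg_sum ler_wpM2l//; apply: ler_sum => u _.
by rewrite avgZ ler_wpM2l// avg_lat_kernel_sqr avg_prod_corr_le.
Qed.
End lattice_variance.

(** * The component-by-component bound *)

Section odd_sums.
Context {R : realType}.

Definition b2 (N t : nat) : R := B2 ((t %% N)%:R / N%:R).

Lemma fracpart_grid (N t : nat) (r : R) : (0 < N)%N -> 0 <= r < N%:R^-1 ->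
  fracpart (t%:R / N%:R + r) = (t %% N)%:R / N%:R + r.
Proof.
move=> N0 /andP[r0 r1]; have NR : 0 < N%:R :> R by rewrite ltr0n.
have E : t%:R / N%:R + r = (t %/ N)%:R + ((t %% N)%:R / N%:R + r).
  rewrite {1}(divn_eq t N) natrD natrM mulrDl mulfK ?gt_eqF//.
  by rewrite addrA.
have ge : 0 <= (t %% N)%:R / N%:R + r by rewrite addr_ge0// divr_ge0.
have lt : (t %% N)%:R / N%:R + r < 1.
  rewrite (@lt_le_trans _ _ ((t %% N).+1%:R / N%:R))//.
    by rewrite -natr1 mulrDl mul1r ltrD2l.
  by rewrite ler_pdivrMr// mul1r ler_nat ltn_mod.
rewrite /fracpart E (_ : Num.floor _ = (t %/ N)%:Z).
  by rewrite addrC addKr.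
apply: Num.Theory.floor_def; rewrite !pmulrn lerDl ge/=.
by rewrite intrD ltrD2l.
Qed.

Lemma B2_fracpart (N t : nat) : (0 < N)%N -> B2 (fracpart (t%:R / N%:R)) = b2 N t.
Proof.
move=> N0; rewrite /b2 -[X in fracpart X]addr0 fracpart_grid// ?addr0//.
by rewrite lexx invr_gt0 ltr0n.
Qed.

Lemma b2_mod N t : b2 N (t %% N) = b2 N t.
Proof. by rewrite /b2 modn_mod. Qed.

Lemma b2_double N t : (0 < N)%N -> b2 (2 * N) (2 * t) = b2 N t.
Proof.
move=> N0; rewrite /b2 -muln_modr !natrM; congr B2.
have : N%:R != 0 :> R by rewrite pnatr_eq0 -lt0n.
by move: (N%:R) => M M0; field.
Qed.

Lemma normr_B2_le (x : R) : 0 <= x <= 1 -> `|B2 x| <= 6^-1.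
Proof.
move=> /andP[x0 x1]; rewrite /B2 ler_norml; apply/andP; split; last by nra.
have := sqr_ge0 (x - 2^-1); nra.
Qed.

Lemma normr_b2_le N t : (0 < N)%N -> `|b2 N t| <= 6^-1.
Proof.
move=> N0; apply: normr_B2_le; rewrite divr_ge0//= ler_pdivrMr ?ltr0n// mul1r ler_nat.
by rewrite ltnW// ltn_mod.
Qed.

Lemma sum_b2 N : (0 < N)%N -> \sum_(c < N) b2 N c = (6 * N%:R)^-1.
Proof.
move=> N0; have NR : N%:R != 0 :> R by rewrite pnatr_eq0 -lt0n.
under eq_bigr => c _.
  rewrite /b2 modn_small// /B2 (_ : _ + _ = N%:R ^- 2 * c%:R ^+ 2 - N%:R^-1 * c%:R + 6^-1); first over.
  by move: N%:R NR => M M0; field.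
rewrite big_split sumrB/= -!mulr_sumr sum_nat_sqr sum_nat_id sumr_const card_ord -[6^-1 *+ N]mulr_natr.
by move: N%:R NR => M M0; field.
Qed.

(** Multiplication by [i] permutes the residues modulo [N]. *)
Lemma sum_b2_coprime N i : (0 < N)%N -> coprime i N ->
  \sum_(c < N) b2 N (i * c) = (6 * N%:R)^-1.
Proof.
case: N => // N _ iN.
rewrite -sum_b2// [RHS](reindex_inj (h := fun c : 'I_N.+1 => inord ((i * c) %% N.+1))).
  by apply: eq_bigr => c _; rewrite inordK ?ltn_mod// b2_mod.
move=> c c' /(congr1 val); rewrite /= !inordK ?ltn_mod// => cc'.
apply/val_inj => /=.
wlog le_cc : c c' cc' / (c <= c')%N.
  by move=> H; case/orP: (leq_total c c') => h; [exact: H|apply/esym; exact: H].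
apply/eqP; rewrite eqn_leq le_cc/= -subn_eq0.
have : (N.+1 %| i * (c' - c))%N.
  by rewrite mulnBr -eqn_mod_dvd ?leq_mul2l ?le_cc ?orbT//; apply/eqP.
rewrite Gauss_dvdr; last by rewrite coprime_sym.
case: (posnP (c' - c)%N) => [->//|h] /(dvdn_leq h).
by have := ltn_ord c'; lia.
Qed.

Lemma sum_even_odd (V : nmodType) (m : nat) (f : nat -> V) :
  \sum_(i < 2 * m) f i = \sum_(i < m) (f (2 * i)%N + f (2 * i).+1).
Proof.
elim: m => [|m IH]; first by rewrite muln0 !big_ord0.
by rewrite mulnS !addSn add0n !big_ord_recr/= IH addrA.
Qed.

Definition sumU (l i : nat) : R := \sum_(c < 2 ^ l) b2 (2 ^ l) (i * c).
Definition sumM (l i : nat) : R := \sum_(c < 2 ^ l) (if odd c then b2 (2 ^ l) (i * c) else 0).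

(** The even [c] reproduce the full sum of the previous level. A sum over odd [c] is thus a
    difference of two full sums, both explicit when [i] is odd. *)
Lemma sumU_split l i : sumU l.+1 i = sumM l.+1 i + sumU l i.
Proof.
rewrite /sumU /sumM expnS (sum_even_odd _ (fun c => b2 (2 * 2 ^ l) (i * c))).
rewrite (sum_even_odd _ (fun c => if odd c then b2 (2 * 2 ^ l) (i * c) else 0)).
rewrite -big_split/=; apply: eq_bigr => c _.
by rewrite oddM/= add0r addrC mulnCA b2_double ?expn_gt0.
Qed.

Lemma sumM_odd l i : odd i -> sumM l.+1 i = - (6 * 2 ^+ l.+1)^-1.
Proof.
move=> oi; have ic k : coprime i (2 ^ k) by rewrite coprimeXr ?coprimen2.
have -> : sumM l.+1 i = sumU l.+1 i - sumU l i by rewrite sumU_split addrK.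
rewrite /sumU !sum_b2_coprime ?expn_gt0// !natrX exprS.
have : (2 ^+ l : R) != 0 by rewrite expf_neq0.
by move: (2 ^+ l : R) => M M0; field.
Qed.

(** At [2 * i] the summand has period [2 ^ l.+1] in [c]; this period is even, so the odd residues
    are run through twice. *)
Lemma sumM_even l i : sumM l.+2 (2 * i) = 2 * sumM l.+1 i.
Proof.
rewrite /sumM !(expnS _ l.+1).
under eq_bigr do rewrite -mulnA b2_double ?expn_gt0//.
rewrite mul2n -addnn big_split_ord/= mulr_natl mulr2n; congr (_ + _).
apply: eq_bigr => c _; rewrite oddD oddX/=.
by rewrite -[in LHS]b2_mod mulnDr modnMDl b2_mod.
Qed.

(** Even arguments give twice the sum of the previous level and odd ones add [12^-1] in total, that
    is, the recursion [S' = 2 S + 12^-1]. *)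
Lemma sum_normr_sumM l :
  \sum_(i < 2 ^ l.+1) `|sumM l.+1 i| = 2 ^+ l / 3 - 12^-1.
Proof.
elim: l => [|l IH].
  rewrite big_ord_recl big_ord1 /sumM !big_ord_recl !big_ord0/=.
  rewrite /b2 !modn_small// !mul0r /B2 /bump/= !add0r !addr0.
  rewrite expr0n/= subr0 add0r.
  rewrite !addn0 muln1 expn1 (ger0_norm (x := 6^-1))// ltr0_norm.
    by field.
  by lra.
rewrite expnS (sum_even_odd _ (fun i => `|sumM l.+2 i|)) big_split/=.
under eq_bigr do rewrite sumM_even normrM ger0_norm//.
rewrite -mulr_sumr IH.
under eq_bigr => i _ do rewrite sumM_odd ?oddS ?oddM//= normrN ger0_norm//.
rewrite sumr_const card_ord -[_ *+ (2 ^ l.+1)]mulr_natr natrX !exprS.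
have : (2 ^+ l : R) != 0 by rewrite expf_neq0.
by move: (2 ^+ l : R) => M M0; field.
Qed.

End odd_sums.

(** * Comparison of the selected component with the average candidate *)

Section cbc_bound.
Context {R : realType}.
Local Notation b2 := (@b2 R).

Lemma sum_period (f : nat -> R) N : f N = f 0%N -> \sum_(1 <= i < N.+1) f i = \sum_(i < N) f i.
Proof.
move=> fN; have : \sum_(0 <= i < N.+1) f i = \sum_(0 <= i < N) f i + f N by rewrite big_nat_recr.
by rewrite big_ltn// fN addrC => /addIr ->; rewrite big_mkord.
Qed.

(** The absolute value is taken for each [i] because the factor from the components already chosen
    has unknown sign. For [N >= 2] the candidates are the [N / 2] odd numbers. Writing
    [3^-1 = 2 * 6^-1] explains the constant 2 of the final bound. *)
Lemma sum_normr_candidates l N : N = (2 ^ l)%N ->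
  \sum_(1 <= i < N.+1) `|\sum_(1 <= c < N.+1 | coprime c N) b2 N (i * c)| <=
  3^-1 * \sum_(1 <= c < N.+1 | coprime c N) 1.
Proof.
case: l => [|l] NE.
  rewrite (_ : N = 1%N)// big_nat1 !big_mkcond !big_nat1/= /b2 modn1 mul0r /B2 expr0n/= subrr add0r.
  by rewrite ger0_norm// big_mkcond big_nat1/=; lra.
have N0 : (0 < N)%N by rewrite NE expn_gt0.
have cop c : coprime c N = odd c by rewrite NE coprime_pexpr// coprimen2.
have oN : odd N = false by rewrite NE oddX.
have E i : \sum_(1 <= c < N.+1 | coprime c N) b2 N (i * c) = sumM l.+1 i.
  rewrite big_mkcond/= (sum_period (f := fun c => if coprime c N then b2 N (i * c) else 0)).
    by rewrite /sumM -NE; apply: eq_bigr => c _; rewrite cop.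
  by rewrite !cop oN.
under eq_bigr do rewrite E.
rewrite (sum_period (f := fun i => `|sumM l.+1 i|)); last first.
  rewrite /sumM -NE; congr `| _ |; apply: eq_bigr => c _; case: ifP => // _.
  by rewrite -b2_mod modnMr mul0n.
rewrite [in X in X <= _]NE sum_normr_sumM big_mkcond/= (sum_period (f := fun c => if coprime c N then 1 else 0)); last first.
  by rewrite !cop oN.
under [X in _ <= _ * X]eq_bigr do rewrite cop.
rewrite NE expnS (sum_even_odd _ (fun c => if odd c then 1 else 0)).
under [X in _ <= _ * X]eq_bigr => c _ do rewrite /= !oddM/= add0r.
by rewrite sumr_const card_ord natrX; lra.
Qed.

Variables (d l : nat) (gam : {set 'I_d} -> R) (z : 'I_d -> nat).
Local Notation N := (2 ^ l)%N.
Hypothesis gam0 : forall u, 0 <= gam u.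
Hypothesis hz : cbc gam N z.

Let N0 : (0 < N)%N. Proof. by rewrite expn_gt0. Qed.

Let quality (z : 'I_d -> nat) (u : {set 'I_d}) : R :=
  N%:R^-1 * \sum_(1 <= i < N.+1) \prod_(h in u) b2 N (i * z h).

Let below J (u : {set 'I_d}) := [forall h in u, (h < J)%N].

Let cbc_errorE z' j : cbc_error gam N z' j =
  \sum_(u | (u != finset.set0) && below j.+1 u) gam u * quality z' u.
Proof.
apply: eq_bigr => u _; congr (_ * (_ * _)); apply: eq_bigr => i _.
by apply: eq_bigr => h _; rewrite B2_fracpart.
Qed.

(** The part of the criterion that varies with the choice at [j]: the sets [u] with largest element
    [j]. *)
Let step (j : 'I_d) (c : nat) : R :=
  \sum_(u | (u != finset.set0) && below j.+1 u && (j \in u))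
    gam u * quality (fun h => if h == j then c else z h) u.

Let belowS (j : 'I_d) u : below j.+1 u && (j \notin u) = below j u.
Proof.
apply/andP/forall_inP => [[/forall_inP uj ju] h hu|uj].
  have := uj h hu; rewrite ltnS leq_eqVlt => /predU1P[/val_inj hj|//].
  by move: ju; rewrite -hj hu.
split; first by apply/forall_inP => h /uj /leqW.
by apply/negP => /uj; rewrite ltnn.
Qed.

Let cbc_error_split (j : 'I_d) c :
  cbc_error gam N (fun h => if h == j then c else z h) j =
  step j c + \sum_(u | (u != finset.set0) && below j u) gam u * quality z u.
Proof.
rewrite cbc_errorE (bigID (fun u : {set 'I_d} => j \in u))/=; congr (_ + _).
rewrite (eq_bigl (fun u => (u != finset.set0) && below j u)); last first.
  by move=> u; rewrite -andbA belowS.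
apply: eq_bigr => u /andP[_]; rewrite -belowS => /andP[_ ju]; congr (_ * (_ * _)).
apply: eq_bigr => i _; apply: eq_bigr => h hu; case: eqP => // hj.
by move: ju; rewrite -hj hu.
Qed.

Let step_self (j : 'I_d) : cbc_error gam N z j =
  step j (z j) + \sum_(u | (u != finset.set0) && below j u) gam u * quality z u.
Proof.
rewrite -cbc_error_split; congr cbc_error; apply/funext => h.
by case: eqP => // ->.
Qed.

Let bound (j : 'I_d) : R :=
  \sum_(u | (u != finset.set0) && below j.+1 u && (j \in u)) gam u * (6^-1) ^+ #|u|.

(** For fixed [u] the candidate occurs only in the factor of [j]. The other [#|u| - 1] factors are
    at most [6^-1] in absolute value, and the sum over candidates supplies the last [6^-1] with the
    constant 2. *)
Let step_sum (j : 'I_d) :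
  \sum_(1 <= c < N.+1 | coprime c N) step j c <=
  (2 / N%:R * bound j) * \sum_(1 <= c < N.+1 | coprime c N) 1.
Proof.
rewrite /step exchange_big/= /bound [2 / _ * _]mulr_sumr [X in _ <= X]mulr_suml.
apply: ler_sum => u /andP[_ ju].
rewrite -mulr_sumr [2 / _ * _]mulrCA -!mulrA ler_wpM2l//.
rewrite -mulr_sumr exchange_big/= [X in _ <= X]mulrCA ler_wpM2l ?invr_ge0//.
pose p i := \prod_(h in u :\ j) b2 N (i * z h).
have E i : \sum_(1 <= c < N.+1 | coprime c N)
     \prod_(h in u) b2 N (i * (if h == j then c else z h)) =
   p i * \sum_(1 <= c < N.+1 | coprime c N) b2 N (i * c).
  rewrite mulr_sumr; apply: eq_bigr => c _.
  rewrite (bigD1 j)//= eqxx mulrC; congr (_ * _).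
  rewrite /p; apply: eq_big => [h|h /andP[_ /negbTE ->]//].
  by rewrite !inE andbC.
under eq_bigr do rewrite E.
have pl i : `|p i| <= (6^-1) ^+ #|u|.-1.
  rewrite (cardsD1 j u) ju add1n/= normr_prod -prodr_const.
  by apply: ler_prod => h _; rewrite normr_ge0 normr_b2_le.
have u1 : (0 < #|u|)%N by apply/card_gt0P; exists j.
apply: (@le_trans _ _ ((6^-1) ^+ #|u|.-1 *
    \sum_(1 <= i < N.+1) `|\sum_(1 <= c < N.+1 | coprime c N) b2 N (i * c)|)).
  rewrite mulr_sumr; apply: ler_sum => i _.
  by apply: (le_trans (ler_norm _)); rewrite normrM ler_wpM2r.
rewrite -[in X in _ <= X](prednK u1) exprS.
have -> : 2 * (6^-1 * (6^-1) ^+ #|u|.-1 * \sum_(1 <= c < N.+1 | coprime c N) 1) =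
   (6^-1) ^+ #|u|.-1 * (3^-1 * \sum_(1 <= c < N.+1 | coprime c N) 1) :> R.
  by move: (6^-1 ^+ _) (\sum_(1 <= c < _ | _) _) => a t; field.
by rewrite ler_wpM2l ?exprn_ge0 ?invr_ge0// (sum_normr_candidates (l := l)).
Qed.

(** A minimum over the candidates is at most their mean; the terms of the criterion without [j] are
    common to all candidates and cancel. *)
Let step_le (j : 'I_d) : step j (z j) <= 2 / N%:R * bound j.
Proof.
(* The first component is 1 by definition and not a minimiser, but there [u] is a singleton and the
   sum is explicit. *)
have [j0|j0] := eqVneq (j : nat) 0%N.
  have := hz j; rewrite j0 eqxx => zj.
  have only u : (u != finset.set0) && below j.+1 u && (j \in u) -> u = [set j]%SET.
    move=> /andP[/andP[_ /forall_inP uj] ju]; apply/finset.setP => h; rewrite !inE.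
    apply/idP/eqP => [hu|->//]; apply/val_inj => /=.
    by have := uj _ hu; rewrite j0 ltnS leqn0 => /eqP.
  rewrite /step /bound mulr_sumr; apply: ler_sum => u /only ->.
  rewrite cards1 [X in _ <= X]mulrCA ler_wpM2l// /quality.
  rewrite -mulrA [X in _ <= X]mulrCA ler_wpM2l ?invr_ge0//.
  under eq_bigr do rewrite big_set1 eqxx zj muln1.
  rewrite (sum_period (f := fun i => b2 N i)); last by rewrite -b2_mod modnn.
  rewrite sum_b2// invfM ler_pdivrMr ?ltr0n// expr1.
  have : (1 : R) <= N%:R by rewrite ler1n.
  by lra.
have cand : (0 : R) < \sum_(1 <= c < N.+1 | coprime c N) 1.
  by rewrite big_ltn_cond// coprime1n ltr_pwDl// sumr_ge0.
rewrite -(ler_pM2r cand); apply: le_trans (step_sum j).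
rewrite mulr_sumr big_nat_cond [X in _ <= X]big_nat_cond; apply: ler_sum => c /andP[/andP[c1 cN] cc].
rewrite mulr1; have := hz j; rewrite (negbTE j0) => -[_ /(_ c)].
rewrite /cbc_candidate c1 -ltnS cN cc => /(_ erefl).
by rewrite step_self cbc_error_split lerD2r.
Qed.

Theorem cbc_bound :
  \sum_(u : {set 'I_d} | u != finset.set0) gam u *
    (N%:R^-1 * \sum_(1 <= i < N.+1) \prod_(h in u) b2 N (i * z h)) <=
  2 / N%:R * \sum_(u : {set 'I_d} | u != finset.set0) gam u * (6^-1) ^+ #|u|.
Proof.
suff key J : (J <= d)%N ->
    \sum_(u | (u != finset.set0) && below J u) gam u * quality z u <=
    2 / N%:R * \sum_(u | (u != finset.set0) && below J u) gam u * (6^-1) ^+ #|u|.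
  have := key d (leqnn d).
  have all u : below d u by apply/forall_inP => h _; exact: ltn_ord.
  by under eq_bigl do rewrite all andbT; under [X in _ <= _ * X]eq_bigl do rewrite all andbT.
elim: J => [_|J IH Jd].
  have none u : (u != finset.set0) && below 0 u = false.
    by apply/negP => /andP[/set0Pn[h hu] /forall_inP /(_ h hu)].
  by rewrite !(eq_bigl _ _ none) !big_pred0_eq mulr0.
pose j := Ordinal Jd.
(* Sets containing [j] are charged to the choice of the component [j], the others to the earlier
   components. *)
rewrite (bigID (fun u : {set 'I_d} => j \in u))/= [X in _ <= _ * X](bigID (fun u : {set 'I_d} => j \in u))/=.
rewrite mulrDr; apply: lerD.
  have := step_le j; rewrite /step; apply: le_trans.
  rewrite le_eqVlt; apply/orP; left; apply/eqP; apply: eq_bigr => u _.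
  congr (_ * (_ * _)); apply: eq_bigr => i _; apply: eq_bigr => h _.
  by case: eqP => // ->.
under eq_bigl do rewrite -andbA (belowS j).
under [X in _ <= _ * X]eq_bigl do rewrite -andbA (belowS j).
by apply: IH; rewrite ltnW.
Qed.
End cbc_bound.

Section cbc_variance.
Context {R : realType} (n d l : nat).
Hypothesis hN : (2 ^ l = n.+1)%N.
Local Notation N := (n.+1%:R : R).
Local Notation X := {ffun 'I_d -> 'I_n.+1}.
Variables (gam : {set 'I_d} -> R) (z : 'I_d -> nat).
Hypothesis gam0 : forall u, 0 <= gam u.
Hypothesis hz : cbc gam (2 ^ l) z.

Definition zmod (h : 'I_d) : 'I_n.+1 := inZp (z h).

Lemma val_zmod_mulrn h (i : nat) : (zmod h *+ i : 'I_n.+1) = (i * z h %% n.+1)%N :> nat.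
Proof. by rewrite Zp_mulrn /= modnMml mulnC. Qed.

Lemma avg_B2_zmod (u : {set 'I_d}) :
  avg (fun i : 'I_n.+1 => \prod_(h in u) B2 ((zmod h *+ i)%R%:R / N)) =
  N^-1 * \sum_(1 <= i < n.+2) \prod_(h in u) b2 n.+1 (i * z h).
Proof.
rewrite (sum_period (f := fun i => \prod_(h in u) b2 n.+1 (i * z h))); last first.
  by apply: eq_bigr => h _; rewrite -b2_mod modnMr mul0n.
rewrite /avg card_ord; congr (_ * _); apply: eq_bigr => i _; apply: eq_bigr => h _.
by rewrite val_zmod_mulrn.
Qed.

Theorem cbc_variance (F : X -> R) (B : {set 'I_d} -> R) :
  (forall u : {set 'I_d}, gam u = 0 -> B u = 0) ->
  (forall (u : {set 'I_d}) (y : X), u != finset.set0 -> (forall l, l \in u -> y l != 0) ->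
     `|mdiff u F y| <= B u) ->
  avg (fun m => (avg (fun i => F (lat zmod m i)) - avg F) ^+ 2) <=
  (\sum_(u : {set 'I_d} | u != finset.set0) B u ^+ 2 / gam u) *
  (2 * \sum_(u : {set 'I_d} | u != finset.set0) gam u * (6^-1) ^+ #|u|) / N.
Proof.
move=> gB HB; apply: le_trans (lattice_variance zmod gam0 gB HB) _.
rewrite -mulrA ler_wpM2l//.
  by apply: sumr_ge0 => u _; rewrite divr_ge0// sqr_ge0.
under eq_bigr do rewrite avg_B2_zmod.
by have := cbc_bound gam0 hz; rewrite hN mulrAC.
Qed.
End cbc_variance.

(** * Mixed differences *)

Section subset_sums.
Context {I : finType}.
Implicit Types (u v w : {set I}).

Lemma big_subsetU1 (V : nmodType) j u (F : {set I} -> V) : j \notin u ->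
  \sum_(w : {set I} | w \subset j |: u) F w =
  \sum_(w : {set I} | w \subset u) (F w + F (j |: w)).
Proof.
move=> ju; rewrite (bigID (fun w : {set I} => j \in w))/= addrC big_split/=; congr (_ + _).
  apply: eq_bigl => w; apply/andP/idP => [[/fintype.subsetP wu jw]|wu].
    apply/fintype.subsetP => h hw; have := wu h hw; rewrite !inE => /predU1P[hj|//].
    by rewrite -hj hw in jw.
  split; first by rewrite (fintype.subset_trans wu)// finset.subsetUr.
  by apply: contra ju => /(fintype.subsetP wu).
rewrite (reindex_onto (fun w => j |: w) (fun w => w :\ j))/=; last first.
  by move=> w /andP[_ jw]; rewrite finset.setD1K.
apply: eq_bigl => w; rewrite finset.setU11 andbT.
apply/andP/idP => [[/fintype.subsetP wu /eqP E]|wu].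
  apply/fintype.subsetP => h hw; have : h \in j |: w by rewrite !inE hw orbT.
  move/wu; rewrite !inE => /predU1P[hj|//].
  by move: hw; rewrite -E !inE hj eqxx.
rewrite finset.setUS//; split=> //; rewrite finset.setU1K//.
by apply: contra ju => /(fintype.subsetP wu).
Qed.

Lemma sum_by_card (R : realType) u (g : nat -> R) :
  \sum_(w : {set I} | w \subset u) g #|w| =
  \sum_(i < #|u|.+1) 'C(#|u|, i)%:R * g i.
Proof.
have lt w : w \subset u -> (#|w| < #|u|.+1)%N by move=> wu; rewrite ltnS subset_leq_card.
rewrite (partition_big (fun w : {set I} => inord #|w| : 'I_#|u|.+1) xpredT)//=.
apply: eq_bigr => i _.
rewrite (eq_bigr (fun _ => g i)); last first.
  by move=> w /andP[wu /eqP <-]; rewrite inordK ?lt.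
rewrite sumr_const mulr_natl; congr (_ *+ _); rewrite -cards_draws -sum1dep_card -sum1_card.
apply: eq_bigl => w; rewrite unfold_in; case wu: (w \subset u) => //=.
apply/eqP/eqP => [<-|wi]; first by rewrite inordK ?lt.
by apply/val_inj; rewrite /= inordK ?lt.
Qed.
End subset_sums.

Lemma disjoint_setU1 (I : finType) (j : I) (u v : {set I}) :
  [disjoint j |: u & v]%B = (j \notin v) && [disjoint u & v]%B.
Proof. by rewrite !finset.disjoints_subset finset.subUset finset.sub1set inE. Qed.

Section mixed_differences.
Context {R : realType} {I : finType}.
Implicit Types (u v w : {set I}) (a b : {set I} -> R) (A B : {set I} -> R).

(* mixed difference at [v] in the directions of [u], of a function on the vertices of a
   cube, a vertex being given by the set of coordinates that have been moved *)
Definition bdiff u a v : R :=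
  \sum_(w : {set I} | w \subset u) (-1) ^+ #|u :\: w| * a (v :|: w).

(** [v] lists the coordinates already moved; disjointness restricts to the genuine faces of the
    cube, at every base point. *)
Definition bnd A a := forall u v, [disjoint u & v]%B -> `|bdiff u a v| <= A u.

Lemma bdiff0 a v : bdiff finset.set0 a v = a v.
Proof.
rewrite /bdiff (bigD1 finset.set0)//= big1 ?addr0; last first.
  by move=> w /andP[]; rewrite finset.subset0 => /eqP ->; rewrite eqxx.
by rewrite finset.setDv cards0 expr0 mul1r finset.setU0.
Qed.

Lemma bdiffU1 j u a v : j \notin u ->
  bdiff (j |: u) a v = bdiff u a (j |: v) - bdiff u a v.
Proof.
move=> ju; rewrite /bdiff big_subsetU1// -sumrB; apply: eq_bigr => w wu.
have jw : j \notin w by apply: contra ju => /(fintype.subsetP wu).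
have -> : (j |: u) :\: (j |: w) = u :\: w.
  by apply/finset.setP => h; rewrite !inE; case: eqP => [->|]//=; rewrite (negbTE ju) andbF.
have -> : (j |: u) :\: w = j |: (u :\: w).
  by apply/finset.setP => h; rewrite !inE; case: eqP => [->|]//=; rewrite jw.
rewrite cardsU1 !inE (negbTE ju) andbF/= add1n exprS mulN1r mulNr addrC.
by rewrite finset.setUCA finset.setUA.
Qed.

Lemma eq_bdiff u a b v : (forall w, w \subset u -> a (v :|: w) = b (v :|: w)) ->
  bdiff u a v = bdiff u b v.
Proof. by move=> ab; apply: eq_bigr => w wu; rewrite ab. Qed.

Lemma bdiffD u a b v : bdiff u (fun w => a w + b w) v = bdiff u a v + bdiff u b v.
Proof. by rewrite /bdiff -big_split; apply: eq_bigr => w _; rewrite mulrDr. Qed.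

Lemma bdiffZ u c a v : bdiff u (fun w => c * a w) v = c * bdiff u a v.
Proof. by rewrite /bdiff mulr_sumr; apply: eq_bigr => w _; rewrite mulrCA. Qed.

Lemma bdiff_0 u v : bdiff u (fun=> 0) v = 0.
Proof. by rewrite /bdiff big1// => w _; rewrite mulr0. Qed.

Lemma bdiff_shift u j a v : bdiff u (fun w => a (j |: w)) v = bdiff u a (j |: v).
Proof. by apply: eq_bigr => w _; rewrite finset.setUA. Qed.

Lemma bdiff_delta u j a v : j \notin u ->
  bdiff u (fun w => a (j |: w) - a w) v = bdiff (j |: u) a v.
Proof.
move=> ju; rewrite bdiffU1// -bdiff_shift -[X in _ = _ - X]mul1r -mulNr -bdiffZ -bdiffD.
by apply: eq_bdiff => w _; rewrite mulN1r.
Qed.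

Lemma bdiff_fixed u j a v : j \in u ->
  (forall w, a (j |: w) = a w) -> bdiff u a v = 0.
Proof.
move=> ju aj; rewrite -(finset.setD1K ju) bdiffU1 ?inE ?eqxx// -bdiff_shift.
by rewrite (eq_bdiff (b := a)) ?subrr.
Qed.

Lemma bdiff_const u c v : u != finset.set0 -> bdiff u (fun=> c) v = 0.
Proof. by move=> /set0Pn[j ju]; apply: (bdiff_fixed v ju). Qed.

Lemma bnd_ge0 A a u : bnd A a -> 0 <= A u.
Proof.
move=> /(_ u finset.set0); rewrite disjoint_sym => /(_ _)/(le_trans _); apply=> //.
by rewrite finset.disjoints_subset finset.sub0set.
Qed.

Lemma bnd_norm A a v : bnd A a -> `|a v| <= A finset.set0.
Proof.
move=> /(_ finset.set0 v); rewrite bdiff0; apply.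
by rewrite finset.disjoints_subset finset.sub0set.
Qed.

Lemma bnd_le A B a : (forall u, A u <= B u) -> bnd A a -> bnd B a.
Proof. by move=> AB Aa u v uv; exact: le_trans (Aa u v uv) (AB u). Qed.

Lemma bndD A B a b : bnd A a -> bnd B b ->
  bnd (fun u => A u + B u) (fun v => a v + b v).
Proof. by move=> Aa Bb u v uv; rewrite bdiffD (le_trans (ler_normD _ _))// lerD// ?Aa ?Bb. Qed.

Lemma bndZ A a c : bnd A a -> bnd (fun u => `|c| * A u) (fun v => c * a v).
Proof. by move=> Aa u v uv; rewrite bdiffZ normrM ler_wpM2l ?Aa. Qed.

Lemma bnd_sum (T : Type) (s : seq T) (P : pred T) (A : T -> {set I} -> R) (a : T -> {set I} -> R) :
  (forall t, P t -> bnd (A t) (a t)) ->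
  bnd (fun u => \sum_(t <- s | P t) A t u) (fun v => \sum_(t <- s | P t) a t v).
Proof.
move=> Aa; elim: s => [|t s IH].
  by move=> u v _; rewrite big_nil (eq_bdiff (b := fun=> 0)) ?bdiff_0 ?normr0// => w _; rewrite big_nil.
have E (f : T -> {set I} -> R) : (fun x => \sum_(t0 <- t :: s | P t0) f t0 x) =
    if P t then (fun x => f t x + \sum_(t0 <- s | P t0) f t0 x)
    else (fun x => \sum_(t0 <- s | P t0) f t0 x).
  by case: ifP => Pt; apply/funext => x; rewrite big_cons Pt.
by rewrite !E; case: ifP => // Pt; apply: bndD => //; exact: Aa.
Qed.

Lemma bnd_avg (T : finType) A (a : T -> {set I} -> R) : (0 < #|T|)%N ->
  (forall t, bnd A (a t)) -> bnd A (fun v => avg (fun t => a t v)).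
Proof.
move=> T0 Aa; have /(bndZ (#|T|%:R^-1)) := bnd_sum (index_enum T) (P := xpredT) (fun t _ => Aa t).
apply: bnd_le => u; rewrite sumr_const ger0_norm ?invr_ge0//.
by rewrite -[A u *+ _]mulr_natl mulKf// pnatr_eq0 -lt0n.
Qed.

(** A mixed difference is a finite sum of values, so a bound uniform in [n] survives pointwise
    limits. Power series enter this way. *)
Lemma bnd_cvg A (a : nat -> {set I} -> R) b : (forall n, bnd A (a n)) ->
  (forall v, (fun n => a n v) @ \oo --> b v) -> bnd A b.
Proof.
move=> Aa ab u v uv.
have ubv : (fun n => bdiff u (a n) v) @ \oo --> bdiff u b v.
  apply: (@cvg_big _ _ _ _ _ _ _ _ _ (fun w n => (-1) ^+ #|u :\: w| * a n (v :|: w))) => /=.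
    exact: add_continuous.
  by move=> w _; apply: cvgM; [exact: cvg_cst|exact: ab].
have ubn : (fun n => `|bdiff u (a n) v|) @ \oo --> `|bdiff u b v| by apply: cvg_norm.
rewrite -(cvg_lim _ ubn)//.
apply: limr_le; first by apply/cvg_ex; exists `|bdiff u b v|.
by near=> n; exact: Aa.
Unshelve. all: by end_near.
Qed.

(** Subset convolution: the majorant that the Leibniz rule yields for a product. *)
Definition sconv A B u : R := \sum_(w : {set I} | w \subset u) A w * B (u :\: w).

Lemma sconvU1 A B j u : j \notin u -> sconv A B (j |: u) =
  sconv A (fun w => B (j |: w)) u + sconv (fun w => A (j |: w)) B u.
Proof.
move=> ju; rewrite /sconv big_subsetU1// -big_split; apply: eq_bigr => w wu /=.
have jw : j \notin w by apply: contra ju => /(fintype.subsetP wu).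
congr (_ * B _ + _ * B _); apply/finset.setP => h; rewrite !inE; case: eqP => [->|]//=.
- by rewrite jw.
- by rewrite (negbTE ju) andbF.
Qed.

(** In direction [j] the difference of a product is [a * Db + Da * b (j |: .)]. The translated
    factor is still bounded by [B] because [bnd] is uniform in the base point; induction over the
    directions then produces the convolution. *)
Lemma bndM A B a b : bnd A a -> bnd B b -> bnd (sconv A B) (fun v => a v * b v).
Proof.
move=> Aa Bb u; have [m um] := ubnP #|u|.
(* Keeping the bounds only for subsets of [u] means that, after [j] is removed, they are asked only
   for sets avoiding [j]. *)
have {Aa}Aa w v : w \subset u -> [disjoint w & v]%B -> `|bdiff w a v| <= A w by move=> _; exact: Aa.
have {Bb}Bb w v : w \subset u -> [disjoint w & v]%B -> `|bdiff w b v| <= B w by move=> _; exact: Bb.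
elim: m u um A B a b Aa Bb => // m IH u um A B a b Aa Bb v uv.
have [u0|/set0Pn[j ju]] := eqVneq u finset.set0.
  rewrite u0 bdiff0 /sconv (bigD1 finset.set0)//= big1 ?addr0; last first.
    by move=> w /andP[]; rewrite finset.subset0 => /eqP ->; rewrite eqxx.
  rewrite finset.setDv normrM; have d0 : [disjoint finset.set0 & v]%B by rewrite -u0.
  have := Aa _ _ (finset.sub0set _) d0; have := Bb _ _ (finset.sub0set _) d0; rewrite !bdiff0 => ? ?.
  exact: ler_pM.
have A0 w : w \subset u -> 0 <= A w.
  move=> wu; apply: le_trans (Aa _ finset.set0 wu _) => //.
  by rewrite disjoint_sym finset.disjoints_subset finset.sub0set.
have B0 w : w \subset u -> 0 <= B w.
  move=> wu; apply: le_trans (Bb _ finset.set0 wu _) => //.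
  by rewrite disjoint_sym finset.disjoints_subset finset.sub0set.
have jv : j \notin v by rewrite (disjointFr uv ju).
set u' := u :\ j; have ju' : j \notin u' by rewrite !inE eqxx.
have uE : u = j |: u' by rewrite finset.setD1K.
have sub w : w \subset u' -> w \subset u /\ j |: w \subset u.
  move=> wu; rewrite uE finset.setUS//; split=> //.
  exact: fintype.subset_trans wu (finset.subsetUr _ _).
have jNw w : w \subset u' -> j \notin w by move=> wu; apply: contra ju' => /(fintype.subsetP wu).
have disjU (w x : {set I}) : [disjoint w & x]%B -> j \notin w -> [disjoint w & j |: x]%B.
  by move=> wx jw; rewrite disjoint_sym disjoint_setU1 jw disjoint_sym.
have delta (c C : {set I} -> R) : (forall w, w \subset u -> 0 <= C w) ->
    (forall w (x : {set I}), w \subset u -> [disjoint w & x]%B -> `|bdiff w c x| <= C w) ->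
    forall w (x : {set I}), w \subset u' -> [disjoint w & x]%B ->
    `|bdiff w (fun t => c (j |: t) - c t) x| <= C (j |: w).
  move=> C0 Cc w x wu wx; have [jx|jx] := boolP (j \in x).
    rewrite (eq_bdiff (b := fun=> 0)) ?bdiff_0 ?normr0 ?C0 ?(sub _ wu).2// => t _.
    rewrite (_ : j |: (x :|: t) = x :|: t) ?subrr//.
    by apply/finset.setP => h; rewrite !inE; case: eqP => [->|]//; rewrite jx.
  rewrite bdiff_delta ?jNw// Cc ?(sub _ wu).2// disjoint_setU1 jx//.
rewrite uE -bdiff_delta// sconvU1//.
rewrite (eq_bdiff (b := fun t => (a (j |: t) - a t) * b (j |: t) + a t * (b (j |: t) - b t))); last first.
  by move=> w _; ring.
have um' : (#|u'| < m)%N by move: um; rewrite uE cardsU1 ju' add1n ltnS.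
have u'v : [disjoint u' & v]%B.
  by apply: disjointWl uv; rewrite uE finset.subsetUr.
rewrite bdiffD (le_trans (ler_normD _ _))// addrC lerD//.
  apply: IH => //.
    by move=> w x wu wx; apply: Aa => //; exact: (sub _ wu).1.
  exact: delta.
apply: IH => //; first exact: delta.
move=> w x wu wx; rewrite bdiff_shift; apply: Bb; first exact: (sub _ wu).1.
exact/disjU/jNw.
Qed.

End mixed_differences.

(** * Gevrey-type majorants and the exponential *)

Section gevrey.
Context {R : realType} {I : finType}.
Variables (beta : R) (b : I -> R).
Hypotheses (beta1 : 1 <= beta) (b0 : forall j, 0 <= b j).
Implicit Types (u v w : {set I}) (a : {set I} -> R).

Definition gev (M r : R) (u : {set I}) : R :=
  M * r ^+ #|u| * (#|u| `!)%:R `^ beta * \prod_(j in u) b j.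

Lemma gev_ge0 M r u : 0 <= M -> 0 <= r -> 0 <= gev M r u.
Proof.
move=> M0 r0; rewrite /gev !mulr_ge0 ?exprn_ge0 ?powR_ge0//.
by apply: prodr_ge0 => j _.
Qed.

Lemma gev_set0 M r : gev M r finset.set0 = M.
Proof. by rewrite /gev cards0 big_set0 expr0 fact0 powR1 !mulr1. Qed.

Lemma gev_le M M' r r' u : 0 <= M -> M <= M' -> 0 <= r -> r <= r' -> gev M r u <= gev M' r' u.
Proof.
move=> M0 MM r0 rr; rewrite /gev ler_wpM2r ?prodr_ge0// ler_wpM2r ?powR_ge0//.
by apply: ler_pM; rewrite ?exprn_ge0// lerXn2r// nnegrE (le_trans r0).
Qed.

(** As [beta >= 1], a binomial coefficient is at most its own power [beta], which completes the two
    factorials to [m!]. *)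
Lemma binomial_powR_fact m i : (i <= m)%N ->
  'C(m, i)%:R * ((i`!)%:R `^ beta * ((m - i)`!)%:R `^ beta) <= (m`!)%:R `^ beta :> R.
Proof.
move=> im; rewrite -(bin_fact im) !natrM !powRM ?mulr_ge0//.
rewrite ler_wpM2r ?mulr_ge0 ?powR_ge0//.
rewrite -[X in X <= _]powRr1// ler_powR//.
by rewrite ler1n bin_gt0.
Qed.

Lemma sum_pow2 m : \sum_(i < m.+1) 2 ^+ (m - i) <= 2 * 2 ^+ m :> R.
Proof.
suff -> : \sum_(i < m.+1) 2 ^+ (m - i) = 2 * 2 ^+ m - 1 :> R by rewrite lerBlDr lerDl.
elim: m => [|m IH]; first by rewrite big_ord1 expr0; lra.
rewrite big_ord_recl subn0; under eq_bigr => i _ do rewrite lift0 subSS.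
by rewrite IH exprS; ring.
Qed.

(** The ratios are deliberately unequal: the subset sum becomes the geometric sum of [2 ^+ (m - i)],
    and multiplying ratio [r] into ratio [2 * r] stays at [2 * r]. All powers of a function of ratio
    [r] therefore have ratio [2 * r]; only the constant grows, by [2 * M] per factor. *)
Lemma sconv_gev M1 M2 r u : 0 <= M1 -> 0 <= M2 -> 0 <= r ->
  sconv (gev M1 r) (gev M2 (2 * r)) u <= gev (2 * M1 * M2) (2 * r) u.
Proof.
move=> M10 M20 r0; set m := #|u|.
pose g i := r ^+ i * (2 * r) ^+ (m - i) * ((i`!)%:R `^ beta * ((m - i)`!)%:R `^ beta).
have -> : sconv (gev M1 r) (gev M2 (2 * r)) u =
    M1 * M2 * \prod_(j in u) b j * \sum_(w : {set I} | w \subset u) g #|w|.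
  rewrite mulr_sumr; apply: eq_bigr => w wu; rewrite /gev /g.
  have -> : \prod_(j in u) b j = \prod_(j in w) b j * \prod_(j in u :\: w) b j.
    rewrite (bigID (fun j => j \in w))/=; congr (_ * _).
      by apply: eq_bigl => j; rewrite andb_idl// => /(fintype.subsetP wu).
    by apply: eq_bigl => j; rewrite inE andbC.
  have -> : #|u :\: w| = (m - #|w|)%N.
    by rewrite finset.cardsD (finset.setIidPr wu).
  by ring.
rewrite sum_by_card -/m /gev -/m.
have h : \sum_(i < m.+1) 'C(m, i)%:R * g i <= (m`!)%:R `^ beta * (2 * (2 * r) ^+ m).
  apply: (@le_trans _ _ (\sum_(i < m.+1) (m`!)%:R `^ beta * (r ^+ m * 2 ^+ (m - i)))).
    apply: ler_sum => i _; have im : (i <= m)%N by rewrite -ltnS.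
    have -> : 'C(m, i)%:R * g i = 'C(m, i)%:R * ((i`!)%:R `^ beta * ((m - i)`!)%:R `^ beta) *
        (r ^+ m * 2 ^+ (m - i)).
      rewrite /g exprMn (_ : r ^+ m = r ^+ i * r ^+ (m - i)); last by rewrite -exprD subnKC.
      by ring.
    by rewrite ler_wpM2r ?mulr_ge0 ?exprn_ge0// binomial_powR_fact.
  rewrite -mulr_sumr ler_wpM2l ?powR_ge0// -mulr_sumr exprMn.
  by rewrite mulrA [X in _ <= X]mulrC ler_wpM2l ?exprn_ge0// sum_pow2.
apply: (@le_trans _ _ (M1 * M2 * \prod_(j in u) b j * ((m`!)%:R `^ beta * (2 * (2 * r) ^+ m)))).
  by rewrite ler_wpM2l ?mulr_ge0 ?prodr_ge0.
by rewrite le_eqVlt; apply/orP; left; apply/eqP; ring.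
Qed.

Lemma bnd_gev1 M r : 0 <= r -> 1 <= M -> bnd (gev M r) (fun=> 1).
Proof.
move=> r0 M1 u v _; have [->|u0] := eqVneq u finset.set0.
  by rewrite bdiff0 gev_set0 normr1.
by rewrite bdiff_const// normr0 gev_ge0// (le_trans _ M1).
Qed.

Lemma bnd_exp_coeff M a n : 0 <= M -> bnd (gev M 2) a ->
  bnd (gev (exp_coeff (2 * M) n) 4) (fun v => exp_coeff (a v) n).
Proof.
move=> M0 aM; have pw : bnd (gev ((2 * M) ^+ n) 4) (fun v => a v ^+ n).
  elim: n => [|n IH]; first by under eq_fun do rewrite expr0; rewrite expr0; exact: bnd_gev1.
  under eq_fun do rewrite exprS.
  apply: bnd_le (bndM aM IH) => u; have -> : 4 = 2 * 2 :> R by ring.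
  by apply: (le_trans (sconv_gev _ _ _ _)) => //; rewrite ?exprn_ge0 ?mulr_ge0// exprS.
have := bndZ (n`!%:R^-1) pw.
rewrite (_ : (fun v => n`!%:R^-1 * a v ^+ n) = (fun v => exp_coeff (a v) n)); last first.
  by apply/funext => v; rewrite exp_coeffE mulrC.
apply: bnd_le => u.
by rewrite ger0_norm ?invr_ge0// /gev exp_coeffE !mulrA [_^-1 * _]mulrC.
Qed.

Lemma bnd_expR M a : 0 <= M -> bnd (gev M 2) a ->
  bnd (gev (expR (2 * M)) 4) (fun v => expR (a v)).
Proof.
move=> M0 aM; apply: (@bnd_cvg _ _ _ (fun n v => series (exp_coeff (a v)) n)); last first.
  by move=> v; exact: is_cvg_series_exp_coeff.
move=> n; rewrite (_ : (fun v => _) = (fun v => \sum_(0 <= i < n) exp_coeff (a v) i))//.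
apply: bnd_le (bnd_sum _ (P := xpredT) (fun i _ => bnd_exp_coeff i M0 aM)) => u.
rewrite /gev -!mulr_suml ler_wpM2r ?prodr_ge0// ler_wpM2r ?powR_ge0// ler_wpM2r ?exprn_ge0//.
apply: (@nondecreasing_cvgn_le _ (series (exp_coeff (2 * M)))); last exact: is_cvg_series_exp_coeff.
apply: nondecreasing_series => i _ _; exact: exp_coeff_ge0 (mulr_ge0 _ M0).
Qed.
End gevrey.

(** * The logarithmic series and a submultiplicative norm *)

Section log_series.
Context {R : realType}.

Definition log_sum (n : nat) (x : R) : R := \sum_(i < n) i.+1%:R^-1 * x ^+ i.+1.

(** The partial sums differentiate to finite geometric sums, which cancel all but the remainder of
    the geometric series. *)
Lemma is_derive_log_sum n (x : R) : x < 1 ->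
  is_derive x 1 (fun t => ln (1 - t) + log_sum n t) (- x ^+ n / (1 - x)).
Proof.
move=> x1; elim: n => [|n IH].
  rewrite (_ : (fun t => _) = @ln R \o (cst 1 - id)); last first.
    by apply/funext => t; rewrite /log_sum big_ord0 addr0.
  have x0 : 0 < (cst 1 - id) x :> R by rewrite /= subr_gt0.
  apply: is_derive_eq; first exact: is_derive1_comp (is_derive1_ln x0) _.
  by rewrite expr0 sub0r mulrN mulr1 mulNr mul1r.
rewrite (_ : (fun t => _) = (fun t => ln (1 - t) + log_sum n t) + n.+1%:R^-1 \*: (id ^+ n.+1)).
  apply: is_derive_eq; rewrite /= -[_%:R^-1 *: _]/(_%:R^-1 * _) -[(n.+1%:R * _) *: _]/(_ * _) mulr1.
  rewrite mulKf ?pnatr_eq0// exprS; field.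
  by rewrite subr_eq0 gt_eqF.
apply/funext => t /=; rewrite /log_sum big_ord_recr/= addrA; congr (_ + _).
by rewrite -[RHS]/(_ * _); congr (_ * _); elim: n.+1 => [|m IHm]; rewrite ?expr0// !exprS IHm.
Qed.

Lemma log_sum_le n (x q : R) : 0 <= x <= q -> q < 1 ->
  `|ln (1 - x) + log_sum n x| <= q ^+ n / (1 - q).
Proof.
move=> /andP[x0 xq] q1; have q0 : 0 <= q := le_trans x0 xq.
have q1' : 0 < 1 - q by rewrite subr_gt0.
have S0 : ln (1 - 0) + log_sum n 0 = 0 :> R.
  rewrite subr0 ln1 add0r /log_sum big1// => i _.
  by rewrite expr0n mulr0.
move: x0; rewrite le_eqVlt => /predU1P[<-|x0].
  by rewrite S0 normr0 divr_ge0 ?exprn_ge0// ltW.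
have x1 := le_lt_trans xq q1.
have [c c0x] : exists2 c, c \in `]0, x[%R & ln (1 - x) + log_sum n x - (ln (1 - 0) + log_sum n 0) =
    (- c ^+ n / (1 - c)) * (x - 0).
  apply: (@MVT _ (fun t => ln (1 - t) + log_sum n t) (fun t => - t ^+ n / (1 - t))) => //.
    move=> t; rewrite in_itv/= => /andP[_ tx]; apply: is_derive_log_sum; exact: lt_trans tx x1.
  apply: derivable_within_continuous => t; rewrite in_itv/= => /andP[_ tx].
  by have [] := is_derive_log_sum n (le_lt_trans tx x1).
rewrite S0 !subr0 => ->; move: c0x; rewrite in_itv/= => /andP[c0 cx].
have c1 : 0 < 1 - c by rewrite subr_gt0 (lt_trans cx).
rewrite mulNr mulNr normrN ger0_norm; last first.
  by rewrite mulr_ge0 ?divr_ge0 ?exprn_ge0// ltW.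
apply: (@le_trans _ _ (c ^+ n / (1 - c))).
  by rewrite ler_piMr ?divr_ge0 ?exprn_ge0// ltW.
apply: ler_pM; rewrite ?exprn_ge0 ?invr_ge0//; try exact: ltW.
  by rewrite lerXn2r// ?nnegrE ?(ltW c0)// (le_trans (ltW cx)).
by rewrite lef_pV2 ?posrE// lerD2l lerN2 (le_trans (ltW cx)).
Qed.

Lemma cvg_log_sum (x : R) : 0 <= x < 1 -> (log_sum n x @[n --> \oo] --> - ln (1 - x)).
Proof.
move=> /andP[x0 x1].
have h : (fun n => x ^+ n / (1 - x)) @ \oo --> (0 : R).
  rewrite -[X in _ --> X](mul0r (1 - x)^-1); apply: cvgM; last exact: cvg_cst.
  by apply: cvg_expr; rewrite ger0_norm.
apply/cvgrPdist_le => e e0; move/cvgrPdist_le : h => /(_ e e0).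
apply: filterS => n; rewrite sub0r normrN => h.
rewrite -opprD normrN; apply: le_trans h; apply: le_trans (ler_norm _).
by apply: log_sum_le; rewrite ?x0 ?lexx.
Qed.
End log_series.

Section log_bound.
Context {R : realType} {I : finType}.
Variable eps : R.
Hypothesis eps0 : 0 < eps.

Let eps_ge0 : 0 <= eps. Proof. exact: ltW. Qed.

Implicit Types (u v w : {set I}) (a A B : {set I} -> R).

(** Unlike the constants of [gev], this norm is submultiplicative under [sconv] without an extra
    factor, so a norm below 1 suffices for the logarithmic series. *)
Definition wnorm A : R := \sum_(u : {set I}) eps ^+ #|u| * A u.

Lemma le_wnorm A u : (forall u, 0 <= A u) -> A u <= wnorm A / eps ^+ #|u|.
Proof.
move=> A0; rewrite ler_pdivlMr ?exprn_gt0// mulrC /wnorm (bigD1 u)//= lerDl.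
by apply: sumr_ge0 => w _; rewrite mulr_ge0 ?exprn_ge0.
Qed.

Lemma wnorm_sconv A B : (forall u, 0 <= A u) -> (forall u, 0 <= B u) ->
  wnorm (sconv A B) <= wnorm A * wnorm B.
Proof.
move=> A0 B0; have T0 w : 0 <= eps ^+ #|w| * B w by rewrite mulr_ge0 ?exprn_ge0.
rewrite /wnorm /sconv.
under eq_bigr do rewrite mulr_sumr.
rewrite (exchange_big_dep xpredT)//= [X in _ <= X]mulr_suml; apply: ler_sum => w _.
have -> : \sum_(u : {set I} | w \subset u) eps ^+ #|u| * (A w * B (u :\: w)) =
    eps ^+ #|w| * A w * \sum_(u : {set I} | w \subset u) eps ^+ #|u :\: w| * B (u :\: w).
  rewrite mulr_sumr; apply: eq_bigr => u wu.
  rewrite -(cardsID w u) (finset.setIidPr wu) exprD; ring.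
rewrite ler_wpM2l ?mulr_ge0 ?exprn_ge0//.
rewrite (reindex_onto (fun v => w :|: v) (fun u => u :\: w))/=; last first.
  by move=> u wu; apply/finset.setP => h; rewrite !inE; case: (boolP (h \in w)) => [/(fintype.subsetP wu)|].
rewrite big_mkcond/=; apply: ler_sum => v _; case: ifP => // /andP[_ /eqP ->].
exact: lexx.
Qed.

Fixpoint spow A (n : nat) : {set I} -> R :=
  if n is n'.+1 then sconv A (spow A n') else fun u => (u == finset.set0)%:R.

Lemma bnd_spow A a n : bnd A a -> bnd (spow A n) (fun v => a v ^+ n).
Proof.
move=> Aa; elim: n => [|n IH] /=; last first.
  by under eq_fun do rewrite exprS; exact: bndM.
move=> u v _; rewrite (eq_bdiff (b := fun=> 1)) => [|w _]; last by rewrite expr0.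
by have [->|u0] := eqVneq; rewrite ?bdiff0 ?normr1// bdiff_const// normr0.
Qed.

Lemma wnorm_spow A a n : bnd A a -> wnorm (spow A n) <= wnorm A ^+ n.
Proof.
move=> Aa; elim: n => [|n IH] /=.
  rewrite /wnorm (bigD1 finset.set0)//= big1 ?addr0 => [|u /negbTE ->]; last by rewrite mulr0.
  by rewrite eqxx cards0 !expr0 mulr1.
have S0 u := bnd_ge0 u (bnd_spow n Aa); have A0 u := bnd_ge0 u Aa.
apply: (le_trans (wnorm_sconv A0 S0)); rewrite exprS ler_wpM2l//.
by apply: sumr_ge0 => w _; rewrite mulr_ge0 ?exprn_ge0.
Qed.

Lemma bnd_exprn A a n : bnd A a -> bnd (fun u => wnorm A ^+ n / eps ^+ #|u|) (fun v => a v ^+ n).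
Proof.
move=> Aa; have := bnd_spow n Aa; apply: bnd_le => u.
apply: le_trans (le_wnorm u _) _; first by move=> w; exact: bnd_ge0 (bnd_spow n Aa).
by rewrite ler_wpM2r ?invr_ge0 ?exprn_ge0// (wnorm_spow n Aa).
Qed.

(** Dropping the coefficients [i.+1%:R^-1], the series is dominated by the geometric series of ratio
    [wnorm A]. *)
Lemma bnd_ln A a : bnd A a -> wnorm A < 1 -> (forall v, 0 <= a v) ->
  bnd (fun u => (1 - wnorm A)^-1 / eps ^+ #|u|) (fun v => - ln (1 - a v)).
Proof.
move=> Aa q1 a0; set q := wnorm A.
have q0 : 0 <= q.
  by apply: sumr_ge0 => w _; rewrite mulr_ge0 ?exprn_ge0 ?(bnd_ge0 _ Aa).
apply: (@bnd_cvg _ _ _ (fun n v => log_sum n (a v))); last first.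
  move=> v; apply: cvg_log_sum; rewrite a0/=; apply: le_lt_trans q1.
  apply: le_trans (ler_norm _) (le_trans (bnd_norm v Aa) _).
  have := le_wnorm finset.set0 (fun u => bnd_ge0 u Aa).
  by rewrite cards0 expr0 divr1.
move=> n; have := bnd_sum (index_enum 'I_n) (P := xpredT)
   (fun i _ => bndZ (i.+1%:R^-1) (bnd_exprn i.+1 Aa)).
apply: bnd_le => u; under eq_bigr do rewrite mulrA.
rewrite -mulr_suml ler_wpM2r ?invr_ge0 ?exprn_ge0//.
apply: (@le_trans _ _ (\sum_(i < n) q ^+ i)).
  apply: ler_sum => i _; rewrite ger0_norm ?invr_ge0// -/q exprS mulrA ler_piMl ?exprn_ge0//.
  by rewrite mulr_ile1 ?invr_ge0 ?(ltW q1)// invf_le1 ?ler1n ?ltr0n.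
have q1' : 0 < 1 - q by rewrite subr_gt0.
rewrite -(ler_pM2l q1') mulfV ?gt_eqF//.
have -> : (1 - q) * \sum_(i < n) q ^+ i = 1 - q ^+ n.
  by rewrite -opprB mulNr -subrX1 opprB.
by rewrite lerBlDr lerDl exprn_ge0.
Qed.
End log_bound.

(** * Mixed differences of the entropy integrand *)

Section xlogx_bound.
Context {R : realType} {I : finType}.
Implicit Types (u v w : {set I}) (a A B : {set I} -> R).

(** The value at the empty set is kept apart from the proper differences: it cannot be made small,
    whereas the others carry positive powers of [eps] in [wnorm]. *)
Definition head_tail (h t : R) u : R := if u == finset.set0 then h else t.

Lemma wnorm_head_tail (eps h t : R) : 0 <= eps <= 1 -> 0 <= t ->
  wnorm eps (head_tail h t) <= h + eps * (t * #|{set I}|%:R).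
Proof.
move=> /andP[e0 e1] t0; rewrite /wnorm (bigD1 finset.set0)//= cards0 expr0 mul1r.
rewrite {1}/head_tail eqxx lerD2l.
apply: (@le_trans _ _ (\sum_(u : {set I} | u != finset.set0) eps * t)).
  apply: ler_sum => u u0; rewrite /head_tail (negbTE u0) ler_wpM2r//.
  have : (0 < #|u|)%N by rewrite card_gt0.
  by case: #|u| => // m _; rewrite exprS ler_piMr// exprn_ile1.
rewrite mulrA mulr_natr -sumr_const big_mkcond/=.
apply: ler_sum => u _; case: ifP => // _; exact: mulr_ge0.
Qed.

Definition scaled (delta : R) A u : R := A u * delta ^+ #|u|.

Lemma wnorm_scaled (delta eps : R) A : delta != 0 ->
  wnorm (eps / delta) (scaled delta A) = wnorm eps A.
Proof.
move=> d0; apply: eq_bigr => u _; rewrite /scaled expr_div_n.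
by rewrite mulrCA divfK ?expf_neq0// mulrC.
Qed.

Lemma sconv_scaled (delta : R) A B u :
  sconv (scaled delta A) (scaled delta B) u = scaled delta (sconv A B) u.
Proof.
rewrite /sconv /scaled mulr_suml; apply: eq_bigr => w wu.
by rewrite -(cardsID w u) (finset.setIidPr wu) exprD; ring.
Qed.

Lemma bnd_head_tail (delta : R) A a (h t : R) : bnd A a -> (forall v, `|a v| <= h) ->
  (forall u, u != finset.set0 -> A u <= t * delta ^+ #|u|) ->
  bnd (scaled delta (head_tail h t)) a.
Proof.
move=> Aa ah At u v uv; rewrite /scaled /head_tail; case: eqVneq => [->|u0].
  by rewrite bdiff0 cards0 mulr1.
exact: le_trans (Aa u v uv) (At u u0).
Qed.

Lemma bnd_cst (delta c : R) : bnd (scaled delta (head_tail `|c| 0)) (fun=> c).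
Proof.
move=> u v _; rewrite /scaled /head_tail; case: eqVneq => [->|u0].
  by rewrite bdiff0 cards0 mulr1.
by rewrite bdiff_const// normr0 mul0r.
Qed.

(** The order of quantifiers is the point: [K] is chosen before [delta], which will be the mesh of
    the grid. All majorants are built for [delta = 1] and rescaled by [scaled]. The series applies
    to [ln a = ln M0 + ln (1 - (1 - a / M0))], whose argument [1 - a / M0] lies between 0 and
    [q < 1]. *)
Lemma xlogx_bound (c0 M0 t : R) : 0 < c0 -> c0 <= M0 -> 0 <= t ->
  exists2 K : R, 0 <= K & forall (delta : R) A a, 0 < delta ->
    bnd A a -> (forall v, c0 <= a v <= M0) ->
    (forall u, u != finset.set0 -> A u <= t * delta ^+ #|u|) ->
    bnd (fun u => K * delta ^+ #|u|) (fun v => xlogx (a v)).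
Proof.
move=> c00 cM t0; have M00 : 0 < M0 := lt_le_trans c00 cM.
set q := 1 - c0 / M0; have q0 : 0 <= q by rewrite subr_ge0 ler_pdivrMr// mul1r.
have q1 : q < 1 by rewrite ltrBlDr ltrDl divr_gt0.
set s := t / M0 * #|{set I}|%:R; have s0 : 0 <= s by rewrite !mulr_ge0// invr_ge0 ltW.
(* [s] bounds the sum of the tails over all subsets; this [eps] gives [eps * s < 1 - q], so that
   [q + eps * s], and with it the norm, stays below 1. *)
pose eps := (1 - q) / (2 * (s + 1)).
have s2 : 0 < 2 * (s + 1) by rewrite mulr_gt0// ltr_wpDl.
have e0 : 0 < eps by rewrite divr_gt0// subr_gt0.
have e1 : eps <= 1 by rewrite ler_pdivrMr// mul1r; lra.
pose A1 := head_tail q (t / M0).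
have nA1 : wnorm eps A1 < 1.
  apply: (@le_lt_trans _ _ (q + eps * s)).
    by apply: wnorm_head_tail; rewrite ?(ltW e0) ?e1 ?divr_ge0// ltW.
  have : eps * s < 1 - q.
    have : eps * (2 * (s + 1)) = 1 - q by rewrite mulfVK// gt_eqF.
    have : 0 <= eps * s by rewrite mulr_ge0// ltW.
    have : 0 < 1 - q by rewrite subr_gt0.
    by nra.
  by rewrite -ltrBrDl.
pose A2 u := head_tail `|ln M0| 0 u + `|-1| * ((1 - wnorm eps A1)^-1 / eps ^+ #|u|).
pose A3 := head_tail M0 t.
have pos2 u : 0 <= A2 u.
  rewrite addr_ge0//; first by rewrite /head_tail; case: ifP.
  by rewrite mulr_ge0// divr_ge0// ?invr_ge0 ?subr_ge0 ?exprn_ge0// ltW.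
have pos3 u : 0 <= A3 u by rewrite /A3 /head_tail; case: ifP => // _; exact: ltW.
have pos u : 0 <= sconv A3 A2 u by apply: sumr_ge0 => w _; exact: mulr_ge0.
(* Summing over all subsets turns the majorant at each [u] into one constant. *)
exists (\sum_(u : {set I}) sconv A3 A2 u) => [|delta A a d0 Aa ca At]; first exact: sumr_ge0.
have a3 : bnd (scaled delta A3) a.
  apply: bnd_head_tail Aa _ At => v; have /andP[ca1 ca2] := ca v.
  by rewrite ger0_norm// (le_trans (ltW c00)).
have a1 : bnd (scaled delta A1) (fun v => 1 - a v / M0).
  have h := bndD (@bnd_cst delta 1) (bndZ (- M0^-1) Aa).
  rewrite (_ : (fun v => _) = (fun v => 1 + - M0^-1 * a v)); last first.
    by apply/funext => v; rewrite mulNr mulrC.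
  apply: bnd_head_tail h _ _ => [v|u u0].
    have /andP[ca1 ca2] := ca v; rewrite mulNr ger0_norm; last first.
      by rewrite subr_ge0 mulrC ler_pdivrMr// mul1r.
    by rewrite lerD2l lerN2 mulrC ler_wpM2l// invr_ge0 ltW.
  rewrite /scaled /head_tail (negbTE u0) mul0r add0r normrN ger0_norm ?invr_ge0 ?(ltW M00)//.
  by rewrite mulrC mulrAC ler_wpM2r ?invr_ge0 ?(ltW M00)// At.
have a2 : bnd (scaled delta A2) (fun v => ln (a v)).
  have ln_a v : ln (a v) = ln M0 + (-1) * - ln (1 - (1 - a v / M0)).
    have av : 0 < a v by have /andP[ca1 _] := ca v; exact: lt_le_trans ca1.
    by rewrite mulN1r opprK subKr lnM ?posrE ?invr_gt0// lnV ?posrE// addrC subrK.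
  have ed0 : 0 < eps / delta by rewrite divr_gt0.
  have w1 : wnorm (eps / delta) (scaled delta A1) < 1 by rewrite wnorm_scaled ?gt_eqF.
  have pos1 v : 0 <= 1 - a v / M0.
    by rewrite subr_ge0 ler_pdivrMr// mul1r; have /andP[] := ca v.
  rewrite (funext ln_a); have := bndD (@bnd_cst delta (ln M0)) (bndZ (-1) (bnd_ln ed0 a1 w1 pos1)).
  apply: bnd_le => u; rewrite wnorm_scaled ?gt_eqF// /scaled /A2 mulrDl lerD2l.
  by rewrite expr_div_n invf_div !mulrA [X in X <= _]mulrAC lexx.
apply: bnd_le (bndM a3 a2) => u; rewrite sconv_scaled /scaled ler_wpM2r ?exprn_ge0 ?(ltW d0)//.
by rewrite (bigD1 u)//= lerDl sumr_ge0.
Qed.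
End xlogx_bound.

(** * From partial derivatives to mixed differences *)

Section mean_value.
Context {R : realType}.
Implicit Types (f : R -> R).

(** Differentiability on [[0, H]] including the endpoints, one-sided there, to match derivatives
    taken relative to a cube. The difference quotient is multiplied out, so [t' = t] involves no
    division. *)
Definition diff_on (H : R) f f' := forall t, 0 <= t <= H -> forall e : R, 0 < e ->
  exists2 d : R, 0 < d & forall t', 0 <= t' <= H -> `|t' - t| < d ->
    `|f t' - f t - (t' - t) * f' t| <= e * `|t' - t|.

Lemma diff_on0 H : diff_on H (fun=> 0) (fun=> 0).
Proof.
move=> t _ e e0; exists 1 => // t' _ _.
by rewrite mulr0 !subr0 normr0 mulr_ge0// ltW.
Qed.

Lemma diff_onD H f f' g g' : diff_on H f f' -> diff_on H g g' ->
  diff_on H (fun t => f t + g t) (fun t => f' t + g' t).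
Proof.
move=> hf hg t tH e e0; have e20 : 0 < e / 2 by rewrite divr_gt0.
have [d1 d10 h1] := hf t tH _ e20; have [d2 d20 h2] := hg t tH _ e20.
exists (Num.min d1 d2) => [|t' t'H]; first by rewrite lt_min d10 d20.
rewrite lt_min => /andP[/(h1 _ t'H) k1 /(h2 _ t'H) k2].
rewrite (_ : _ - _ = (f t' - f t - (t' - t) * f' t) + (g t' - g t - (t' - t) * g' t)); last by ring.
apply: (le_trans (ler_normD _ _)); have := lerD k1 k2.
by move/le_trans; apply; rewrite -mulrDl -splitr.
Qed.

Lemma diff_onZ H c f f' : diff_on H f f' -> diff_on H (fun t => c * f t) (fun t => c * f' t).
Proof.
move=> hf t tH e e0; have c0 : 0 < `|c| + 1 by rewrite ltr_wpDl.
have ec : 0 < e / (`|c| + 1) by rewrite divr_gt0.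
have [d d0 h] := hf t tH _ ec; exists d => // t' t'H /(h _ t'H) k.
rewrite (_ : _ - _ = c * (f t' - f t - (t' - t) * f' t)); last by ring.
rewrite normrM; apply: (@le_trans _ _ ((`|c| + 1) * (e / (`|c| + 1) * `|t' - t|))).
  by apply: ler_pM => //; rewrite lerDl.
by rewrite mulrA [_ * (e / _)]mulrC divfK// gt_eqF.
Qed.

Lemma diff_on_sum (J : Type) (s : seq J) (P : pred J) H (f f' : J -> R -> R) :
  (forall j, P j -> diff_on H (f j) (f' j)) ->
  diff_on H (fun t => \sum_(j <- s | P j) f j t) (fun t => \sum_(j <- s | P j) f' j t).
Proof.
move=> hf; elim: s => [|j s IH].
  have E (g : J -> R -> R) : (fun t => \sum_(j0 <- [::] | P j0) g j0 t) = (fun=> 0).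
    by apply/funext => t; rewrite big_nil.
  by rewrite !E; exact: diff_on0.
have E (g : J -> R -> R) : (fun t => \sum_(j0 <- j :: s | P j0) g j0 t) =
    if P j then (fun t => g j t + \sum_(j0 <- s | P j0) g j0 t)
    else (fun t => \sum_(j0 <- s | P j0) g j0 t).
  by case: ifP => Pj; apply/funext => t; rewrite big_cons Pj.
by rewrite !E; case: ifP => // Pj; apply: diff_onD => //; exact: hf.
Qed.

Lemma diff_on_derive H f f' t : diff_on H f f' -> 0 < t < H -> is_derive t 1 f (f' t).
Proof.
move=> hf /andP[t0 tH].
have h : (fun h : R => h^-1 *: ((f \o shift t) (h *: 1) - f t)) @ 0^' --> f' t.
  apply/cvgrPdist_le => e e0.
  have [|d d0 k] := hf t _ e e0; first by rewrite !ltW.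
  have m0 : 0 < Num.min d (Num.min t (H - t)) by rewrite !lt_min d0 t0 subr_gt0.
  near=> h.
  have hN : h != 0 by near: h; exact: nbhs_dnbhs_neq.
  have : `|h| < Num.min d (Num.min t (H - t)) by near: h; exact: dnbhs0_lt.
  rewrite !lt_min => /and3P[hd ht hH].
  rewrite /= [h *: 1]mulr1 -[_ *: _]/(_ * _).
  have hE : h + t - t = h by rewrite addrK.
  have := k (h + t); rewrite hE => /(_ _ hd) kk.
  have {}kk : `|f (h + t) - f t - h * f' t| <= e * `|h|.
    apply: kk; move: ht hH; rewrite !ltr_norml => /andP[h1 _] /andP[_ h2].
    by apply/andP; split; lra.
  have -> : f' t - h^-1 * (f (h + t) - f t) = - h^-1 * (f (h + t) - f t - h * f' t).
    by field.
  by rewrite normrM normrN normfV mulrC ler_pdivrMr// normr_gt0.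
apply: DeriveDef; first by apply/cvg_ex; exists (f' t).
exact: cvg_lim.
Unshelve. all: by end_near.
Qed.

Lemma diff_on_continuous H f f' : diff_on H f f' -> {within `[0, H], continuous f}.
Proof.
move=> hf; apply/subspace_continuousP => t; rewrite /= in_itv/= => tH.
apply/cvgrPdist_le => e e0; have [d d0 k] := hf t tH 1 ltr01.
have m0 : 0 < Num.min d (e / (1 + `|f' t|)) by rewrite lt_min d0 divr_gt0// ltr_pwDl.
rewrite near_withinE; near=> t' => /=; rewrite in_itv/= => t'H.
have : `|t - t'| < Num.min d (e / (1 + `|f' t|)).
  by near: t'; exact: (nbhsx_ballx t _ m0).
rewrite distrC lt_min => /andP[td te].
have := k t' t'H td; rewrite mul1r => kk.
rewrite /from_subspace distrC (_ : f t' - f t = (f t' - f t - (t' - t) * f' t) + (t' - t) * f' t); last by ring.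
apply: (le_trans (ler_normD _ _)); rewrite normrM.
apply: (@le_trans _ _ (`|t' - t| * (1 + `|f' t|))).
  by rewrite mulrDr mulr1 lerD2r.
by rewrite -ler_pdivlMr ?ltr_pwDl// ltW.
Unshelve. all: by end_near.
Qed.

Lemma mean_value_on H f f' M : 0 <= H -> diff_on H f f' ->
  (forall t, 0 <= t <= H -> `|f' t| <= M) -> `|f H - f 0| <= H * M.
Proof.
rewrite le_eqVlt => /predU1P[<-|H0] hf fM; first by rewrite subrr normr0 mul0r.
have [c] : exists2 c, c \in `]0, H[%R & f H - f 0 = f' c * (H - 0).
  apply: MVT => //; last exact: diff_on_continuous hf.
  by move=> t; rewrite in_itv/= => tH; exact: diff_on_derive hf tH.
rewrite in_itv/= => /andP[c0 cH] ->; rewrite subr0 normrM mulrC (gtr0_norm H0).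
by apply: ler_wpM2l; [exact: ltW|apply: fM; rewrite !ltW].
Qed.
End mean_value.

Section vertices.
Context {R : realType} {n : nat}.
Implicit Types (x h : 'cV[R]_n) (u v w : {set 'I_n}).

Definition vert x h v : 'cV[R]_n := \col_j (x j 0 + (if j \in v then h j 0 else 0)).

Lemma vert_setU1 x h j v : j \notin v -> vert x h (j |: v) = vert x h v + h j 0 *: delta_mx j 0.
Proof.
move=> jv; apply/colP => i; rewrite !mxE eqxx andbT !inE; case: eqVneq => [->|_] /=.
  by rewrite (negbTE jv) mulr1 addr0.
by rewrite mulr0 addr0.
Qed.

Lemma vert_shift x h j v (t : R) : j \notin v ->
  vert (x + t *: delta_mx j 0) (\col_i (if i == j then 0 else h i 0)) v =
  vert x h v + t *: delta_mx j 0.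
Proof.
move=> jv; apply/colP => i; rewrite !mxE addrAC; congr (_ + _ + _).
by case: eqVneq => [->|//]; rewrite (negbTE jv).
Qed.

Lemma vert_cube (a b : R) x h v : cube n a b x -> (forall j, 0 <= h j 0) -> cube n a b (x + h) ->
  cube n a b (vert x h v).
Proof.
move=> xD h0 xhD j; rewrite mxE; have /andP[x1 x2] := xD j.
have /andP[] := xhD j; rewrite mxE => y1 y2; case: ifP => _; last by rewrite addr0 x1.
by rewrite y2 andbT (le_trans x1)// lerDl.
Qed.

Variables (a b : R) (g : seq 'I_n -> 'cV[R]_n -> R).
Local Notation D := (cube n a b).
Hypothesis hg : forall js j x, D x -> forall e : R, 0 < e ->
  exists2 d : R, 0 < d & forall t : R, `|t| < d -> D (x + t *: delta_mx j 0) ->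
    `|g js (x + t *: delta_mx j 0) - g js x - t * g (j :: js) x| <= e * `|t|.

(** One application of the mean value theorem per direction. Directions leave [js] at its end
    because [pderivs] is a [foldr] and applies the last listed derivative first. *)
Lemma bdiff_vert_le js tl (M : R) x h v : uniq js -> D x -> (forall j, 0 <= h j 0) -> D (x + h) ->
  (forall j, j \in js -> j \notin v) -> (forall y, D y -> `|g (js ++ tl) y| <= M) ->
  `|bdiff [set j in js] (fun w => g tl (vert x h w)) v| <= M * \prod_(j <- js) h j 0.
Proof.
elim/last_ind: js tl x h => [|js j IH] tl x h.
  move=> _ xD h0 xhD _ gM; rewrite (_ : [set j in [::]] = finset.set0); last first.
    by apply/finset.setP => j; rewrite !inE.
  by rewrite bdiff0 big_nil mulr1; apply: gM; exact: vert_cube.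
rewrite rcons_uniq => /andP[jjs ujs] xD h0 xhD jsv gM.
set u := [set j in js]; have ju : j \notin u by rewrite inE.
have jv : j \notin v by apply: jsv; rewrite mem_rcons mem_head.
have -> : [set i in rcons js j] = j |: u.
  by apply/finset.setP => i; rewrite !inE mem_rcons in_cons.
have jw w : w \subset u -> j \notin v :|: w.
  by move=> wu; rewrite inE negb_or jv; apply: contra ju => /(fintype.subsetP wu).
rewrite -bdiff_delta//.
(* [phi] slides the face spanned by the remaining directions along [j]; its derivative is the same
   mixed difference of [g (j :: tl')]. *)
pose phi tl' (t : R) := \sum_(w : {set 'I_n} | w \subset u)
  (-1) ^+ #|u :\: w| * g tl' (vert x h (v :|: w) + t *: delta_mx j 0).
have -> : bdiff u (fun w => g tl (vert x h (j |: w)) - g tl (vert x h w)) v =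
   phi tl (h j 0) - phi tl 0.
  rewrite /bdiff /phi -sumrB; apply: eq_bigr => w wu.
  by rewrite mulrBr vert_setU1 ?jw// scale0r addr0.
have yD w t : 0 <= t <= h j 0 -> w \subset u -> D (vert x h (v :|: w) + t *: delta_mx j 0).
  move=> /andP[t0 th] wu i; rewrite !mxE eqxx andbT.
  case: eqVneq => [->|_] /=; last first.
    by rewrite mulr0 addr0; have := @vert_cube a b x h (v :|: w) xD h0 xhD i; rewrite mxE.
  rewrite (negbTE (jw w wu)) mulr1 addr0; have /andP[x1 x2] := xD j.
  have /andP[] := xhD j; rewrite mxE => y1 y2.
  by rewrite (le_trans x1) ?lerDl//= (le_trans _ y2)// lerD2l.
rewrite -cats1 big_cat/= big_seq1 mulrA mulrC; apply: (@mean_value_on _ _ _ (phi (j :: tl))) => //.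
  apply: diff_on_sum => w wu; apply: diff_onZ => t tH e e0.
  have [d d0 k] := hg tl j (yD w t tH wu) e0; exists d => // t' t'H tt'.
  have yE : vert x h (v :|: w) + t *: delta_mx j 0 + (t' - t) *: delta_mx j 0 =
            vert x h (v :|: w) + t' *: delta_mx j 0.
    by rewrite -addrA -scalerDl addrCA subrr addr0.
  by have := k (t' - t) tt'; rewrite yE => /(_ (yD w t' t'H wu)).
(* The face moved by [t] belongs to a box with corner [x + t *: delta_mx j 0] and no extent in
   direction [j], still inside the cube. *)
move=> t tH; pose h' : 'cV[R]_n := \col_i (if i == j then 0 else h i 0).
have -> : phi (j :: tl) t = bdiff u (fun w => g (j :: tl) (vert (x + t *: delta_mx j 0) h' w)) v.
  by apply: eq_bigr => w wu; rewrite vert_shift// jw.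
have -> : \prod_(i <- js) h i 0 = \prod_(i <- js) h' i 0.
  apply: eq_big_seq => i ijs; rewrite mxE; case: eqVneq => // ij.
  by move: jjs; rewrite -ij ijs.
have /andP[t0 th] := tH.
apply: IH => //.
- move=> i; rewrite !mxE eqxx andbT; have /andP[x1 x2] := xD i.
  have /andP[] := xhD i; rewrite mxE => y1 y2; case: eqVneq => [ij|_] /=; last by rewrite mulr0 addr0 x1.
  rewrite mulr1 (le_trans x1) ?lerDl//= (le_trans _ y2)// ij lerD2l.
  by [].
- by move=> i; rewrite mxE; case: eqP.
- move=> i; rewrite !mxE eqxx andbT; have /andP[x1 x2] := xD i.
  have /andP[] := xhD i; rewrite mxE => y1 y2; case: eqVneq => [ij|_] /=; last by rewrite mulr0 addr0 y1.
  rewrite mulr1 addr0 (le_trans x1) ?lerDl//= (le_trans _ y2)// ij lerD2l.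
  by [].
- by move=> i ijs; apply: jsv; rewrite mem_rcons in_cons ijs orbT.
- by move=> y yDy; have := gM y yDy; rewrite cat_rcons.
Qed.
End vertices.

Section smooth_coordinates.
Context {R : realType}.

Lemma coord_le_mx_norm k (x : 'cV[R]_k) (i : 'I_k) : `|x i 0| <= `|x|.
Proof.
rewrite -[`|x|]/(mx_norm x) mx_normrE.
exact: (le_bigmax _ (fun ij : 'I_k * 'I_1 => `|x ij.1 ij.2|) (i, 0)).
Qed.

Lemma coord_le_enorm k (x : 'cV[R]_k) (i : 'I_k) : `|x i 0| <= enorm x.
Proof.
rewrite /enorm -sqrtr_sqr ler_wsqrtr// (bigD1 i)//= lerDl.
by apply: sumr_ge0 => j _; exact: sqr_ge0.
Qed.

(** [pderiv] is a [lim] along increments that stay in [D]; the convergence part of [smooth_on] makes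
    it an actual derivative, here in increment form and coordinatewise. *)
Lemma smooth_on_coord_diff n k (D : set 'cV[R]_n) (F : 'cV[R]_n -> 'cV[R]_k) (i : 'I_k) :
  smooth_on D F -> forall js j x, D x -> forall e : R, 0 < e ->
  exists2 d : R, 0 < d & forall t : R, `|t| < d -> D (x + t *: delta_mx j 0) ->
    `|pderivs D js F (x + t *: delta_mx j 0) i 0 - pderivs D js F x i 0
      - t * pderivs D (j :: js) F x i 0| <= e * `|t|.
Proof.
move=> sF js j x Dx e e0; have [_ /(_ j x Dx)] := sF js.
move=> /cvgrPdist_le /(_ e e0).
rewrite near_withinE => /nbhs_ballP[d /= d0 k'].
exists d => // t td Dt; have [->|t0] := eqVneq t 0.
  by rewrite scale0r addr0 subrr mul0r subr0 normr0 mulr0.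
have {k'} := k' t; rewrite /ball/= sub0r normrN => /(_ td t0 Dt) k'.
set L := lim _ in k'.
have -> : pderiv D j (pderivs D js F) x = L by [].
have := le_trans (coord_le_mx_norm _ i) k'; rewrite /diff_quotient !mxE => kk.
set A := pderivs D js F (x + t *: delta_mx j 0) i 0 in kk *.
set B := pderivs D js F x i 0 in kk *.
have -> : A - B - t * L i 0 = - t * (L i 0 - t^-1 * (A - B)) by field.
by rewrite normrM normrN mulrC ler_wpM2r.
Qed.

Lemma nseq_flatten_set n (u : {set 'I_n}) :
  flatten [seq nseq (j \in u) j | j <- enum 'I_n] = enum u.
Proof.
rewrite [RHS](_ : _ = [seq j <- enum 'I_n | j \in u]); last by rewrite enumT.
by elim: (enum 'I_n) => //= j s ->; case: ifP.
Qed.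

Variables (n k : nat) (C beta : R) (b : nat -> R) (F : 'cV[R]_n -> 'cV[R]_k).
Hypotheses (sF : smooth_on (Theta n) F) (bF : gevrey_bound C beta b F).

(** [mderiv] at the indicator of [u] differentiates along [enum u], the list along which the mixed
    difference is unrolled. *)
Lemma bdiff_smooth (i : 'I_k) (x h : 'cV[R]_n) (u v : {set 'I_n}) :
  Theta n x -> (forall j, 0 <= h j 0) -> Theta n (x + h) -> [disjoint u & v]%B ->
  `|bdiff u (fun w => F (vert x h w) i 0) v| <=
  gev beta (fun j : 'I_n => b j * h j 0) C 1 u.
Proof.
move=> xD h0 xhD uv.
have {1}-> : u = [set j in enum u] by apply/finset.setP => j; rewrite !inE mem_enum.
apply: (le_trans (bdiff_vert_le (smooth_on_coord_diff i sF) (js := enum u) (tl := [::])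
   (M := C * (#|u| `!)%:R `^ beta * \prod_(j in u) b j) (enum_uniq _) xD h0 xhD _ _)).
- by move=> j; rewrite mem_enum => ju; rewrite (disjointFr uv ju).
- move=> y yD; rewrite cats0; have := bF (fun j => j \in u) yD.
  rewrite /mderiv nseq_flatten_set => /(le_trans (coord_le_enorm _ i)) /le_trans; apply.
  rewrite -sum1_card (eq_bigr (fun j : 'I_n => if j \in u then 1%N else 0%N)); last first.
    by move=> j _; case: (j \in u).
  rewrite -big_mkcond/= sum1_card [\prod_(j in u) _]big_mkcond/=.
  have -> // : \prod_(j < n) b j ^+ (j \in u) = \prod_(j < n) (if j \in u then b j else 1).
  by apply: eq_bigr => j _; case: (j \in u).
by rewrite big_enum/= /gev expr1n mulr1 -mulrA -big_split.
Qed.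
End smooth_coordinates.

(** * The likelihood *)

Section spd_facts.
Context {R : realType} {k : nat}.
Variable Gamma : 'M[R]_k.
Hypothesis hG : spd Gamma.

Lemma spd_unitmx : Gamma \in unitmx.
Proof.
rewrite unitmxE unitfE; apply/negP => /det0P[v v0 vG].
have [_ /(_ v^T)] := hG; rewrite trmxK vG mul0mx mxE ltxx => h.
suff : false by []; apply: h; apply: contra v0 => /eqP vT.
by rewrite -[v]trmxK vT trmx0.
Qed.

(** With [x = Gamma *m w], the form of the inverse at [x] is the form of [Gamma] at [w]. *)
Lemma spd_invmx_ge0 (x : 'cV[R]_k) : 0 <= (x^T *m invmx Gamma *m x) 0 0.
Proof.
have [GT pos] := hG; have Gu := spd_unitmx.
set w := invmx Gamma *m x.
have xE : x = Gamma *m w by rewrite mulKVmx.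
have -> : x^T *m invmx Gamma *m x = w^T *m Gamma *m w.
  by rewrite -mulmxA -/w {1}xE trmx_mul GT.
have [->|w0] := eqVneq w 0; last by rewrite ltW// pos.
by rewrite mulmx0 mxE.
Qed.

Lemma sqr_weighted_norm (x : 'cV[R]_k) :
  weighted_norm Gamma x ^+ 2 = \sum_j \sum_i invmx Gamma i j * (x i 0 * x j 0).
Proof.
rewrite sqr_sqrtr ?spd_invmx_ge0// mxE; apply: eq_bigr => j _.
by rewrite !mxE mulr_suml; apply: eq_bigr => i _; rewrite mxE; ring.
Qed.

Lemma normconst_gt0 : 0 < normconst Gamma.
Proof.
have dG : \det Gamma != 0 by rewrite -unitfE -unitmxE spd_unitmx.
rewrite /normconst /powR detZ ifN ?expR_gt0// mulf_neq0// expf_neq0//.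
by rewrite mulf_neq0// gt_eqF// pi_gt0.
Qed.
End spd_facts.

Section gaussian_bound.
Context {R : realType} {I : finType} {k : nat}.
Variables (beta : R) (c : I -> R) (P : 'M[R]_k) (C : R) (e : 'I_k -> {set I} -> R).
Hypotheses (beta1 : 1 <= beta) (c0 : forall j, 0 <= c j) (C0 : 0 <= C).
Hypothesis he : forall i, bnd (gev beta c C 1) (e i).

(** Majorant of the quadratic form in the exponent; [2 * C * C] is the constant that [sconv_gev]
    gives for a product of two residuals. *)
Definition quad_const (P : 'M[R]_k) (C : R) : R :=
  \sum_j \sum_i `|- 2^-1 * P i j| * (2 * C * C).

Lemma quad_const_ge0 : 0 <= quad_const P C.
Proof. by apply: sumr_ge0 => j _; apply: sumr_ge0 => i _; rewrite !mulr_ge0. Qed.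

(** The ratios are 1 for the residuals, 2 for their products and 4 after the exponential. Taking
    absolute values of the coefficients makes the signs of the quadratic form irrelevant. *)
Lemma bnd_gaussian (nc : R) : 0 <= nc ->
  bnd (gev beta c (nc * expR (2 * quad_const P C)) 4)
      (fun w => nc * expR (- 2^-1 * \sum_j \sum_i P i j * (e i w * e j w))).
Proof.
move=> nc0; have prodb i j : bnd (gev beta c (2 * C * C) 2) (fun w => e i w * e j w).
  have ej : bnd (gev beta c C (2 * 1)) (e j).
    by apply: bnd_le (he j) => u; apply: gev_le => //; lra.
  apply: bnd_le (bndM (he i) ej) => u.
  by have := sconv_gev beta1 c0 u C0 C0 ler01; rewrite mulr1.
have q : bnd (gev beta c (quad_const P C) 2)
    (fun w => - 2^-1 * \sum_j \sum_i P i j * (e i w * e j w)).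
  have := bnd_sum (index_enum 'I_k) (P := xpredT) (fun j _ =>
    bnd_sum (index_enum 'I_k) (P := xpredT) (fun i _ => bndZ (- 2^-1 * P i j) (prodb i j))).
  rewrite (_ : (fun v => \sum_j \sum_i - 2^-1 * P i j * (e i v * e j v)) =
     (fun w => - 2^-1 * \sum_j \sum_i P i j * (e i w * e j w))); last first.
    apply/funext => w; rewrite mulr_sumr; apply: eq_bigr => j _.
    by rewrite mulr_sumr; apply: eq_bigr => i _; rewrite [RHS]mulrA.
  apply: bnd_le => u; rewrite /quad_const /gev !mulr_suml.
  rewrite le_eqVlt; apply/orP; left; apply/eqP; apply: eq_bigr => j _.
  by rewrite !mulr_suml; apply: eq_bigr => i _; rewrite !mulrA.
have := bndZ nc (bnd_expR beta1 c0 quad_const_ge0 q).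
by apply: bnd_le => u; rewrite ger0_norm// /gev !mulrA.
Qed.
End gaussian_bound.

Section likelihood_bounds.
Context {R : realType}.
Variables (k s : nat) (K C beta : R) (Gamma : 'M[R]_k) (b : nat -> R) (G : 'cV[R]_s -> 'cV[R]_k).
Hypotheses (hG : spd Gamma) (K0 : 0 < K) (C1 : 1 <= C) (beta1 : 1 <= beta) (b0 : forall j, 0 <= b j).
Hypotheses (sG : smooth_on (Theta s) G) (bG : gevrey_bound C beta b G).

Let f := likelihood Gamma G.
Let C0 : 0 <= C. Proof. exact: le_trans C1. Qed.

Lemma likelihoodE theta y : f theta y =
  normconst Gamma * expR (- 2^-1 * \sum_j \sum_i invmx Gamma i j *
     ((y i 0 - G theta i 0) * (y j 0 - G theta j 0))).
Proof.
rewrite /f /likelihood sqr_weighted_norm//; congr (_ * expR (_ * _)).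
by apply: eq_bigr => j _; apply: eq_bigr => i _; rewrite !mxE.
Qed.

Lemma normr_model_le theta i : Theta s theta -> `|G theta i 0| <= C.
Proof.
move=> th; apply: le_trans (coord_le_enorm _ i) _.
have := bG (fun=> 0%N) th; rewrite /mderiv.
have -> : flatten [seq nseq 0 j | j <- enum 'I_s] = [::] :> seq 'I_s.
  by elim: (enum 'I_s).
by rewrite /= big1// fact0 powR1 mulr1 big1 ?mulr1.
Qed.

Definition lik_const := normconst Gamma * expR (2 * quad_const (invmx Gamma) (K + C)).

Lemma bnd_likelihood_theta y (x h : 'cV[R]_s) : cube k (- K) K y ->
  Theta s x -> (forall j, 0 <= h j 0) -> Theta s (x + h) ->
  bnd (gev beta (fun j : 'I_s => b j * h j 0) lik_const 4) (fun w => f (vert x h w) y).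
Proof.
move=> yK xT h0 xhT; rewrite (funext (fun w => likelihoodE (vert x h w) y)).
apply: (@bnd_gaussian _ _ _ _ _ _ _ (fun i w => y i 0 - G (vert x h w) i 0)) => //.
- by move=> j; rewrite mulr_ge0.
- by rewrite addr_ge0// ltW.
- move=> i u v uv.
  have [->|u0] := eqVneq u finset.set0.
    rewrite bdiff0 gev_set0 (le_trans (ler_normB _ _))// lerD//.
      by rewrite ler_norml; have /andP[-> ->] := yK i.
    by apply: normr_model_le; exact: vert_cube.
  rewrite (eq_bdiff (b := fun w => y i 0 + (-1) * G (vert x h w) i 0)); last by move=> w _; rewrite mulN1r.
  rewrite bdiffD bdiff_const// add0r bdiffZ mulN1r normrN.
  apply: (le_trans (bdiff_smooth sG bG i xT h0 xhT uv)).
  by apply: gev_le => //; [move=> j; rewrite mulr_ge0|rewrite lerDr ltW].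
- exact/ltW/normconst_gt0.
Qed.

(** In [y] the residuals are affine: the [i]-th one changes only with coordinate [i], by [h i 0].
    The 1 in [K + C + 1] lets the constant dominate the coefficient of this first difference. *)
Lemma bnd_likelihood_y theta (y h : 'cV[R]_k) : Theta s theta ->
  cube k (- K) K y -> (forall j, 0 <= h j 0) -> cube k (- K) K (y + h) ->
  bnd (gev 1 (fun j : 'I_k => h j 0) (normconst Gamma * expR (2 * quad_const (invmx Gamma) (K + C + 1))) 4)
     (fun w => f theta (vert y h w)).
Proof.
move=> th yK h0 yhK; rewrite (funext (fun w => likelihoodE theta (vert y h w))).
have KC : 0 <= K + C + 1 by rewrite !addr_ge0// ltW.
apply: (@bnd_gaussian _ _ _ _ _ _ _ (fun i w => vert y h w i 0 - G theta i 0)) => //.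
- move=> i u v uv.
  have [->|u0] := eqVneq u finset.set0.
    rewrite bdiff0 gev_set0 (le_trans (ler_normB _ _))//.
    have h1 : `|vert y h v i 0| <= K.
      by have := @vert_cube _ _ _ _ _ _ v yK h0 yhK i; rewrite ler_norml.
    by apply: le_trans (lerD h1 (normr_model_le i th)) _; rewrite lerDl.
  have [/eqP u1|nu1] := eqVneq u [set i]%SET.
    rewrite (eqP u1) -[[set i]%SET]finset.setU0 bdiffU1 ?inE// !bdiff0 finset.setU0.
    have iv : i \notin v by rewrite (disjointFr uv)// (eqP u1) inE.
    rewrite vert_setU1// opprB addrA subrK !mxE !eqxx mulr1 addrAC subrr add0r ger0_norm//.
    rewrite /gev cards1 big_set1 expr1n (_ : (1 `!)%N = 1%N)// powR1 !mulr1 ler_peMl//.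
    by rewrite lerDr addr_ge0// ltW.
  have [j ju ji] : exists2 j, j \in u & j != i.
    apply/exists_inP; apply: contraNT nu1; rewrite negb_exists_in => /forall_inP uj.
    apply/eqP/finset.setP => j; rewrite inE; apply/idP/eqP => [/uj|->]; first by rewrite negbK => /eqP.
    by have /set0Pn[l lu] := u0; have := uj l lu; rewrite negbK => /eqP <-.
  rewrite (bdiff_fixed v ju) ?normr0 ?gev_ge0// => w.
  by rewrite !mxE !inE [i == j]eq_sym (negbTE ji).
- exact/ltW/normconst_gt0.
Qed.

Definition lik_min := normconst Gamma *
  expR (- \sum_j \sum_i `|invmx Gamma i j| * ((K + C) * (K + C))).

Lemma lik_min_gt0 : 0 < lik_min.
Proof. by rewrite mulr_gt0 ?expR_gt0// normconst_gt0. Qed.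

Lemma likelihood_bounds theta y : Theta s theta -> cube k (- K) K y ->
  lik_min <= f theta y <= normconst Gamma.
Proof.
move=> th yK; have nc := normconst_gt0 hG; apply/andP; split; last first.
  rewrite /f /likelihood ler_piMr ?(ltW nc)// -expR0 ler_expR.
  by rewrite mulNr oppr_le0 mulr_ge0 ?sqr_ge0.
rewrite likelihoodE ler_wpM2l ?(ltW nc)// ler_expR.
set S := \sum_j \sum_i _ * ((y i 0 - _) * _).
have SB : `|S| <= \sum_j \sum_i `|invmx Gamma i j| * ((K + C) * (K + C)).
  apply: (le_trans (ler_norm_sum _ _ _)); apply: ler_sum => j _.
  apply: (le_trans (ler_norm_sum _ _ _)); apply: ler_sum => i _.
  have h l : `|y l 0 - G theta l 0| <= K + C.
    rewrite (le_trans (ler_normB _ _))// lerD ?normr_model_le//.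
    by rewrite ler_norml; have /andP[-> ->] := yK l.
  by rewrite !normrM ler_wpM2l// ler_pM.
have := ler_norm S; have := normr_ge0 S; lra.
Qed.
End likelihood_bounds.

(** * Summability over subsets *)

Section summability.
Context {R : realType}.

(** Each term is at most the total [T], hence [x i] to the power [r - 1] is at most [T] to the power
    [r - 1]. *)
Lemma sum_powR_le (I : finType) (P : pred I) (x : I -> R) (r : R) : 1 <= r ->
  (forall i, 0 <= x i) ->
  \sum_(i | P i) x i `^ r <= (\sum_(i | P i) x i) `^ r.
Proof.
move=> r1 x0; set T := \sum_(i | P i) x i; have T0 : 0 <= T by exact: sumr_ge0.
have r0 : 0 < r := lt_le_trans ltr01 r1.
rewrite -(mulr_powRB1 T0 r0) mulr_suml; apply: ler_sum => i Pi.
rewrite -(mulr_powRB1 (x0 i) r0) ler_wpM2l//.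
apply: ge0_ler_powR; rewrite ?nnegrE// ?subr_ge0//.
by rewrite /T (bigD1 i)//= lerDl sumr_ge0.
Qed.

Lemma powR_prod (I : finType) (A : {set I}) (F : I -> R) (r : R) : (forall i, 0 <= F i) ->
  (\prod_(i in A) F i) `^ r = \prod_(i in A) F i `^ r.
Proof.
move=> F0; have : 0 <= \prod_(i in A) F i /\ (\prod_(i in A) F i) `^ r = \prod_(i in A) F i `^ r.
  apply: (big_ind2 (fun x y => 0 <= x /\ x `^ r = y)).
  - by rewrite powR1.
  - by move=> x1 x2 y1 y2 [h1 e1] [h2 e2]; rewrite powRM// e1 e2; split=> //; exact: mulr_ge0.
  - by [].
by case.
Qed.

Lemma powR_exprn (x r : R) (m : nat) : 0 <= x -> (x ^+ m) `^ r = (x `^ r) ^+ m.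
Proof.
move=> x0; elim: m => [|m IH]; first by rewrite !expr0 powR1.
by rewrite !exprS powRM ?exprn_ge0// IH.
Qed.

Lemma exprn_le_expR (x : R) (m : nat) : 0 <= x -> x ^+ m / m`!%:R <= expR x.
Proof.
move=> x0; rewrite -[X in X <= _]/(exp_coeff x m).
apply: (@le_trans _ _ (series (exp_coeff x) m.+1)).
  rewrite /series/= big_nat_recr//= lerDr; apply: sumr_ge0 => i _; exact: exp_coeff_ge0.
apply: nondecreasing_cvgn_le; last exact: is_cvg_series_exp_coeff.
by apply: nondecreasing_series => i _ _; exact: exp_coeff_ge0.
Qed.

Lemma fact_le_expn m : (m`! <= m ^ m)%N.
Proof.
elim: m => // m IH; rewrite factS expnS leq_mul2l/=.
by apply: (leq_trans IH); case: m {IH} => // m; rewrite leq_exp2r.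
Qed.

(* elementary symmetric polynomials: extract the weight [m / P] and bound by the whole product *)
Lemma sum_subsets_card_le (n m : nat) (w : 'I_n -> R) (P : R) : 0 < P ->
  (forall j, 0 <= w j) -> \sum_j w j <= P ->
  \sum_(u : {set 'I_n} | #|u| == m) \prod_(j in u) w j <= (expR 1 * P) ^+ m / m`!%:R.
Proof.
move=> P0 w0 wP; have [->|m0] := posnP m.
  rewrite expr0 fact0 invr1 mulr1 (bigD1 finset.set0) ?cards0//= big_set0 big1 ?addr0// => u.
  by rewrite finset.cards_eq0 => /andP[->].
set lam : R := m%:R / P; have lam0 : 0 < lam by rewrite divr_gt0// ltr0n.
have h : \sum_(u : {set 'I_n} | #|u| == m) lam ^+ m * \prod_(j in u) w j <= expR 1 ^+ m.
  apply: (@le_trans _ _ (\sum_(u : {set 'I_n}) \prod_(j in u) (lam * w j))).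
    rewrite big_mkcond/=; apply: ler_sum => u _; case: ifPn => [/eqP um|_]; last first.
      by apply: prodr_ge0 => j _; rewrite mulr_ge0// ltW.
    by rewrite -um -prodr_const -big_split.
  have -> : \sum_(u : {set 'I_n}) \prod_(j in u) (lam * w j) = \prod_j (lam * w j + 1).
    by rewrite bigA_distr; apply: eq_bigr => u _; rewrite big_mkcond.
  apply: (@le_trans _ _ (\prod_j expR (lam * w j))).
    apply: ler_prod => j _; apply/andP; split; last by rewrite addrC expR_ge1Dx.
    by rewrite addr_ge0// mulr_ge0// ltW.
  rewrite -expR_sum -mulr_sumr -expRM_natl ler_expR mulr1.
  by rewrite /lam -mulrA ler_piMr// mulrC ler_pdivrMr// mul1r.
rewrite -mulr_sumr -ler_pdivlMl ?exprn_gt0// in h.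
apply: (le_trans h); rewrite [X in _ <= X / _]exprMn mulrC -[X in _ <= X]mulrA ler_wpM2l ?exprn_ge0 ?expR_ge0//.
rewrite /lam exprMn invfM exprVn invrK mulrC ler_wpM2l ?exprn_ge0 ?(ltW P0)//.
rewrite lef_pV2 ?posrE ?exprn_gt0 ?ltr0n ?fact_gt0// -natrX ler_nat.
exact: fact_le_expn.
Qed.

Lemma sum_half_le n : \sum_(i < n) (2^-1 : R) ^+ i <= 2.
Proof.
suff -> : \sum_(i < n) (2^-1 : R) ^+ i = 2 - 2 * (2^-1) ^+ n.
  by rewrite lerBlDr lerDl mulr_ge0// exprn_ge0.
elim: n => [|n IH]; first by rewrite big_ord0 expr0; lra.
by rewrite big_ord_recr IH/= exprS; field.
Qed.

(** For [y] the power [eta^-1] of [2 * Z], the left side is the power [eta] of [y ^+ m / m!] times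
    [2^-1 ^+ m], and [y ^+ m / m!] is a term of the exponential series. *)
Lemma factorial_series_bound (Z eta : R) : 0 <= Z -> 0 < eta ->
  exists2 E : R, 0 <= E & forall m, Z ^+ m / (m`!%:R `^ eta) <= E * (2^-1) ^+ m.
Proof.
move=> Z0 eta0; set y := (2 * Z) `^ eta^-1.
exists (expR y `^ eta) => [|m]; first exact: powR_ge0.
have -> : Z ^+ m / m`!%:R `^ eta = (y ^+ m / m`!%:R) `^ eta * (2^-1) ^+ m.
  rewrite powRM ?exprn_ge0 ?powR_ge0 ?invr_ge0// powR_exprn ?powR_ge0//.
  rewrite /y -powRrM mulVf ?gt_eqF// powRr1 ?mulr_ge0//.
  rewrite -[m`!%:R^-1]powR_inv1// -powRrM mulN1r powRN.
  rewrite exprMn mulrAC mulrAC -[X in _ = X]mulrA [_ * 2^-1 ^+ m]mulrC.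
  rewrite exprVn; by field; rewrite expf_neq0// gt_eqF// powR_gt0// ltr0n fact_gt0.
rewrite ler_wpM2r ?exprn_ge0//; apply: ge0_ler_powR; rewrite ?nnegrE ?expR_ge0//; first exact: ltW.
  by rewrite divr_ge0 ?exprn_ge0 ?powR_ge0.
exact/exprn_le_expR/powR_ge0.
Qed.

(** As [tau >= p], it suffices to sum the powers with exponent [p]. Sets of size [m] contribute [m!]
    to the power [beta * p] times an elementary symmetric polynomial of size [(e P)^m / m!] at most;
    [beta * p < 1] leaves a positive power of [m!] in the denominator, which beats every geometric
    factor. *)
Lemma gevrey_subset_sum (beta p tau r P : R) :
  0 < p -> p <= tau -> beta * p < 1 -> 0 <= r -> 0 < P ->
  exists2 S : R, 0 <= S & forall (n : nat) (b : 'I_n -> R), (forall j, 0 <= b j) ->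
    \sum_j b j `^ p <= P ->
    \sum_(u : {set 'I_n}) ((#|u| `!)%:R `^ beta * r ^+ #|u| * \prod_(j in u) b j) `^ tau <= S.
Proof.
move=> p0 ptau bp r0 P0; set eta := 1 - beta * p; have eta0 : 0 < eta by rewrite subr_gt0.
set W := r `^ p; have W0 : 0 <= W by exact: powR_ge0.
have Z0 : 0 <= W * (expR 1 * P) by rewrite !mulr_ge0 ?expR_ge0// ltW.
have [E E0 hE] := factorial_series_bound Z0 eta0.
exists ((E * 2) `^ (tau / p)) => [|n b b0 bP]; first exact: powR_ge0.
pose x (u : {set 'I_n}) := ((#|u| `!)%:R `^ beta * r ^+ #|u| * \prod_(j in u) b j) `^ p.
have base0 (u : {set 'I_n}) : 0 <= (#|u| `!)%:R `^ beta * r ^+ #|u| * \prod_(j in u) b j.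
  by rewrite !mulr_ge0 ?powR_ge0 ?exprn_ge0// prodr_ge0.
have tp : 1 <= tau / p by rewrite ler_pdivlMr// mul1r.
apply: (@le_trans _ _ (\sum_(u : {set 'I_n}) x u `^ (tau / p))).
  by apply: ler_sum => u _; rewrite /x -powRrM mulrCA mulfV ?mulr1// gt_eqF.
apply: (le_trans (sum_powR_le _ tp _)) => [u|]; first exact: powR_ge0.
apply: ge0_ler_powR; rewrite ?nnegrE; [exact: le_trans ler01 tp| |exact: mulr_ge0|].
  by apply: sumr_ge0 => u _; exact: powR_ge0.
rewrite (partition_big (fun u : {set 'I_n} => inord #|u| : 'I_n.+1) xpredT)//=.
have un (u : {set 'I_n}) : (#|u| < n.+1)%N by rewrite ltnS -[X in (_ <= X)%N](card_ord n) max_card.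
apply: (@le_trans _ _ (\sum_(m < n.+1) E * (2^-1) ^+ m)); last first.
  by rewrite -mulr_sumr ler_wpM2l// sum_half_le.
apply: ler_sum => m _; apply: le_trans (hE m).
rewrite (eq_bigl (fun u : {set 'I_n} => #|u| == m)); last first.
  by move=> u; rewrite -val_eqE/= inordK.
have fm : 0 < (m`!)%:R :> R by rewrite ltr0n fact_gt0.
rewrite (eq_bigr (fun u : {set 'I_n} => (m`!)%:R `^ (beta * p) * W ^+ m * \prod_(j in u) b j `^ p)); last first.
  move=> u /eqP um; rewrite /x um !powRM ?mulr_ge0 ?powR_ge0 ?exprn_ge0 ?prodr_ge0//.
  by rewrite -powRrM powR_exprn// powR_prod.
rewrite -mulr_sumr.
have := sum_subsets_card_le m P0 (fun j => powR_ge0 (b j) p) bP.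
move=> h; apply: (@le_trans _ _ ((m`!)%:R `^ (beta * p) * W ^+ m * ((expR 1 * P) ^+ m / (m`!)%:R))).
  by rewrite ler_wpM2l// mulr_ge0 ?powR_ge0 ?exprn_ge0.
rewrite le_eqVlt; apply/orP; left; apply/eqP.
rewrite [in RHS]exprMn /eta powRB ?gt_eqF// powRr1 ?ltW//.
by field; rewrite !gt_eqF// powR_gt0.
Qed.
End summability.

(** * Positivity of the zeta function on [x > 1] *)

Section zeta_positive.
Context {R : realType}.

(** A telescoping majorant for the terms of the zeta series, from [ln (1 + x) <= x] and
    [1 + x <= expR x]. *)
Lemma powR_succ_le (a : R) (m : nat) : 0 < a -> (0 < m)%N ->
  a * (m.+1%:R `^ (1 + a))^-1 <= (m%:R `^ a)^-1 - (m.+1%:R `^ a)^-1.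
Proof.
move=> a0 m0; have mR : 0 < m%:R :> R by rewrite ltr0n.
have m1R : 0 < m.+1%:R :> R by rewrite ltr0n.
rewrite -!powRN /powR !gt_eqF//.
have lnE : ln m.+1%:R - ln m%:R >= m.+1%:R^-1 :> R.
  have := @le_ln1Dx R (- m.+1%:R^-1).
  have -> : 1 + - m.+1%:R^-1 = m%:R / m.+1%:R :> R.
    have -> : m%:R = m.+1%:R - 1 :> R by rewrite -natr1 addrK.
    by rewrite mulrBl mulfV ?gt_eqF// mul1r.
  rewrite lnM ?posrE ?invr_gt0// lnV ?posrE// => h.
  have : -1 < - m.+1%:R^-1 :> R by rewrite ltrN2 invf_lt1// ltr1n.
  by move=> /h; rewrite -[X in X <= _]opprB lerN2.
have -> : expR (- a * ln m%:R) =
    expR (- a * ln m.+1%:R) * expR (a * (ln m.+1%:R - ln m%:R)) :> R.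
  by rewrite -expRD; congr expR; ring.
have -> : expR (- (1 + a) * ln m.+1%:R) = expR (- a * ln m.+1%:R) / m.+1%:R :> R.
  have -> : - (1 + a) * ln m.+1%:R = - a * ln m.+1%:R + - ln m.+1%:R :> R by ring.
  by rewrite expRD expRN lnK.
have h : 1 + a * m.+1%:R^-1 <= expR (a * (ln m.+1%:R - ln m%:R)).
  by apply: le_trans (expR_ge1Dx _); rewrite lerD2l ler_wpM2l// ltW.
have p := expR_gt0 (- a * ln m.+1%:R).
rewrite mulrCA -[X in _ - X]mulr1 -mulrBr ler_wpM2l ?(ltW p)//.
by rewrite lerBrDr addrC.
Qed.

(** [zeta] is a [limn], informative only for a convergent series, so convergence is established on
    the way to positivity. *)
Lemma zeta_gt0 (x : R) : 1 < x -> 0 < zeta x.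
Proof.
move=> x1; pose a := x - 1; have a0 : 0 < a by rewrite subr_gt0.
have xE : x = 1 + a by rewrite addrC subrK.
set u := fun j : nat => (j.+1%:R `^ x)^-1 : R.
have u0 n : 0 <= u n by rewrite invr_ge0 powR_ge0.
have nd : nondecreasing_seq (series u) by apply: nondecreasing_series => n _ _.
have bd n : series u n.+1 <= 1 + a^-1 - a^-1 * (n.+1%:R `^ a)^-1.
  elim: n => [|n IH].
    by rewrite /series/= big_nat1 /u !powR1 invr1 mulr1 addrK.
  rewrite seriesSr; apply: le_trans (lerD IH (lexx _)) _.
  rewrite -addrA lerD2l -lerBrDl opprK addrC -mulrBr.
  rewrite -(ler_pM2l a0) mulVKf ?gt_eqF// /u xE.
  exact: powR_succ_le.
have cv : cvgn (series u).
  apply: nondecreasing_is_cvgn => //; exists (1 + a^-1) => _ [n _ <-].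
  apply: le_trans (nd _ _ (leqnSn n)) _; apply: le_trans (bd n) _.
  by rewrite gerBl mulr_ge0// invr_ge0 ?powR_ge0// ltW.
apply: (@lt_le_trans _ _ (series u 1)); last exact: nondecreasing_cvgn_le.
by rewrite /series/= big_nat1 /u powR1 invr1.
Qed.
End zeta_positive.

(** * Integrals of functions close to step functions *)

Section step_integrals.
Context d (T : measurableType d) (R : realType).
Variables (mu : {measure set T -> \bar R}) (D : set T).
Hypothesis mD : measurable D.

(** Both sides are suprema over nonnegative simple functions below the integrand, and a larger
    integrand admits more of them. *)
Lemma ge0_le_integral_nonmeas (f g : T -> \bar R) :
  (forall x, D x -> (0 <= f x)%E) -> (forall x, D x -> (f x <= g x)%E) ->
  (\int[mu]_(x in D) f x <= \int[mu]_(x in D) g x)%E.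
Proof.
move=> f0 fg; rewrite !ge0_integralE//; last first.
  by move=> x Dx; apply: le_trans (fg x Dx); exact: f0.
apply: le_ereal_sup => _ [h hf <-]; exists h => // x.
apply: le_trans (hf x) _; rewrite !patchE; case: ifPn => // /set_mem Dx.
exact: fg.
Qed.

Variables (I : finType) (p : T -> I) (w : I -> R).
Hypothesis mp : forall i, measurable (D `&` p @^-1` [set i]).
Hypothesis mup : forall i, mu (D `&` p @^-1` [set i]) = (w i)%:E.

Lemma weight_ge0 i : 0 <= w i.
Proof. by rewrite -lee_fin -mup measure_ge0. Qed.

Lemma integral_step (phi : I -> R) : (forall i, 0 <= phi i) ->
  (\int[mu]_(x in D) (phi (p x))%:E = (\sum_i phi i * w i)%:E)%E.
Proof.
move=> phi0.
transitivity (\int[mu]_(x in D) (\sum_(i : I) (phi i)%:E * (\1_(D `&` p @^-1` [set i]) x)%:E))%E.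
  apply: eq_integral => x /set_mem Dx.
  rewrite (bigD1 (p x))//= big1 ?adde0 => [|i ip].
    by rewrite indicE mem_set ?mule1//.
  rewrite indicE memNset ?mule0// => -[_] /= pi.
  by move: ip; rewrite pi eqxx.
rewrite ge0_integral_sum//; last 2 first.
- move=> i; apply/measurable_EFinP; apply: measurable_funM; first exact: measurable_cst.
  exact: measurable_indic.
- by move=> i x _; rewrite mule_ge0// lee_fin.
rewrite -sumEFin; apply: eq_bigr => i _; rewrite ge0_integralZl_EFin//; last first.
  by apply/measurable_EFinP; exact: measurable_indic.
by rewrite integral_indic// setIC setIA setIid mup EFinM.
Qed.

Lemma integral_le_step (f : T -> R) (phi : I -> R) :
  (forall x, D x -> 0 <= f x <= phi (p x)) -> (forall i, 0 <= phi i) ->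
  (\int[mu]_(x in D) (f x)%:E <= (\sum_i phi i * w i)%:E)%E.
Proof.
move=> fphi phi0; rewrite -integral_step//; apply: ge0_le_integral_nonmeas => x Dx.
  by rewrite lee_fin; have /andP[] := fphi x Dx.
by rewrite lee_fin; have /andP[] := fphi x Dx.
Qed.

Lemma ge0_integral_step_dist (f : T -> R) (phi : I -> R) (e : R) : 0 <= e ->
  (forall x, D x -> 0 <= f x) -> (forall i, 0 <= phi i) ->
  (forall x, D x -> `|f x - phi (p x)| <= e) ->
  exists2 v, (\int[mu]_(x in D) (f x)%:E = v%:E)%E &
   `|v - \sum_i phi i * w i| <= e * \sum_i w i.
Proof.
move=> e0 f0 phi0 h.
have up : (\int[mu]_(x in D) (f x)%:E <= (\sum_i (phi i + e) * w i)%:E)%E.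
  apply: integral_le_step => [x Dx|i]; last exact: addr_ge0.
  by rewrite f0//=; have := h x Dx; rewrite ler_distl addrC => /andP[_]; rewrite addrC.
have lo : ((\sum_i (Num.max (phi i - e) 0) * w i)%:E <= \int[mu]_(x in D) (f x)%:E)%E.
  rewrite -(integral_step (phi := fun i => Num.max (phi i - e) 0)) => [|i]; last by rewrite le_max lexx orbT.
  apply: ge0_le_integral_nonmeas => x Dx; rewrite lee_fin ?le_max ?lexx ?orbT//.
  rewrite ge_max f0// andbT; by have := h x Dx; rewrite ler_distl => /andP[].
exists (fine (\int[mu]_(x in D) (f x)%:E)).
  rewrite fineK// ge0_fin_numE; first by apply: le_lt_trans up _; rewrite ltry.
  by apply: integral_ge0 => x Dx; rewrite lee_fin f0.
have fin : (\int[mu]_(x in D) (f x)%:E)%E \is a fin_num.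
  rewrite ge0_fin_numE; first by apply: le_lt_trans up _; rewrite ltry.
  by apply: integral_ge0 => x Dx; rewrite lee_fin f0.
rewrite -(fineK fin) !lee_fin in up lo.
rewrite ler_distl; apply/andP; split.
  apply: le_trans lo; rewrite mulr_sumr -sumrB; apply: ler_sum => i _.
  by rewrite -mulrBl ler_wpM2r ?weight_ge0// le_max lexx.
apply: (le_trans up); rewrite mulr_sumr -big_split/=; apply: ler_sum => i _.
by rewrite mulrDl.
Qed.

(** Taking positive and negative parts is 1-Lipschitz; each part costs [e], whence the factor 2. *)
Lemma Rintegral_step_dist (f : T -> R) (phi : I -> R) (e : R) : 0 <= e ->
  (forall x, D x -> `|f x - phi (p x)| <= e) ->
  `|\int[mu]_(x in D) f x - \sum_i phi i * w i| <= 2 * e * \sum_i w i.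
Proof.
move=> e0 h; have max_dist (a b : R) : `|Num.max a 0 - Num.max b 0| <= `|a - b|.
  have := ler_norm (a - b); have := ler_norm (- (a - b)); rewrite normrN.
  rewrite ler_norml; case: (leP a 0); case: (leP b 0) => *; apply/andP; split; lra.
have part (g : T -> R) (psi : I -> R) : (forall x, D x -> `|g x - psi (p x)| <= e) ->
    exists2 v, (\int[mu]_(x in D) (Num.max (g x) 0)%:E = v%:E)%E &
   `|v - \sum_i Num.max (psi i) 0 * w i| <= e * \sum_i w i.
  move=> gpsi; apply: ge0_integral_step_dist => // [x _|i|x Dx]; rewrite ?le_max ?lexx ?orbT//.
  exact: le_trans (max_dist _ _) (gpsi x Dx).
have [v1 E1 h1] := part _ _ h.
have [|v2 E2 h2] := part (fun x => - f x) (fun i => - phi i).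
  by move=> x Dx; rewrite -opprD normrN h.
have maxE (a : R) : a = Num.max a 0 - Num.max (- a) 0.
  by case: (leP a 0); case: (leP (- a) 0) => *; lra.
have -> : \int[mu]_(x in D) f x = v1 - v2.
  rewrite /Rintegral integralE.
  rewrite (eq_integral (fun x => (Num.max (f x) 0)%:E))//; last first.
    by move=> x _; rewrite funeposE -EFin_max.
  rewrite [X in (_ - X)%E](eq_integral (fun x => (Num.max (- f x) 0)%:E))//; last first.
    by move=> x _; rewrite funenegE -EFin_max.
  by rewrite E1 E2.
have -> : \sum_i phi i * w i = \sum_i Num.max (phi i) 0 * w i - \sum_i Num.max (- phi i) 0 * w i.
  by rewrite -sumrB; apply: eq_bigr => i _; rewrite -mulrBl -maxE.
move: (\sum_i Num.max (phi i) 0 * w i) (\sum_i Num.max (- phi i) 0 * w i) h1 h2 => S1 S2 h1 h2.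
rewrite (_ : _ - _ = (v1 - S1) - (v2 - S2)); last by ring.
by apply: (le_trans (ler_normB _ _)); move: (\sum_i w i) h1 h2 => W; lra.
Qed.
End step_integrals.

(** * Lebesgue measure of boxes and of grid cells *)

Section boxes.
Context {R : realType}.

Definition box n (E : 'I_n -> set (measurableTypeR R)) : set 'cV[R]_n :=
  [set x | forall j, E j (x j 0)].

Lemma measurable_box n (E : 'I_n -> set (measurableTypeR R)) :
  (forall j, measurable (E j)) -> measurable (box E).
Proof.
move=> mE; have -> : box E = \bigcap_(j in [set: 'I_n]) ((fun x : 'cV[R]_n => x j 0) @^-1` E j).
  by apply/seteqP; split=> [x Ex j _|x Ex j]; [exact: Ex|exact: Ex].
apply: fin_bigcap_measurable => // j _.
by rewrite -[X in measurable X]setTI; apply: measurable_coord.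
Qed.

Lemma vcons_head n (p : measurableTypeR R * 'cV[R]_n) : vcons p ord0 0 = p.1.
Proof. by have /(congr1 fst) := vconsK p. Qed.

Lemma vcons_tail n (p : measurableTypeR R * 'cV[R]_n) (j : 'I_n) : vcons p (lift ord0 j) 0 = p.2 j 0.
Proof.
rewrite -[in RHS](vconsK p) /= [RHS]mxE.
by congr (vcons p _ _); exact: val_inj.
Qed.

Lemma leb_box n (E : 'I_n -> set (measurableTypeR R)) (w : 'I_n -> R) :
  (forall j, measurable (E j)) -> (forall j, lebesgue_measure (E j) = (w j)%:E) ->
  leb n (box E) = (\prod_j w j)%:E.
Proof.
elim: n E w => [|n IH] E w mE wE.
  by rewrite big_ord0 /= diracE mem_set// => -[].
rewrite big_ord_recl EFinM -wE -(IH (fun j => E (lift ord0 j)))//.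
rewrite -product_measure1E//; last exact: measurable_box.
rewrite /= /leb_step /pushforward; congr (_ _).
apply/seteqP; split=> -[a y] /=.
  by move=> Ex; split=> /= [|j]; [have := Ex ord0; rewrite vcons_head|have := Ex (lift ord0 j); rewrite vcons_tail].
move=> [/= Ea Ey] j; case: (unliftP ord0 j) => [i ->|->]; first by rewrite vcons_tail.
by rewrite vcons_head.
Qed.
End boxes.

Section cells.
Context {R : realType} (n : nat).
Variables (a h : R) (top : 'I_n.+1).
Hypothesis h0 : 0 < h.
Local Notation b := (a + n.+1%:R * h).

(* [top], the cell to which the endpoint [b] belongs, is the last one for an integration domain
   and the first one for the shifts, which act modulo 1. *)
Definition cell_index (x : R) : 'I_n.+1 :=
  if x == b then top else inord `|Num.floor ((x - a) / h)|.

Definition cell (i : 'I_n.+1) : set (measurableTypeR R) :=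
  `[a + i%:R * h, a + i.+1%:R * h[%classic `|` (if i == top then [set b] else set0).

Lemma cell_indexP (x : R) : a <= x < b ->
  a + (cell_index x)%:R * h <= x < a + (cell_index x).+1%:R * h.
Proof.
move=> /andP[ax xb]; rewrite /cell_index lt_eqF//.
set y := (x - a) / h; have y0 : 0 <= y by rewrite divr_ge0 ?subr_ge0// ltW.
have xE : x = a + y * h by rewrite /y divfK ?gt_eqF// addrC subrK.
have yn : y < n.+1%:R by rewrite ltr_pdivrMr// ltrBlDl.
have f0 : 0 <= Num.floor y by rewrite -floor_ge0 in y0 *.
have fE : (`|Num.floor y|%N)%:R = (Num.floor y)%:~R :> R by rewrite natr_absz ger0_norm.
have /andP[fy yf] := floor_itv y.
have fn : (`|Num.floor y| < n.+1)%N by rewrite -(ltr_nat R) fE (le_lt_trans fy).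
rewrite inordK// [in X in X && _]xE [in X in _ && X]xE lerD2l ltrD2l ler_pM2r// ltr_pM2r// fE fy/=.
by rewrite -natr1 fE -intrD1.
Qed.

Lemma cell_index_preimage (i : 'I_n.+1) : `[a, b]%classic `&` cell_index @^-1` [set i] = cell i.
Proof.
have hN k : (k <= n.+1)%N -> a + k%:R * h <= b by move=> kn; rewrite lerD2l ler_pM2r// ler_nat.
apply/seteqP; split=> x /=.
  rewrite in_itv/= => -[/andP[ax xb] xi]; rewrite /cell/=; move: xb; rewrite le_eqVlt => /predU1P[xb|xb].
    by right; move: xi; rewrite /cell_index xb eqxx => ->; rewrite eqxx.
  by left; rewrite /= in_itv/= -xi; apply: cell_indexP; rewrite ax.
move=> [|]; rewrite /= in_itv/=.
  move=> /andP[ix xi]; have ax : a <= x by apply: le_trans ix; rewrite lerDl mulr_ge0// ltW.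
  have xb : x < b by apply: lt_le_trans xi _; exact: hN.
  rewrite in_itv/= ax (ltW xb); split=> //.
  have /cell_indexP/andP[jx xj] : a <= x < b by rewrite ax.
  apply/val_inj/eqP; rewrite /= eqn_leq; apply/andP; split.
    by have := le_lt_trans jx xi; rewrite ltrD2l ltr_pM2r// ltr_nat ltnS.
  by have := le_lt_trans ix xj; rewrite ltrD2l ltr_pM2r// ltr_nat ltnS.
case: eqP => [->|]// ->; rewrite lexx andbT; split; first by rewrite lerDl mulr_ge0// ltW.
by rewrite /cell_index eqxx.
Qed.

Lemma measurable_cell i : measurable (cell i).
Proof. by apply: measurableU; [exact: measurable_itv|case: ifP => _]. Qed.

Lemma lebesgue_cell i : lebesgue_measure (cell i) = h%:E.
Proof.
rewrite measureU0//; last 2 first.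
- by case: ifP.
- by case: ifP => _; [exact: lebesgue_measure_set1|exact: measure0].
have /= := lebesgue_measure_itv `[a + i%:R * h, a + i.+1%:R * h[.
move=> ->; rewrite lte_fin ltrD2l ltr_pM2r// ltr_nat ltnSn -EFinB.
by congr EFin; rewrite -natr1; ring.
Qed.

Lemma measurable_cube d : measurable (cube d a b : set 'cV[R]_d).
Proof.
have -> : cube d a b = box (fun=> `[a, b]%classic).
  by apply/seteqP; split=> x xD j; have := xD j; rewrite /= in_itv.
by apply: measurable_box => j; exact: measurable_itv.
Qed.

Definition grid_index d (x : 'cV[R]_d) : {ffun 'I_d -> 'I_n.+1} := [ffun j => cell_index (x j 0)].

Lemma grid_index_preimage d (m : {ffun 'I_d -> 'I_n.+1}) :
  cube d a b `&` @grid_index d @^-1` [set m] = box (fun j => cell (m j)).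
Proof.
apply/seteqP; split=> x /=.
  by move=> [xD <-] j; rewrite -cell_index_preimage ffunE; split=> //=; rewrite in_itv/=; exact: xD.
move=> xm; split=> [j|]; first by have := xm j; rewrite -cell_index_preimage => -[] /=; rewrite in_itv.
by apply/ffunP => j; rewrite ffunE; have := xm j; rewrite -cell_index_preimage => -[].
Qed.

Lemma measurable_grid_index d (m : {ffun 'I_d -> 'I_n.+1}) :
  measurable (cube d a b `&` @grid_index d @^-1` [set m]).
Proof. by rewrite grid_index_preimage; apply: measurable_box => j; exact: measurable_cell. Qed.

Lemma leb_grid_index d (m : {ffun 'I_d -> 'I_n.+1}) :
  leb d (cube d a b `&` @grid_index d @^-1` [set m]) = (h ^+ d)%:E.
Proof.
rewrite grid_index_preimage (leb_box (w := fun=> h)).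
- by rewrite prodr_const card_ord.
- by move=> j; exact: measurable_cell.
- by move=> j; exact: lebesgue_cell.
Qed.
End cells.

(** * Discretisation *)

Section grid_points.
Context {R : realType} (n d : nat).
Local Notation N := (n.+1%:R : R).
Local Notation X := {ffun 'I_d -> 'I_n.+1}.
Implicit Types (m y : X) (u v w : {set 'I_d}).

Definition grid_pt (a h : R) m : 'cV[R]_d := \col_j (a + (m j)%:R * h).

Lemma grid_pt_cube (a h : R) m (r : 'cV[R]_d) : 0 <= h -> (forall j, 0 <= r j 0 <= h) ->
  cube d a (a + N * h) (grid_pt a h m + r).
Proof.
move=> h0 rh j; rewrite !mxE; have /andP[r0 r1] := rh j.
rewrite -addrA lerDl lerD2l addr_ge0 ?mulr_ge0//=.
apply: (@le_trans _ _ ((m j)%:R * h + h)); first by rewrite lerD2l.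
by rewrite -{2}[h]mul1r -mulrDl natr1 ler_wpM2r// ler_nat.
Qed.

Lemma grid_pt_cube0 (a h : R) m : 0 <= h -> cube d a (a + N * h) (grid_pt a h m).
Proof.
by move=> h0; rewrite -[grid_pt a h m]addr0; apply: grid_pt_cube => // j; rewrite mxE lexx.
Qed.

Lemma grid_index_dist (a h : R) (x : 'cV[R]_d) : 0 < h -> cube d a (a + N * h) x ->
  exists2 r : 'cV[R]_d, (forall j, 0 <= r j 0 <= h) &
    x = grid_pt a h (grid_index a h ord_max x) + r.
Proof.
move=> h0 xD; exists (x - grid_pt a h (grid_index a h ord_max x)); last by rewrite addrC subrK.
move=> j; rewrite !mxE ffunE; have /andP[ax] := xD j; rewrite le_eqVlt => /predU1P[xb|xb].
  (* The right endpoint lies in the last cell, at offset exactly [h]; this is why the bound on [r]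
     is closed. *)
  rewrite /cell_index xb eqxx /= -natr1.
  have -> : a + (n%:R + 1) * h - (a + n%:R * h) = h by ring.
  by rewrite lexx ltW.
have /andP[] : a + (@cell_index R n a h ord_max (x j 0))%:R * h <= x j 0 <
    a + (@cell_index R n a h ord_max (x j 0)).+1%:R * h by apply: cell_indexP; rewrite // ax.
rewrite -natr1 mulrDl mul1r addrA => h1 h2.
by rewrite subr_ge0 h1/= lerBlDl ltW.
Qed.

Lemma val_opred (y : 'I_n.+1) : y != 0 -> (opred y)%:R = y%:R - 1 :> R.
Proof.
move=> y0; have y1 : (0 < y)%N by rewrite lt0n.
rewrite /opred inordK; last by rewrite (leq_ltn_trans (leq_pred _)).
by rewrite -[in RHS](prednK y1) -natr1 addrK.
Qed.

Definition dir_step (h : R) u : 'cV[R]_d := \col_j (if j \in u then h else 0).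

Lemma vert_grid (a h : R) u v y : (forall l, l \in u -> y l != 0) -> v \subset u ->
  vert (grid_pt a h (lower u y)) (dir_step h u) v = grid_pt a h (lower (u :\: v) y).
Proof.
move=> yu vu; apply/colP => j; rewrite !mxE !ffunE inE.
have [jv|jv] /= := boolP (j \in v); last by rewrite addr0.
rewrite (fintype.subsetP vu _ jv) val_opred ?yu ?(fintype.subsetP vu)//.
by ring.
Qed.

(** [mdiff] takes backward differences at [y] and [bdiff] forward ones at the lower corner;
    complementing subsets within [u] matches terms and signs. On nonzero coordinates [opred] really
    lowers by 1. *)
Lemma mdiff_bdiff (Phi : 'cV[R]_d -> R) (a h : R) u y : (forall l, l \in u -> y l != 0) ->
  mdiff u (fun m => Phi (grid_pt a h m)) y = N ^+ #|u| *
  bdiff u (fun v => Phi (vert (grid_pt a h (lower u y)) (dir_step h u) v)) finset.set0.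
Proof.
move=> yu; rewrite /mdiff; congr (_ * _).
rewrite /bdiff (reindex_onto (fun w => u :\: w) (fun w => u :\: w))/=; last first.
  by move=> w wu; rewrite finset.setDDr finset.setDv finset.set0U (finset.setIidPr wu).
apply: eq_big => [w|w /andP[_ /eqP wE]].
  rewrite finset.subsetDl/= finset.setDDr finset.setDv finset.set0U.
  by apply/eqP/idP => [<-|wu]; [rewrite finset.subsetIl|exact/finset.setIidPr].
have wu : w \subset u by rewrite -wE finset.subsetDl.
by rewrite finset.set0U vert_grid.
Qed.

Lemma dir_step_cube (a h : R) u y : 0 <= h -> (forall l, l \in u -> y l != 0) ->
  [/\ cube d a (a + N * h) (grid_pt a h (lower u y)),
      forall j, 0 <= dir_step h u j 0 &
      cube d a (a + N * h) (grid_pt a h (lower u y) + dir_step h u)].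
Proof.
move=> h0 yu; split.
- exact: grid_pt_cube0.
- by move=> j; rewrite mxE; case: ifP.
- by apply: grid_pt_cube => // j; rewrite mxE; case: ifP; rewrite ?lexx ?h0.
Qed.
End grid_points.

(** The coordinates are moved one at a time, and each move is a first difference. *)
Lemma bnd_path (R : realType) (I : finType) (A a : {set I} -> R) : bnd A a ->
  `|a [set: I]%SET - a finset.set0| <= \sum_j A [set j]%SET.
Proof.
move=> Aa; suff h v : `|a v - a finset.set0| <= \sum_(j in v) A [set j]%SET.
  by have := h [set: I]%SET; rewrite (eq_bigl xpredT)// => j; rewrite inE.
have [m vm] := ubnP #|v|; elim: m v vm => // m IH v vm.
have [->|/set0Pn[j jv]] := eqVneq v finset.set0.
  by rewrite subrr normr0 big_set0.
rewrite -(finset.setD1K jv) big_setU1 ?inE ?eqxx//=.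
rewrite -[X in `|X - _|](subrK (a (v :\ j))) -addrA.
apply: le_trans (ler_normD _ _) (lerD _ _); last first.
  by apply: IH; move: vm; rewrite (cardsD1 j v) jv.
have dj : [disjoint [set j]%SET & v :\ j]%B by rewrite finset.disjoints1 !inE eqxx.
have E x : bdiff [set j]%SET a x = a (j |: x) - a x.
  by rewrite -[[set j]%SET]finset.setU0 bdiffU1 ?inE// !bdiff0 finset.setU0.
by rewrite -E; exact: Aa.
Qed.

Section lattice_points.
Context {R : realType} (n d : nat).
Local Notation N := (n.+1%:R : R).

Lemma lattice_pt_period (z : 'I_d -> nat) (Delta : 'cV[R]_d) :
  cube d 0 1 Delta -> lattice_pt n.+1 z Delta n.+1 = lattice_pt n.+1 z Delta 0.
Proof.
move=> D01; apply/colP => j; rewrite !mxE mul0n mul0r add0r.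
rewrite natrM mulrAC mulfV ?pnatr_eq0// mul1r /fracpart.
by rewrite floorDzr ?natr_int// intrD floorK ?natr_int//; ring.
Qed.

(** The offset [r] is common to all points of the rule, since translations by multiples of [1 / N]
    permute the cells modulo 1. A shift coordinate equal to 1 acts as 0, with offset 0. *)
Lemma lattice_pt_grid (z : 'I_d -> nat) (Delta : 'cV[R]_d) : cube d 0 1 Delta ->
  exists2 r : 'cV[R]_d, (forall j, 0 <= r j 0 <= N^-1) &
    forall i : 'I_n.+1, lattice_pt n.+1 z Delta i =
      grid_pt 0 N^-1 (lat (@zmod n d z) (grid_index 0 N^-1 ord0 Delta) i) + r.
Proof.
move=> D01; have N0 : 0 < N^-1 by rewrite invr_gt0 ltr0n.
have NN : N * N^-1 = 1 by rewrite mulfV ?pnatr_eq0.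
have key (x : R) : 0 <= x <= 1 -> exists2 r : R, 0 <= r < N^-1 &
    forall t : nat, fracpart (t%:R / N + x) = ((t + @cell_index R n 0 N^-1 ord0 x) %% n.+1)%:R * N^-1 + r.
  move=> /andP[x0]; rewrite le_eqVlt => /predU1P[->|x1].
    exists 0; first by rewrite lexx.
    move=> t; rewrite /cell_index add0r NN eqxx addn0.
    have -> : t%:R / N + 1 = (t + n.+1)%:R / N by rewrite natrD mulrDl NN.
    by rewrite -[X in fracpart X]addr0 fracpart_grid ?lexx// modnDr.
  set c : nat := @cell_index R n 0 N^-1 ord0 x.
  have rb : 0 <= x - c%:R * N^-1 < N^-1.
    have : 0 + c%:R * N^-1 <= x < 0 + c.+1%:R * N^-1.
      by apply: cell_indexP; rewrite // x0 add0r NN.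
    rewrite !add0r -[c.+1%:R]natr1 mulrDl mul1r => /andP[h1 h2].
    by rewrite subr_ge0 h1/= ltrBlDl.
  exists (x - c%:R * N^-1) => // t; rewrite -fracpart_grid//.
  by congr fracpart; rewrite natrD mulrDl -addrA; congr (_ + _); rewrite addrC subrK.
have /choice[r hr] : forall j : 'I_d, exists r : R, 0 <= r <= N^-1 /\
    forall t : nat, fracpart (t%:R / N + Delta j 0) =
      ((t + @cell_index R n 0 N^-1 ord0 (Delta j 0)) %% n.+1)%:R * N^-1 + r.
  by move=> j; have [r /andP[r0 r1] k] := key _ (D01 j); exists r; rewrite r0 ltW.
exists (\col_j r j) => [j|i]; first by rewrite mxE; have [] := hr j.
apply/colP => j; have [_ k] := hr j; rewrite !mxE k !ffunE add0r; congr (_%:R * _ + _).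
by rewrite /= val_zmod_mulrn modnDml.
Qed.
End lattice_points.

(** * Lipschitz bound for the entropy integrand away from 0 *)

Section xlogx_lipschitz.
Context {R : realType}.

(** From [x ln x - y ln y = (x - y) ln x + y (ln x - ln y)]: the two logarithms bound [|ln x|], and
    [M / c] combines [y <= M] with the slope [c^-1] of [ln]. *)
Definition xlogx_lip (c M : R) : R := `|ln c| + `|ln M| + M / c.

Lemma xlogx_lip_ge0 (c M : R) : 0 < c -> c <= M -> 0 <= xlogx_lip c M.
Proof.
by move=> c0 cM; rewrite !addr_ge0// divr_ge0// ?(ltW c0)// (le_trans (ltW c0)).
Qed.

Lemma xlogx_lipschitz (c M x y : R) : 0 < c -> c <= x <= M -> c <= y <= M ->
  `|xlogx x - xlogx y| <= xlogx_lip c M * `|x - y|.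
Proof.
move=> c0 /andP[cx xM] /andP[cy yM].
have x0 := lt_le_trans c0 cx; have y0 := lt_le_trans c0 cy.
have half (s t : R) : c <= s -> c <= t -> ln s - ln t <= `|s - t| / c.
  move=> cs ct; have s0 := lt_le_trans c0 cs; have t0 := lt_le_trans c0 ct.
  have := @le_ln1Dx R (s / t - 1); rewrite [1 + _]addrC subrK lnM ?posrE ?invr_gt0// lnV ?posrE//.
  move=> h; apply: (@le_trans _ _ (s / t - 1)); first by apply: h; rewrite ltrBDr addNr divr_gt0.
  have -> : s / t - 1 = (s - t) / t by rewrite mulrBl mulfV ?gt_eqF.
  apply: (@le_trans _ _ (`|s - t| / t)); first by rewrite ler_wpM2r ?invr_ge0 ?(ltW t0)// ler_norm.
  by rewrite ler_wpM2l// lef_pV2 ?posrE.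
have lnB : `|ln x - ln y| <= `|x - y| / c.
  rewrite ler_norml lerNl opprB half// andbT; rewrite distrC.
  by rewrite half.
have lnx : `|ln x| <= `|ln c| + `|ln M|.
  have h1 : ln c <= ln x by rewrite ler_ln ?posrE.
  have h2 : ln x <= ln M by rewrite ler_ln ?posrE// (lt_le_trans x0).
  have := ler_norm (ln M); have := ler_norm (- ln c); rewrite normrN => h3 h4.
  have := normr_ge0 (ln M); have := normr_ge0 (ln c).
  by rewrite ler_norml => *; apply/andP; split; lra.
have -> : xlogx x - xlogx y = (x - y) * ln x + y * (ln x - ln y) by rewrite /xlogx; ring.
apply: le_trans (ler_normD _ _) _; rewrite !normrM /xlogx_lip mulrDl lerD//.
  by rewrite mulrC ler_wpM2r.
rewrite (gtr0_norm y0); apply: (@le_trans _ _ (M * (`|x - y| / c))); last by rewrite mulrCA mulrC.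
by apply: ler_pM => //; exact: ltW.
Qed.

Lemma avg_itv (T : finType) (c M : R) (F : T -> R) : (0 < #|T|)%N ->
  (forall t, c <= F t <= M) -> c <= avg F <= M.
Proof.
move=> T0 h; rewrite -{1}(avg_const c T0) -[X in _ && (_ <= X)](avg_const M T0).
by rewrite !ler_avg// => t; have /andP[] := h t.
Qed.

Lemma avg_dist (T : finType) (e : R) (F G : T -> R) : (0 < #|T|)%N ->
  (forall t, `|F t - G t| <= e) -> `|avg F - avg G| <= e.
Proof.
move=> T0 h; rewrite -avgB; apply: le_trans (ler_norm_avg _) _.
by rewrite -[X in _ <= X](avg_const e T0); exact: ler_avg.
Qed.
End xlogx_lipschitz.

Section likelihood_on_grid.
Context {R : realType}.
Variables (k s n : nat) (K C beta B1 : R) (Gamma : 'M[R]_k) (b : nat -> R) (G : 'cV[R]_s -> 'cV[R]_k).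
Hypotheses (hG : spd Gamma) (K0 : 0 < K) (C1 : 1 <= C) (beta1 : 1 <= beta) (b0 : forall j, 0 <= b j).
Hypotheses (sG : smooth_on (Theta s) G) (bG : gevrey_bound C beta b G).
Hypothesis hB1 : \sum_(j < s) b j <= B1.
Local Notation N := (n.+1%:R : R).
Let f := likelihood Gamma G.
Let Mth := lik_const K C Gamma.
Let My := normconst Gamma * expR (2 * quad_const (invmx Gamma) (K + C + 1)).
Let cmin := lik_min K C Gamma.
Let cmax := normconst Gamma.

Definition theta_pt (m : {ffun 'I_s -> 'I_n.+1}) : 'cV[R]_s := grid_pt (- 2^-1) N^-1 m.
Definition y_pt (m : {ffun 'I_k -> 'I_n.+1}) : 'cV[R]_k := grid_pt (- K) (2 * K / N) m.

Let NV0 : 0 < N^-1. Proof. by rewrite invr_gt0 ltr0n. Qed.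

Lemma y_step_gt0 : 0 < 2 * K / N.
Proof. by rewrite !mulr_gt0. Qed.

Lemma theta_cubeE : cube s (- 2^-1) (- 2^-1 + N * N^-1) = Theta s.
Proof. by rewrite /Theta mulfV ?pnatr_eq0//; congr cube; field. Qed.

Lemma y_cubeE : cube k (- K) (- K + N * (2 * K / N)) = cube k (- K) K.
Proof. by rewrite mulrC divfK ?pnatr_eq0//; congr cube; ring. Qed.

Lemma vert_setT d (x r : 'cV[R]_d) : vert x r [set: 'I_d]%SET = x + r.
Proof. by apply/colP => j; rewrite !mxE inE. Qed.

Lemma vert_set0 d (x r : 'cV[R]_d) : vert x r finset.set0 = x.
Proof. by apply/colP => j; rewrite !mxE inE addr0. Qed.

Lemma gev_set1 (I : finType) (be : R) (c : I -> R) M r j : gev be c M r [set j]%SET = M * r * c j.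
Proof. by rewrite /gev cards1 big_set1 expr1 (_ : (1 `!)%N = 1%N)// powR1 mulr1. Qed.

Lemma Mth_ge0 : 0 <= Mth.
Proof. by rewrite mulr_ge0 ?expR_ge0// ltW// normconst_gt0. Qed.

Lemma My_ge0 : 0 <= My.
Proof. by rewrite mulr_ge0 ?expR_ge0// ltW// normconst_gt0. Qed.

(** Only first differences occur, so independence of [s] comes down to the bound [B1] on the sum of
    the [b j]. *)
Lemma likelihood_dist_theta m (r : 'cV[R]_s) y : cube k (- K) K y -> (forall j, 0 <= r j 0 <= N^-1) ->
  `|f (theta_pt m + r) y - f (theta_pt m) y| <= 4 * Mth * B1 / N.
Proof.
move=> yK rN; have r0 j : 0 <= r j 0 by have /andP[] := rN j.
have h0 := ltW NV0.
have xT : Theta s (theta_pt m) by rewrite -theta_cubeE; exact: grid_pt_cube0.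
have xrT : Theta s (theta_pt m + r) by rewrite -theta_cubeE; exact: grid_pt_cube.
have := bnd_path (bnd_likelihood_theta hG K0 C1 beta1 b0 sG bG yK xT r0 xrT).
rewrite vert_setT vert_set0 => /le_trans; apply.
apply: (@le_trans _ _ (\sum_(j < s) Mth * 4 * (b j * N^-1))).
  apply: ler_sum => j _; rewrite gev_set1; apply: ler_wpM2l; first by rewrite mulr_ge0// Mth_ge0.
  apply: ler_wpM2l => //.
  by have /andP[] := rN j.
have -> : 4 * Mth * B1 / N = Mth * 4 * (B1 * N^-1) by ring.
rewrite -mulr_sumr -mulr_suml; apply: ler_wpM2l; first by rewrite mulr_ge0// Mth_ge0.
by rewrite ler_wpM2r.
Qed.

Lemma likelihood_dist_y theta m (r : 'cV[R]_k) : Theta s theta -> (forall j, 0 <= r j 0 <= 2 * K / N) ->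
  `|f theta (y_pt m + r) - f theta (y_pt m)| <= 8 * My * K * k%:R / N.
Proof.
move=> th rN; have r0 j : 0 <= r j 0 by have /andP[] := rN j.
have h0 := ltW y_step_gt0.
have xT : cube k (- K) K (y_pt m) by rewrite -y_cubeE; exact: grid_pt_cube0.
have xrT : cube k (- K) K (y_pt m + r) by rewrite -y_cubeE; exact: grid_pt_cube.
have := bnd_path (bnd_likelihood_y hG K0 C1 bG th xT r0 xrT).
rewrite vert_setT vert_set0 => /le_trans; apply.
apply: (@le_trans _ _ (\sum_(j < k) My * 4 * (2 * K / N))).
  apply: ler_sum => j _; rewrite gev_set1; apply: ler_wpM2l; first by rewrite mulr_ge0// My_ge0.
  by have /andP[] := rN j.
rewrite sumr_const card_ord -[_ *+ k]mulr_natr le_eqVlt; apply/orP; left; apply/eqP.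
by ring.
Qed.

Lemma theta_pt_Theta m : Theta s (theta_pt m).
Proof. by rewrite -theta_cubeE; apply: grid_pt_cube0; exact: ltW. Qed.

Lemma y_pt_cube m : cube k (- K) K (y_pt m).
Proof. by rewrite -y_cubeE; apply: grid_pt_cube0; exact: ltW y_step_gt0. Qed.

Lemma likelihood_grid_bounds m2 m1 : cmin <= f (theta_pt m2) (y_pt m1) <= cmax.
Proof. by apply: (likelihood_bounds hG bG); [exact: theta_pt_Theta|exact: y_pt_cube]. Qed.

Lemma cmin_gt0 : 0 < cmin. Proof. exact: lik_min_gt0. Qed.

Lemma cmin_le_cmax : cmin <= cmax.
Proof.
rewrite /cmin /lik_min ler_piMr ?(ltW (normconst_gt0 hG))// -expR0 ler_expR oppr_le0.
by apply: sumr_ge0 => j _; apply: sumr_ge0 => i _; rewrite !mulr_ge0// addr_ge0// ?(ltW K0)// (le_trans ler01).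
Qed.
End likelihood_on_grid.

Section grid_averages.
Context {R : realType}.

Lemma sum_grid_weight (n d : nat) (h : R) (phi : {ffun 'I_d -> 'I_n.+1} -> R) :
  \sum_m phi m * h ^+ d = (n.+1%:R * h) ^+ d * avg phi.
Proof.
rewrite -mulr_suml /avg card_ffun !card_ord exprMn natrX mulrC mulrAC mulrA.
by rewrite mulrAC mulfV ?mul1r 1?mulrC// expf_neq0// pnatr_eq0.
Qed.

Lemma lattice_rule_avg (n d : nat) (z : 'I_d -> nat) (Delta : 'cV[R]_d) (F : 'cV[R]_d -> R) :
  cube d 0 1 Delta ->
  lattice_rule n.+1 z Delta F = avg (fun i : 'I_n.+1 => F (lattice_pt n.+1 z Delta i)).
Proof.
move=> D01; rewrite /lattice_rule /avg card_ord; congr (_ * _).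
rewrite (sum_period (f := fun i => F (lattice_pt n.+1 z Delta i)))//.
by rewrite lattice_pt_period.
Qed.
End grid_averages.

Section discretisation.
Context {R : realType}.
Variables (k s n : nat) (K C beta B1 : R) (Gamma : 'M[R]_k) (b : nat -> R) (G : 'cV[R]_s -> 'cV[R]_k).
Hypotheses (hG : spd Gamma) (K0 : 0 < K) (C1 : 1 <= C) (beta1 : 1 <= beta) (b0 : forall j, 0 <= b j).
Hypotheses (sG : smooth_on (Theta s) G) (bG : gevrey_bound C beta b G).
Hypothesis hB1 : \sum_(j < s) b j <= B1.
Local Notation N := (n.+1%:R : R).
Local Notation f := (likelihood Gamma G).
Local Notation Xs := {ffun 'I_s -> 'I_n.+1}.
Local Notation Xk := {ffun 'I_k -> 'I_n.+1}.
Local Notation cmin := (lik_min K C Gamma).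
Local Notation cmax := (normconst Gamma).
Local Notation theta_pt := (@theta_pt R s n).
Local Notation y_pt := (@y_pt R k n K).
Let e1 := 4 * lik_const K C Gamma * B1.
Let e2 := 8 * (normconst Gamma * expR (2 * quad_const (invmx Gamma) (K + C + 1))) * K * k%:R.
Let L := xlogx_lip cmin cmax.
Variables (z1 : 'I_k -> nat) (z2 : 'I_s -> nat).

Definition grid_inner (m1 : Xk) : R := avg (fun m2 : Xs => f (theta_pt m2) (y_pt m1)).
Definition grid_inner_rule (d2 : Xs) (m1 : Xk) : R :=
  avg (fun i => f (theta_pt (lat (@zmod n s z2) d2 i)) (y_pt m1)).
Definition grid_outer : R := (2 * K) ^+ k * avg (fun m1 => xlogx (grid_inner m1)).
Definition grid_tensor_rule (d1 : Xk) (d2 : Xs) : R :=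
  (2 * K) ^+ k * avg (fun i => xlogx (grid_inner_rule d2 (lat (@zmod n k z1) d1 i))).

Let NV0 : 0 < N^-1. Proof. by rewrite invr_gt0 ltr0n. Qed.
Let NN : N * N^-1 = 1. Proof. by rewrite mulfV ?pnatr_eq0. Qed.
Let X0 d : (0 < #|{: {ffun 'I_d -> 'I_n.+1}}|)%N.
Proof. by rewrite card_ffun !card_ord expn_gt0. Qed.
Let cm0 : 0 < cmin. Proof. exact: cmin_gt0. Qed.
Let cmm : cmin <= cmax. Proof. exact: cmin_le_cmax. Qed.

Lemma grid_inner_bounds m1 : cmin <= grid_inner m1 <= cmax.
Proof. by apply: avg_itv => // m2; exact: (likelihood_grid_bounds hG K0 bG). Qed.

Lemma grid_inner_rule_bounds d2 m1 : cmin <= grid_inner_rule d2 m1 <= cmax.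
Proof. by apply: avg_itv => [|i]; rewrite ?card_ord//; exact: (likelihood_grid_bounds hG K0 bG). Qed.

Lemma likelihood_dist m2 (r2 : 'cV[R]_s) m1 (r1 : 'cV[R]_k) :
  (forall j, 0 <= r2 j 0 <= N^-1) -> (forall j, 0 <= r1 j 0 <= 2 * K / N) ->
  `|f (theta_pt m2 + r2) (y_pt m1 + r1) - f (theta_pt m2) (y_pt m1)| <= (e1 + e2) / N.
Proof.
move=> h2 h1; rewrite -[X in `|X - _|](subrK (f (theta_pt m2) (y_pt m1 + r1))) -addrA mulrDl.
apply: le_trans (ler_normD _ _) (lerD _ _).
  apply: (likelihood_dist_theta hG K0 C1 beta1 b0 sG bG hB1) => //.
  by rewrite -(y_cubeE k n K); apply: grid_pt_cube => //; exact/ltW/y_step_gt0.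
apply: (likelihood_dist_y hG K0 C1 bG) => //.
by apply: theta_pt_Theta.
Qed.

Let e_ge0 : 0 <= (e1 + e2) / N.
Proof.
apply: le_trans (normr_ge0 _) (@likelihood_dist [ffun=> 0] 0 [ffun=> 0] 0 _ _) => j; rewrite mxE lexx ltW//.
exact: y_step_gt0.
Qed.

Lemma integral_theta y : cube k (- K) K y ->
  (`|\int[leb s]_(theta in Theta s) f theta y - avg (fun m2 : Xs => f (theta_pt m2) y)| <= e1 / N) /\
  cmin <= \int[leb s]_(theta in Theta s) f theta y <= cmax.
Proof.
move=> yK; have TE := theta_cubeE (R := R) s n.
have mT : measurable (Theta s : set 'cV[R]_s) by rewrite -TE; exact: measurable_cube.
have mp (m : Xs) : measurable (Theta s `&` @grid_index R n (- 2^-1) N^-1 ord_max s @^-1` [set m]).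
  by rewrite -TE; exact: measurable_grid_index.
have mup (m : Xs) : leb s (Theta s `&` @grid_index R n (- 2^-1) N^-1 ord_max s @^-1` [set m]) =
    (N^-1 ^+ s)%:E.
  by rewrite -TE; exact: leb_grid_index.
have fb theta : Theta s theta -> cmin <= f theta y <= cmax.
  by move=> th; exact: (likelihood_bounds hG bG).
have f0 theta : Theta s theta -> 0 <= f theta y.
  by move=> /fb /andP[h _]; rewrite (le_trans (ltW cm0)).
have w1 : \sum_(m : Xs) N^-1 ^+ s = 1.
  have := sum_grid_weight N^-1 (fun _ : Xs => 1); rewrite NN expr1n avg_const// mulr1.
  by under eq_bigr do rewrite mul1r.
have e10 : 0 <= e1 / N.
  apply: le_trans (normr_ge0 _) (likelihood_dist_theta hG K0 C1 beta1 b0 sG bG hB1 [ffun=> 0] (r := 0) yK _).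
  by move=> j; rewrite mxE lexx ltW.
split.
  have [|||v vE] := @ge0_integral_step_dist _ _ _ (leb s) (Theta s) mT _ _ _ mp mup
    (fun theta => f theta y) (fun m => f (theta_pt m) y) (e1 / N) e10.
  - exact: f0.
  - by move=> m; apply: f0; exact: theta_pt_Theta.
  - move=> theta th; rewrite -TE in th.
    have [r rN thE] := grid_index_dist NV0 th.
    rewrite {1}thE; exact: (likelihood_dist_theta hG K0 C1 beta1 b0 sG bG hB1).
  - by rewrite w1 mulr1 sum_grid_weight NN expr1n mul1r /Rintegral vE.
(* The two-sided bound comes from the same estimate, with a constant step function at the midpoint
   and half the width as distance. *)
pose mid := (cmin + cmax) / 2; pose rad := (cmax - cmin) / 2.
have [||||v vE] := @ge0_integral_step_dist _ _ _ (leb s) (Theta s) mT _ _ _ mp mup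
    (fun theta => f theta y) (fun m => mid) rad.
- by rewrite divr_ge0// subr_ge0.
- exact: f0.
- by move=> m; rewrite divr_ge0// addr_ge0// ?(ltW cm0)// (le_trans (ltW cm0)).
- by move=> theta /fb/andP[h1 h2]; rewrite ler_distl /mid /rad; apply/andP; split; lra.
rewrite -mulr_sumr w1 !mulr1 /Rintegral vE/= ler_distl /mid /rad => /andP[h1 h2].
by apply/andP; split; lra.
Qed.

Lemma I_K_grid : `|I_K K f - grid_outer| <= 2 * (L * ((e1 + e2) / N)) * (2 * K) ^+ k.
Proof.
have YE := y_cubeE k n K; have hy := y_step_gt0 n K0.
have mY : measurable (cube k (- K) K : set 'cV[R]_k) by rewrite -YE; exact: measurable_cube.
have mp (m : Xk) : measurable (cube k (- K) K `&` @grid_index R n (- K) (2 * K / N) ord_max k @^-1` [set m]).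
  by rewrite -YE; exact: measurable_grid_index.
have mup (m : Xk) : leb k (cube k (- K) K `&` @grid_index R n (- K) (2 * K / N) ord_max k @^-1` [set m]) =
    ((2 * K / N) ^+ k)%:E.
  by rewrite -YE; exact: leb_grid_index.
have w1 : \sum_(m : Xk) (2 * K / N) ^+ k = (2 * K) ^+ k.
  have := sum_grid_weight (2 * K / N) (fun _ : Xk => 1).
  rewrite [N * (_ / _)]mulrC divfK ?pnatr_eq0// avg_const// mulr1.
  by under eq_bigr do rewrite mul1r.
have := @Rintegral_step_dist _ _ _ (leb k) (cube k (- K) K) mY _ _ _ mp mup
    (fun y => xlogx (\int[leb s]_(theta in Theta s) f theta y))
    (fun m => xlogx (grid_inner m)) (L * ((e1 + e2) / N)).
rewrite w1 sum_grid_weight [N * (2 * K / _)]mulrC divfK ?pnatr_eq0//; apply.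
  by rewrite mulr_ge0// xlogx_lip_ge0.
move=> y yK; have [h1 h2] := integral_theta yK.
apply: le_trans (xlogx_lipschitz cm0 h2 (grid_inner_bounds _)) _.
rewrite ler_wpM2l ?xlogx_lip_ge0//.
set m := grid_index _ _ _ _.
rewrite -[X in `|X - _|](subrK (avg (fun m2 : Xs => f (theta_pt m2) y))) -addrA mulrDl.
apply: le_trans (ler_normD _ _) (lerD h1 _).
apply: avg_dist => // m2; rewrite -YE in yK.
have [r rN yE] := grid_index_dist hy yK.
rewrite {1}yE; apply: (likelihood_dist_y hG K0 C1 bG) => //.
exact: theta_pt_Theta.
Qed.

Lemma tensor_rule_grid l (D1 : 'cV[R]_k) (D2 : 'cV[R]_s) : (2 ^ l = n.+1)%N ->
  cube k 0 1 D1 -> cube s 0 1 D2 ->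
  `|tensor_rule K l z1 z2 f D1 D2 -
    grid_tensor_rule (grid_index 0 N^-1 ord0 D1) (grid_index 0 N^-1 ord0 D2)| <=
  L * ((e1 + e2) / N) * (2 * K) ^+ k.
Proof.
move=> lN D1c D2c; rewrite /tensor_rule /Q1 /Q2 lN /grid_tensor_rule -mulrBr.
have K2 : 0 <= 2 * K by rewrite mulr_ge0// ltW.
rewrite normrM ger0_norm ?exprn_ge0// mulrC ler_wpM2r ?exprn_ge0//.
rewrite lattice_rule_avg//; apply: avg_dist => [|i]; first by rewrite card_ord.
rewrite lattice_rule_avg//.
have [r1 r1N D1E] := lattice_pt_grid n z1 D1c; have [r2 r2N D2E] := lattice_pt_grid n z2 D2c.
set d1 := grid_index _ _ _ D1 in D1E *; set d2 := grid_index _ _ _ D2 in D2E *.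
have yE : (2 * K) *: lattice_pt n.+1 z1 D1 i - const_mx K =
    y_pt (lat (@zmod n k z1) d1 i) + (2 * K) *: r1.
  by apply/colP => j; rewrite D1E !mxE; ring.
have thE (i2 : 'I_n.+1) : lattice_pt n.+1 z2 D2 i2 - const_mx 2^-1 = theta_pt (lat (@zmod n s z2) d2 i2) + r2.
  by apply/colP => j; rewrite D2E !mxE; ring.
have r1K j : 0 <= ((2 * K) *: r1) j 0 <= 2 * K / N.
  by rewrite mxE; have /andP[h1 h2] := r1N j; rewrite mulr_ge0//= ler_wpM2l.
apply: le_trans (xlogx_lipschitz cm0 _ (grid_inner_rule_bounds _ _)) _.
  apply: avg_itv => [|i2]; first by rewrite card_ord.
  rewrite yE thE; apply: (likelihood_bounds hG bG).
    by rewrite -(theta_cubeE s n); apply: grid_pt_cube => //; exact: ltW.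
  by rewrite -(y_cubeE k n K); apply: grid_pt_cube => //; exact/ltW/y_step_gt0.
rewrite ler_wpM2l ?xlogx_lip_ge0//; apply: avg_dist => [|i2]; first by rewrite card_ord.
by rewrite yE thE; exact: likelihood_dist.
Qed.
End discretisation.

(** * The error estimate *)

Section variances.
Context {R : realType}.
Variables (k s n l : nat) (K C beta : R) (Gamma : 'M[R]_k) (b : nat -> R) (G : 'cV[R]_s -> 'cV[R]_k).
Hypotheses (hG : spd Gamma) (K0 : 0 < K) (C1 : 1 <= C) (beta1 : 1 <= beta) (b0 : forall j, 0 <= b j).
Hypotheses (sG : smooth_on (Theta s) G) (bG : gevrey_bound C beta b G).
Hypothesis hN : (2 ^ l = n.+1)%N.
Local Notation N := (n.+1%:R : R).
Local Notation f := (likelihood Gamma G).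
Local Notation Xs := {ffun 'I_s -> 'I_n.+1}.
Local Notation Xk := {ffun 'I_k -> 'I_n.+1}.
Local Notation cmin := (lik_min K C Gamma).
Local Notation cmax := (normconst Gamma).
Local Notation theta_pt := (@theta_pt R s n).
Local Notation y_pt := (@y_pt R k n K).
Let My := normconst Gamma * expR (2 * quad_const (invmx Gamma) (K + C + 1)).
Let NV0 : 0 < N^-1. Proof. by rewrite invr_gt0 ltr0n. Qed.
Let X0 d : (0 < #|{: {ffun 'I_d -> 'I_n.+1}}|)%N.
Proof. by rewrite card_ffun !card_ord expn_gt0. Qed.

(** The factor [N ^+ #|u|] in [mdiff] cancels the step [N^-1] in each direction, leaving a bound
    free of the mesh. *)
Lemma mdiff_theta (m1 : Xk) (u : {set 'I_s}) (y : Xs) : (forall j, j \in u -> y j != 0) ->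
  `|mdiff u (fun m2 => f (theta_pt m2) (y_pt m1)) y| <=
  gev beta (fun j : 'I_s => b j) (lik_const K C Gamma) 4 u.
Proof.
move=> yu; rewrite (mdiff_bdiff (fun th => f th (y_pt m1)) _ _ yu).
have [xT h0 xhT] := dir_step_cube (- 2^-1) (ltW NV0) yu.
rewrite (theta_cubeE s n) in xT xhT.
have yK := y_pt_cube K0 m1.
have := bnd_likelihood_theta hG K0 C1 beta1 b0 sG bG yK xT h0 xhT.
move=> /(_ u finset.set0); rewrite disjoint_sym finset.disjoints_subset finset.sub0set => /(_ isT) h.
rewrite normrM ger0_norm ?exprn_ge0//.
apply: (@le_trans _ _ (N ^+ #|u| * gev beta (fun j : 'I_s => b j * dir_step N^-1 u j 0) (lik_const K C Gamma) 4 u)).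
  by rewrite ler_wpM2l ?exprn_ge0.
rewrite /gev big_split/= (eq_bigr (fun=> N^-1) (F1 := fun i => dir_step N^-1 u i 0)); last first.
  by move=> j ju; rewrite mxE ju.
rewrite prodr_const exprVn le_eqVlt; apply/orP; left; apply/eqP.
have : N ^+ #|u| != 0 by rewrite expf_neq0// pnatr_eq0.
by move: (N ^+ #|u|) => M M0; field.
Qed.

Lemma inner_variance (gam : {set 'I_s} -> R) (z : 'I_s -> nat) (m1 : Xk) :
  (forall u, 0 <= gam u) -> cbc gam (2 ^ l) z ->
  (forall u, gam u = 0 -> gev beta (fun j : 'I_s => b j) (lik_const K C Gamma) 4 u = 0) ->
  avg (fun d2 : Xs => (grid_inner_rule K Gamma G z d2 m1 - grid_inner K Gamma G m1) ^+ 2) <=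
  (\sum_(u : {set 'I_s} | u != finset.set0)
     gev beta (fun j : 'I_s => b j) (lik_const K C Gamma) 4 u ^+ 2 / gam u) *
  (2 * \sum_(u : {set 'I_s} | u != finset.set0) gam u * (6^-1) ^+ #|u|) / N.
Proof.
move=> g0 hz gB.
apply: (@cbc_variance _ _ _ _ hN gam z g0 hz (fun m2 => f (theta_pt m2) (y_pt m1))) => //.
by move=> u y _; exact: mdiff_theta.
Qed.

(** A single constant for all [u]: the dimension [k] is fixed, so [#|u|] may be replaced by [k]. *)
Definition outer_tail := My * 4 ^+ k * (k `!)%:R.

Lemma mdiff_y (Kx : R) :
  (forall (delta : R) (A a : {set 'I_k} -> R), 0 < delta ->
    bnd A a -> (forall v, cmin <= a v <= cmax) ->
    (forall u, u != finset.set0 -> A u <= outer_tail * delta ^+ #|u|) ->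
    bnd (fun u => Kx * delta ^+ #|u|) (fun v => xlogx (a v))) ->
  forall (u : {set 'I_k}) (y : Xk), (forall j, j \in u -> y j != 0) ->
  `|mdiff u (fun m1 => xlogx (grid_inner K Gamma G m1)) y| <= Kx * (2 * K) ^+ #|u|.
Proof.
move=> hKx u y yu; have hy := y_step_gt0 n K0; have M0 : 0 <= My by exact: My_ge0.
pose Phi y' := xlogx (avg (fun m2 : Xs => f (theta_pt m2) y')).
rewrite (mdiff_bdiff Phi (- K) (2 * K / N) yu).
have [xT h0 xhT] := dir_step_cube (- K) (ltW hy) yu.
rewrite (y_cubeE k n K) in xT xhT.
set x := grid_pt _ _ _ in xT xhT *; set h := dir_step _ _ in h0 xhT *.
have ab := bnd_avg (X0 s) (fun m2 => bnd_likelihood_y hG K0 C1 bG (theta_pt_Theta m2) xT h0 xhT).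
have := hKx (2 * K / N) _ _ hy ab.
have cb v : cmin <= avg (fun m2 : Xs => f (theta_pt m2) (vert x h v)) <= cmax.
  apply: avg_itv => // m2; apply: (likelihood_bounds hG bG); first exact: theta_pt_Theta.
  exact: vert_cube.
move=> /(_ cb) H; have {H} : bnd (fun u => Kx * (2 * K / N) ^+ #|u|) (fun v => Phi (vert x h v)).
  apply: H => w _; rewrite /gev -/My powRr1//.
  have wk : (#|w| <= k)%N by rewrite -[X in (_ <= X)%N](card_ord k) max_card.
  have pw : \prod_(j in w) h j 0 <= (2 * K / N) ^+ #|w|.
    by rewrite -prodr_const; apply: ler_prod => j _; rewrite h0/= mxE; case: ifP; rewrite // ltW.
  have p0 : 0 <= \prod_(j in w) h j 0 by apply: prodr_ge0 => j _.
  have fk : (#|w| `! <= k `!)%N by exact: leq_fact.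
  have q : My * 4 ^+ #|w| * (#|w| `!)%:R <= outer_tail.
    rewrite /outer_tail; apply: ler_pM; rewrite ?ler_nat//; first by rewrite mulr_ge0// exprn_ge0.
    by rewrite ler_wpM2l// ler_weXn2l// ler1n.
  by apply: ler_pM => //; rewrite mulr_ge0// mulr_ge0// exprn_ge0.
move=> /(_ u finset.set0); rewrite disjoint_sym finset.disjoints_subset finset.sub0set => /(_ isT) hh.
rewrite normrM ger0_norm ?exprn_ge0//.
apply: (@le_trans _ _ (N ^+ #|u| * (Kx * (2 * K / N) ^+ #|u|))).
  by rewrite ler_wpM2l ?exprn_ge0.
by rewrite mulrCA -exprMn [N * _]mulrC divfK// pnatr_eq0.
Qed.

Lemma outer_variance (Kx : R) (gam : {set 'I_k} -> R) (z : 'I_k -> nat) :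
  (forall (delta : R) (A a : {set 'I_k} -> R), 0 < delta ->
    bnd A a -> (forall v, cmin <= a v <= cmax) ->
    (forall u, u != finset.set0 -> A u <= outer_tail * delta ^+ #|u|) ->
    bnd (fun u => Kx * delta ^+ #|u|) (fun v => xlogx (a v))) ->
  (forall u, 0 < gam u) -> cbc gam (2 ^ l) z ->
  avg (fun d1 : Xk => (avg (fun i => xlogx (grid_inner K Gamma G (lat (@zmod n k z) d1 i))) -
     avg (fun m1 : Xk => xlogx (grid_inner K Gamma G m1))) ^+ 2) <=
  (\sum_(u : {set 'I_k} | u != finset.set0) (Kx * (2 * K) ^+ #|u|) ^+ 2 / gam u) *
  (2 * \sum_(u : {set 'I_k} | u != finset.set0) gam u * (6^-1) ^+ #|u|) / N.
Proof.
move=> hKx g0 hz.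
apply: (@cbc_variance _ _ _ _ hN gam z _ hz (fun m1 => xlogx (grid_inner K Gamma G m1))).
- by move=> u; exact: ltW.
- by move=> u gu; have := g0 u; rewrite gu ltxx.
- by move=> u y _; exact: mdiff_y.
Qed.

(** The intermediate term is the outer rule applied to [grid_inner]: its error depends on [d1] only.
    At each outer point the Lipschitz bound passes the inner error through [xlogx], where it is
    averaged over [d2] for a fixed node [m1]; hence [Vin] has to be uniform in [m1]. *)
Lemma tensor_variance (z1 : 'I_k -> nat) (z2 : 'I_s -> nat) (Vout Vin : R) :
  avg (fun d1 : Xk => (avg (fun i => xlogx (grid_inner K Gamma G (lat (@zmod n k z1) d1 i))) -
     avg (fun m1 : Xk => xlogx (grid_inner K Gamma G m1))) ^+ 2) <= Vout ->
  (forall m1, avg (fun d2 : Xs =>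
     (grid_inner_rule K Gamma G z2 d2 m1 - grid_inner K Gamma G m1) ^+ 2) <= Vin) ->
  avg (fun d1 : Xk => avg (fun d2 : Xs =>
    (grid_outer n K Gamma G - grid_tensor_rule K Gamma G z1 z2 d1 d2) ^+ 2)) <=
  ((2 * K) ^+ k) ^+ 2 * (2 * (Vout + xlogx_lip cmin cmax ^+ 2 * Vin)).
Proof.
move=> hout hin; set L := xlogx_lip cmin cmax.
pose H (m1 : Xk) := xlogx (grid_inner K Gamma G m1).
pose pt (d1 : Xk) i := lat (@zmod n k z1) d1 i.
pose E d1 := (avg (fun i => H (pt d1 i)) - avg H) ^+ 2.
pose V (m1 : Xk) (d2 : Xs) := (grid_inner_rule K Gamma G z2 d2 m1 - grid_inner K Gamma G m1) ^+ 2.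
have key d1 d2 : (grid_outer n K Gamma G - grid_tensor_rule K Gamma G z1 z2 d1 d2) ^+ 2 <=
    ((2 * K) ^+ k) ^+ 2 * (2 * (E d1 + L ^+ 2 * avg (fun i => V (pt d1 i) d2))).
  rewrite /grid_outer /grid_tensor_rule -mulrBr exprMn ler_wpM2l ?sqr_ge0//.
  set A := avg H; set Bq := avg (fun i => xlogx (grid_inner_rule K Gamma G z2 d2 (pt d1 i))).
  set M := avg (fun i => H (pt d1 i)).
  have -> : (A - Bq) ^+ 2 = ((M - Bq) - (M - A)) ^+ 2 by congr (_ ^+ 2); ring.
  have h1 : (M - Bq) ^+ 2 <= L ^+ 2 * avg (fun i => V (pt d1 i) d2).
    rewrite /M /Bq -avgB -avgZ; apply: (le_trans (avg_sqr_le _ _)); first by rewrite card_ord.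
    apply: ler_avg => i; rewrite -[X in X <= _]real_normK ?num_real// /V.
    rewrite -[X in _ <= _ * X]real_normK ?num_real// -exprMn ler_sqr ?nnegrE// ?mulr_ge0//.
      rewrite [X in _ <= _ * X]distrC; apply: xlogx_lipschitz.
      - exact: cmin_gt0.
      - exact: (grid_inner_bounds hG K0 bG).
      - exact: (grid_inner_rule_bounds hG K0 bG).
    by apply: xlogx_lip_ge0; [exact: cmin_gt0|exact: cmin_le_cmax].
  have h2 : (M - A) ^+ 2 = E d1 by [].
  have := sqr_ge0 ((M - Bq) + (M - A)); rewrite -h2.
  by move: (M - Bq) (M - A) h1 => p q; nra.
apply: (@le_trans _ _ (avg (fun d1 : Xk => avg (fun d2 : Xs =>
   ((2 * K) ^+ k) ^+ 2 * (2 * (E d1 + L ^+ 2 * avg (fun i => V (pt d1 i) d2))))))).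
  by apply: ler_avg => d1; apply: ler_avg => d2; exact: key.
under eq_avg => d1.
  rewrite avgZ avgZ avgD avg_const// avgZ exchange_avg; over.
rewrite avgZ avgZ avgD avgZ ler_wpM2l ?sqr_ge0// ler_wpM2l// lerD// ler_wpM2l ?sqr_ge0//.
rewrite -[X in _ <= X](avg_const Vin (X0 k)); apply: ler_avg => d1.
rewrite -[X in _ <= X](@avg_const _ 'I_n.+1 Vin) ?card_ord//; apply: ler_avg => i.
exact: hin.
Qed.
End variances.

Section mean_square_error.
Context {R : realType}.
Variables (k s n l : nat) (K C beta B1 : R) (Gamma : 'M[R]_k) (b : nat -> R) (G : 'cV[R]_s -> 'cV[R]_k).
Hypotheses (hG : spd Gamma) (K0 : 0 < K) (C1 : 1 <= C) (beta1 : 1 <= beta) (b0 : forall j, 0 <= b j).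
Hypotheses (sG : smooth_on (Theta s) G) (bG : gevrey_bound C beta b G).
Hypotheses (hB1 : \sum_(j < s) b j <= B1) (hN : (2 ^ l = n.+1)%N).
Local Notation N := (n.+1%:R : R).
Local Notation f := (likelihood Gamma G).
Local Notation Xs := {ffun 'I_s -> 'I_n.+1}.
Local Notation Xk := {ffun 'I_k -> 'I_n.+1}.

(** The factor 3 is 2 for the integral, by positive and negative parts, plus 1 for the rule. *)
Definition discretisation_const (k : nat) (K C B1 : R) (Gamma : 'M[R]_k) : R :=
  3 * (2 * K) ^+ k * xlogx_lip (lik_min K C Gamma) (normconst Gamma) *
  (4 * lik_const K C Gamma * B1 +
   8 * (normconst Gamma * expR (2 * quad_const (invmx Gamma) (K + C + 1))) * K * k%:R).

Lemma mean_square_error (z1 : 'I_k -> nat) (z2 : 'I_s -> nat) (V : R) :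
  avg (fun d1 : Xk => avg (fun d2 : Xs =>
    (grid_outer n K Gamma G - grid_tensor_rule K Gamma G z1 z2 d1 d2) ^+ 2)) <= V ->
  (\int[(leb k \x leb s)%E]_(D in cube k 0 1 `*` cube s 0 1)
    ((`| I_K K f - tensor_rule K l z1 z2 f D.1 D.2 | ^+ 2)%:E) <=
   (2 * V + 2 * (discretisation_const K C B1 Gamma / N) ^+ 2)%:E)%E.
Proof.
move=> hV; set E := discretisation_const _ _ _ _ / N.
have NV0 : 0 < N^-1 by rewrite invr_gt0 ltr0n.
have NN : 0 + N * N^-1 = 1 by rewrite add0r mulfV ?pnatr_eq0.
pose p d := @grid_index R n 0 N^-1 ord0 d.
pose T (d1 : Xk) (d2 : Xs) := grid_tensor_rule K Gamma G z1 z2 d1 d2.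
pose phi (m : Xk * Xs) := 2 * (grid_outer n K Gamma G - T m.1 m.2) ^+ 2 + 2 * E ^+ 2.
have phi0 m : 0 <= phi m by apply: addr_ge0; apply: mulr_ge0 => //; exact: sqr_ge0.
have mC d : measurable (cube d 0 1 : set 'cV[R]_d) by rewrite -NN; exact: measurable_cube.
have mD : measurable (cube k 0 1 `*` cube s 0 1 : set ('cV[R]_k * 'cV[R]_s)).
  exact: measurableX.
have mp d (m : {ffun 'I_d -> 'I_n.+1}) : measurable (cube d 0 1 `&` p d @^-1` [set m]).
  by rewrite -NN; exact: measurable_grid_index.
have mup d (m : {ffun 'I_d -> 'I_n.+1}) : leb d (cube d 0 1 `&` p d @^-1` [set m]) = (N^-1 ^+ d)%:E.
  by rewrite -[X in cube d _ X]NN; exact: leb_grid_index.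
pose P (D : 'cV[R]_k * 'cV[R]_s) : Xk * Xs := (p k D.1, p s D.2).
have fib (m : Xk * Xs) : (cube k 0 1 `*` cube s 0 1) `&` P @^-1` [set m] =
    (cube k 0 1 `&` p k @^-1` [set m.1]) `*` (cube s 0 1 `&` p s @^-1` [set m.2]).
  case: m => m1 m2; apply/seteqP; split=> -[x y] /=; rewrite /P/=.
    by move=> [[xc yc] [-> ->]].
  by move=> [[xc ->] [yc ->]].
have mP (m : Xk * Xs) : measurable ((cube k 0 1 `*` cube s 0 1) `&` P @^-1` [set m]).
  by rewrite fib; apply: measurableX; exact: mp.
have muP (m : Xk * Xs) : (leb k \x leb s)%E ((cube k 0 1 `*` cube s 0 1) `&` P @^-1` [set m]) =
    (N^-1 ^+ k * N^-1 ^+ s)%:E.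
  rewrite fib EFinM -(mup k m.1) -(mup s m.2).
  by apply: product_measure1E; exact: mp.
have := @integral_le_step _ _ R (leb k \x leb s)%E _ mD _ P (fun=> N^-1 ^+ k * N^-1 ^+ s) mP muP
  (fun D => `| I_K K f - tensor_rule K l z1 z2 f D.1 D.2 | ^+ 2) phi _ phi0.
move=> H; apply: le_trans (H _) _.
  move=> [D1 D2] [/= D1c D2c]; rewrite exprn_ge0//= /phi/=.
  set g := T _ _; set t := tensor_rule _ _ _ _ _ _ _.
  have h1 := I_K_grid n hG K0 C1 beta1 b0 sG bG hB1.
  have h2 : `|t - g| <= _ := tensor_rule_grid hG K0 C1 beta1 b0 sG bG hB1 z1 z2 hN D1c D2c.
  have h3 : `|(I_K K f - grid_outer n K Gamma G) - (t - g)| <= E.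
    apply: le_trans (ler_normB _ _) (le_trans (lerD h1 h2) _).
    by rewrite /E /discretisation_const le_eqVlt; apply/orP; left; apply/eqP; ring.
  rewrite real_normK ?num_real//.
  have -> : I_K K f - t = (grid_outer n K Gamma G - g) + ((I_K K f - grid_outer n K Gamma G) - (t - g)).
    by ring.
  set a := _ - g; set c := (_ - _) - _ in h3 *.
  have h4 : c ^+ 2 <= E ^+ 2.
    rewrite -[X in X <= _]real_normK ?num_real// ler_sqr ?nnegrE//.
    exact: le_trans h3.
  have := sqr_ge0 (a - c); move: (E ^+ 2) h4 => E2 h4; nra.
rewrite lee_fin.
have -> : \sum_(m : Xk * Xs) phi m * (N^-1 ^+ k * N^-1 ^+ s) =
    avg (fun d1 : Xk => avg (fun d2 : Xs => phi (d1, d2))).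
  rewrite /avg !card_ffun !card_ord !natrX -!exprVn -mulr_suml mulrC -mulrA; congr (_ * _).
  rewrite -mulr_sumr; congr (_ * _); rewrite pair_bigA/=.
  by apply: eq_bigr => -[].
have X0 d : (0 < #|{: {ffun 'I_d -> 'I_n.+1}}|)%N by rewrite card_ffun !card_ord expn_gt0.
under eq_avg => d1 do rewrite avgD avg_const// avgZ.
by rewrite avgD avg_const// avgZ lerD2r ler_wpM2l.
Qed.
End mean_square_error.

(** * The prescribed inner weights *)

Section inner_weights.
Context {R : realType}.

Lemma ellp_partial_sums (p : R) (b : nat -> R) : (forall j, 0 <= b j) -> ellp p b ->
  exists2 P : R, 0 < P & forall s, \sum_(j < s) b j `^ p <= P.
Proof.
move=> b0 bp; exists (limn (series (fun j => `|b j| `^ p)) + 1) => [|s].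
  rewrite ltr_wpDl//; apply: limr_ge => //.
  by apply: nearW => n; apply: sumr_ge0 => j _; exact: powR_ge0.
apply: (@le_trans _ _ (series (fun j => `|b j| `^ p) s)).
  rewrite /series/= big_mkord le_eqVlt; apply/orP; left; apply/eqP.
  by apply: eq_bigr => j _; rewrite ger0_norm.
rewrite (@le_trans _ _ (limn (series (fun j => `|b j| `^ p))))// ?lerDl//.
apply: nondecreasing_cvgn_le bp _.
by apply: nondecreasing_series => j _ _; exact: powR_ge0.
Qed.

Lemma sum_le_powR_sum (p P : R) (b : nat -> R) (s : nat) : 0 < p < 1 -> (forall j, 0 <= b j) ->
  \sum_(j < s) b j `^ p <= P -> \sum_(j < s) b j <= P `^ p^-1.
Proof.
move=> /andP[p0 p1] b0 bP.
have -> : \sum_(j < s) b j = \sum_(j < s) (b j `^ p) `^ p^-1.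
  by apply: eq_bigr => j _; rewrite -powRrM mulfV ?gt_eqF// powRr1.
apply: le_trans (sum_powR_le _ _ _) _ => [|j|]; first by rewrite invf_ge1// ltW.
  exact: powR_ge0.
apply: ge0_ler_powR; rewrite ?nnegrE ?invr_ge0 ?(ltW p0)//.
  by apply: sumr_ge0 => j _; exact: powR_ge0.
by apply: le_trans bP; apply: sumr_ge0 => j _; exact: powR_ge0.
Qed.

Variables (mu_min C beta delta : R) (b : nat -> R).
Hypotheses (mu0 : 0 < mu_min) (C1 : 1 <= C) (b0 : forall j, 0 <= b j) (d0 : 0 < delta < 2^-1).

Let lambda := (2 - 2 * delta)^-1.
Definition weight_exponent := 2 / (1 + lambda).
Definition weight_factor :=
  2 `^ beta * C / Num.sqrt mu_min / Num.sqrt (2 * zeta (2 * lambda) / (2 * pi ^+ 2) `^ lambda).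

(** The range of [delta] puts [lambda] strictly between [2^-1] and 1. Hence the exponent [t] exceeds
    1 and [2 - t] exceeds [2 / 3], so both are at least [p]. *)
Lemma weight_exponent_bounds : 1 < weight_exponent < 4 / 3.
Proof.
have /andP[d1 d2] := d0; have h : 0 < 2 - 2 * delta by lra.
have l1 : 2^-1 < lambda by rewrite ltf_pV2 ?posrE//; lra.
have l2 : lambda < 1 by rewrite invf_lt1//; lra.
rewrite /weight_exponent; apply/andP; split.
  by rewrite ltr_pdivlMr; lra.
by rewrite ltr_pdivrMr; lra.
Qed.

Lemma weight_factor_gt0 : 0 < weight_factor.
Proof.
have /andP[d1 d2] := d0; have h : 0 < 2 - 2 * delta by lra.
have l1 : 2^-1 < lambda by rewrite ltf_pV2 ?posrE//; lra.
rewrite /weight_factor !divr_gt0// ?sqrtr_gt0 ?mulr_gt0 ?powR_gt0//.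
- exact: lt_le_trans ltr01 C1.
- by apply: zeta_gt0; lra.
- by rewrite invr_gt0 powR_gt0// mulr_gt0// exprn_gt0// pi_gt0.
Qed.

Lemma inner_weightE s (u : {set 'I_s}) : inner_weight mu_min C beta delta b u =
  ((#|u| `!)%:R `^ beta * weight_factor ^+ #|u| * \prod_(j in u) b j) `^ weight_exponent.
Proof.
rewrite /inner_weight -[in RHS]mulrA; congr ((_ * _) `^ _).
by rewrite -prodr_const -big_split/=; apply: eq_bigr => j _; rewrite /weight_factor mulrAC.
Qed.

Lemma inner_weight_ge0 s (u : {set 'I_s}) : 0 <= inner_weight mu_min C beta delta b u.
Proof. by rewrite inner_weightE powR_ge0. Qed.

Let gfact s (u : {set 'I_s}) := (#|u| `!)%:R `^ beta * \prod_(j in u) b j.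

Let gfact_ge0 s (u : {set 'I_s}) : 0 <= gfact u.
Proof. by rewrite mulr_ge0 ?powR_ge0// prodr_ge0. Qed.

(** The numerical factor being positive, a weight vanishes only through the product of the [b j],
    which [gev] contains as well. *)
Lemma inner_weight_eq0 M r s (u : {set 'I_s}) : inner_weight mu_min C beta delta b u = 0 ->
  gev beta (fun j : 'I_s => b j) M r u = 0.
Proof.
have w0 := weight_factor_gt0; have /andP[t1 _] := weight_exponent_bounds.
rewrite inner_weightE => /eqP; rewrite powR_eq0 => /andP[/eqP h _].
have {h} : weight_factor ^+ #|u| * gfact u = 0 by rewrite -h /gfact; ring.
move=> /eqP; rewrite mulf_eq0 expf_eq0 (gt_eqF w0) andbF/= => /eqP h.
by rewrite /gev -mulrA -/(gfact u) h mulr0.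
Qed.

(** Dividing the squared majorant by the weight leaves a power of [gfact u] with exponent [2 - t],
    so both sums have the form of [gevrey_subset_sum], with exponents [2 - t] and [t]. *)
Lemma inner_constant (p M : R) : 0 < p -> p <= 2 / 3 -> beta * p < 1 -> 0 <= M ->
  (exists2 P : R, 0 < P & forall s, \sum_(j < s) b j `^ p <= P) ->
  exists2 V : R, 0 <= V & forall s,
    (\sum_(u : {set 'I_s} | u != finset.set0)
       gev beta (fun j : 'I_s => b j) M 4 u ^+ 2 / inner_weight mu_min C beta delta b u) *
    (2 * \sum_(u : {set 'I_s} | u != finset.set0)
       inner_weight mu_min C beta delta b u * (6^-1) ^+ #|u|) <= V.
Proof.
move=> p0 p23 bp M0 [P P0 hP]; have /andP[t1 t2] := weight_exponent_bounds.
have w0 := weight_factor_gt0; set t := weight_exponent in t1 t2 *; set w := weight_factor in w0.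
pose tau := 2 - t; have tau0 : 0 < tau by rewrite /tau; lra.
(* Chosen so that its power [tau] is 16 divided by the power [t] of [w]: 16 is the square of the
   ratio 4, and the power of [w] comes from the weight in the denominator. *)
pose r2 := (16 / w `^ t) `^ tau^-1.
have [S1 S10 h1] : exists2 S : R, 0 <= S & forall (n : nat) (b : 'I_n -> R), (forall j, 0 <= b j) ->
    \sum_j b j `^ p <= P ->
    \sum_(u : {set 'I_n}) ((#|u| `!)%:R `^ beta * w ^+ #|u| * \prod_(j in u) b j) `^ t <= S.
  by apply: gevrey_subset_sum => //; [lra|exact: ltW].
have [S2 S20 h2] : exists2 S : R, 0 <= S & forall (n : nat) (b : 'I_n -> R), (forall j, 0 <= b j) ->
    \sum_j b j `^ p <= P ->
    \sum_(u : {set 'I_n}) ((#|u| `!)%:R `^ beta * r2 ^+ #|u| * \prod_(j in u) b j) `^ tau <= S.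
  by apply: gevrey_subset_sum => //; [rewrite /tau; lra|exact: powR_ge0].
exists (M ^+ 2 * S2 * (2 * S1)) => [|s]; first by rewrite !mulr_ge0 ?sqr_ge0.
apply: ler_pM.
- by apply: sumr_ge0 => u _; rewrite divr_ge0 ?sqr_ge0 ?inner_weight_ge0.
- by rewrite mulr_ge0// sumr_ge0// => u _; rewrite mulr_ge0 ?inner_weight_ge0 ?exprn_ge0.
- apply: (@le_trans _ _ (M ^+ 2 * \sum_(u : {set 'I_s}) ((#|u| `!)%:R `^ beta * r2 ^+ #|u| * \prod_(j in u) b j) `^ tau)); last first.
    by rewrite ler_wpM2l ?sqr_ge0//; apply: h2.
  rewrite mulr_sumr big_mkcond/=; apply: ler_sum => u _; case: ifP => _; last first.
    by rewrite mulr_ge0 ?sqr_ge0 ?powR_ge0.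
  rewrite inner_weightE -/t -/w.
  have -> : gev beta (fun j : 'I_s => b j) M 4 u = M * 4 ^+ #|u| * gfact u by rewrite /gev /gfact mulrA.
  have -> : (#|u| `!)%:R `^ beta * w ^+ #|u| * \prod_(j in u) b j = w ^+ #|u| * gfact u.
    by rewrite /gfact; ring.
  have -> : (#|u| `!)%:R `^ beta * r2 ^+ #|u| * \prod_(j in u) b j = r2 ^+ #|u| * gfact u.
    by rewrite /gfact; ring.
  have w00 := ltW w0; have r20 : 0 <= r2 by exact: powR_ge0.
  rewrite (powRM _ (exprn_ge0 _ w00) (gfact_ge0 u)) (powRM _ (exprn_ge0 _ r20) (gfact_ge0 u)).
  rewrite (powR_exprn _ _ w00) (powR_exprn _ _ r20).
  have r2E : r2 `^ tau = 16 / w `^ t.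
    by rewrite /r2 -powRrM mulVf ?gt_eqF// powRr1// divr_ge0// powR_ge0.
  rewrite r2E; have [->|g0] := eqVneq (gfact u) 0.
    by rewrite mulr0 expr0n mul0r !mulr_ge0 ?sqr_ge0 ?exprn_ge0 ?divr_ge0 ?powR_ge0.
  have gp : 0 < gfact u by rewrite lt_neqAle eq_sym g0 gfact_ge0.
  rewrite /tau powRB ?(negbTE g0) ?implybT// powR_mulrn ?(ltW gp)//.
  have wt : w `^ t != 0 by rewrite gt_eqF ?powR_gt0.
  have gt' : gfact u `^ t != 0 by rewrite gt_eqF ?powR_gt0.
  rewrite le_eqVlt; apply/orP; left; apply/eqP.
  have e16 : 16 ^+ #|u| = (4 ^+ #|u|) ^+ 2 :> R.
    by rewrite -exprM mulnC exprM; congr (_ ^+ _); ring.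
  rewrite expr_div_n e16; have wtu : (w `^ t) ^+ #|u| != 0 by rewrite expf_neq0.
  move: (gfact u) (gfact u `^ t) gt' (4 ^+ #|u|) ((w `^ t) ^+ #|u|) wtu => g gt gt0 x y y0.
  by field; rewrite gt0 y0.
- rewrite ler_wpM2l//; apply: (@le_trans _ _ (\sum_(u : {set 'I_s}) inner_weight mu_min C beta delta b u)); last first.
    by under eq_bigr do rewrite inner_weightE; exact: h1.
  rewrite big_mkcond/=; apply: ler_sum => u _; case: ifP => _; last exact: inner_weight_ge0.
  rewrite ler_piMr ?inner_weight_ge0// exprn_ile1// ?invr_ge0//.
  by rewrite invf_le1//; lra.
Qed.
End inner_weights.

Theorem corollary7p4 (R : realType)
  (k : nat) (hk : (0 < k)%N)
  (K : R) (hK : 0 < K)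
  (q : nat) (Xi : set 'cV[R]_q) (hXi : compact Xi)
  (Gamma : 'M[R]_k) (hGamma : spd Gamma)
  (mu_min : R) (hmu : 0 < mu_min <= 1)
  (hmu_eig : forall a : R, eigenvalue Gamma a -> mu_min <= a)
  (C beta : R) (hC : 1 <= C) (hbeta : 1 <= beta)
  (p : R) (hp01 : 0 < p < 1)
  (b : nat -> R) (hb0 : forall j, 0 <= b j) (hbp : ellp p b)
  (G : forall s : nat, 'cV[R]_s -> 'cV[R]_q -> 'cV[R]_k)
  (hGsmooth : forall (s : nat) (xi : 'cV[R]_q), (0 < s)%N -> Xi xi ->
     smooth_on (Theta s) (fun theta => G s theta xi))
  (hGbound : forall (s : nat) (xi : 'cV[R]_q), (0 < s)%N -> Xi xi ->
     gevrey_bound C beta b (fun theta => G s theta xi))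
  (hp : p <= Num.min (2 / 3) (1 / beta)) (hpbeta : p != 1 / beta)
  (xi : 'cV[R]_q) (hxi : Xi xi)
  (delta : R) (hdelta : 0 < delta < 2^-1)
  (z2 : forall s : nat, nat -> 'I_s -> nat)
  (hz2 : forall s l : nat, (0 < s)%N ->
     cbc (@inner_weight R s mu_min C beta delta b) (2 ^ l) (z2 s l))
  (gamma1 : {set 'I_k} -> R) (hgamma1 : forall u, 0 < gamma1 u)
  (C1 : R)
  (z1 : nat -> nat -> 'I_k -> nat)
  (hz1 : forall s l : nat, (0 < s)%N -> cbc gamma1 (2 ^ l) (z1 s l))
  (hrate : forall (s l : nat) (F : 'cV[R]_k -> R)
       (D : {set 'I_k} -> 'cV[R]_k -> R), (0 < s)%N -> sobolev F D ->
     (rms_error (2 ^ l) (z1 s l) F <=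
      (C1 * 2 `^ (- (1 - delta) * l%:R) * sobolev_norm gamma1 D)%:E)%E) :
  exists2 C' : R, 0 < C' & forall s l : nat, (0 < s)%N ->
    (rms_full_error K l (z1 s l) (z2 s l)
       (likelihood Gamma (fun theta => G s theta xi)) <=
     (C' * (2 ^+ l) `^ (- 2^-1 + delta))%:E)%E.
Proof.
have /andP[mu0 _] := hmu; have /andP[p0 p1] := hp01.
have K0 := hK.
have beta0 : 0 < beta := lt_le_trans ltr01 hbeta.
have [p23 bp] : p <= 2 / 3 /\ beta * p < 1.
  move: hp; rewrite le_min => /andP[-> pb]; split=> //.
  by rewrite mulrC -ltr_pdivlMr// lt_neqAle hpbeta.
have [P P0 hP] := ellp_partial_sums hb0 hbp.
(* As [p < 1], summability of the powers [p] bounds the partial sums of [b], uniformly in [s]. *)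
set B1 := P `^ p^-1.
have cm0 : 0 < lik_min K C Gamma by exact: cmin_gt0.
have cmm : lik_min K C Gamma <= normconst Gamma by exact: cmin_le_cmax.
have t0 : 0 <= outer_tail K C Gamma.
  by rewrite !mulr_ge0 ?exprn_ge0 ?expR_ge0// ltW// normconst_gt0.
have [Kx Kx0 hKx] := @xlogx_bound R 'I_k _ _ _ cm0 cmm t0.
have Mth0 : 0 <= lik_const K C Gamma by exact: Mth_ge0.
have [Vin Vin0 hVin] := inner_constant mu0 hC hb0 hdelta p0 p23 bp Mth0 (ex_intro2 _ _ P P0 hP).
pose Vout := (\sum_(u : {set 'I_k} | u != finset.set0) (Kx * (2 * K) ^+ #|u|) ^+ 2 / gamma1 u) *
  (2 * \sum_(u : {set 'I_k} | u != finset.set0) gamma1 u * (6^-1) ^+ #|u|).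
have Vout0 : 0 <= Vout.
  rewrite mulr_ge0//; first by apply: sumr_ge0 => u _; rewrite divr_ge0 ?sqr_ge0// ltW.
  by rewrite mulr_ge0// sumr_ge0// => u _; rewrite mulr_ge0 ?exprn_ge0// ltW.
set L := xlogx_lip (lik_min K C Gamma) (normconst Gamma).
set E := discretisation_const K C B1 Gamma.
pose V := ((2 * K) ^+ k) ^+ 2 * (2 * (Vout + L ^+ 2 * Vin)).
have V0 : 0 <= V by rewrite mulr_ge0 ?sqr_ge0// mulr_ge0// addr_ge0// mulr_ge0 ?sqr_ge0.
pose W := 2 * V + 2 * E ^+ 2.
have W0 : 0 <= W by apply: addr_ge0; apply: mulr_ge0 => //; exact: sqr_ge0.
(* The added 1 makes the constant positive even if [W = 0]. *)
exists (Num.sqrt W + 1) => [|s l s0]; first by rewrite ltr_wpDl ?sqrtr_ge0.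
have [n hN] : exists n, (2 ^ l = n.+1)%N by exists (2 ^ l).-1; rewrite prednK ?expn_gt0.
have NE : (2 ^+ l : R) = n.+1%:R by rewrite -natrX hN.
have sG := hGsmooth s xi s0 hxi; have bG := hGbound s xi s0 hxi.
have hB1 : \sum_(j < s) b j <= B1 by apply: (sum_le_powR_sum hp01 hb0 (hP s)).
have hout := outer_variance hGamma K0 hC bG hN hKx hgamma1 (hz1 s l s0).
have hin m1 : avg (fun d2 : {ffun 'I_s -> 'I_n.+1} =>
   (grid_inner_rule K Gamma (G s ^~ xi) (z2 s l) d2 m1 - grid_inner K Gamma (G s ^~ xi) m1) ^+ 2) <=
   Vin / n.+1%:R.
  apply: le_trans (inner_variance hGamma K0 hC hbeta hb0 sG bG hN m1 _ (hz2 s l s0) _) _.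
  - by move=> u; exact: inner_weight_ge0.
  - by move=> u; exact: inner_weight_eq0.
  - by rewrite ler_wpM2r ?invr_ge0.
have N1 : (1 : R) <= n.+1%:R by rewrite ler1n.
have N0 : (0 : R) < n.+1%:R by rewrite ltr0n.
have hV := tensor_variance hGamma K0 hC bG hout hin.
have := mean_square_error hGamma K0 hC hbeta hb0 sG bG hB1 hN hV.
rewrite -/L -/E => hI.
have hW : (\int[(leb k \x leb s)%E]_(D in cube k 0 1 `*` cube s 0 1)
    ((`| I_K K (likelihood Gamma (G s ^~ xi)) -
       tensor_rule K l (z1 s l) (z2 s l) (likelihood Gamma (G s ^~ xi)) D.1 D.2 | ^+ 2)%:E) <=
    (W / n.+1%:R)%:E)%E.
  apply: le_trans hI _; rewrite lee_fin /W [X in _ <= X]mulrDl lerD//.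
    by rewrite le_eqVlt /V /Vout; apply/orP; left; apply/eqP; ring.
  (* The squared discretisation error has order [N ^- 2], which [N^-1] dominates. *)
  rewrite -mulrA ler_wpM2l// exprMn ler_wpM2l ?sqr_ge0// expr2 ler_piMr ?invr_ge0//.
  by rewrite invf_le1.
rewrite /rms_full_error; apply: (@le_trans _ _ (sqrte (W / n.+1%:R)%:E)).
  by rewrite lee_sqrt// lee_fin divr_ge0.
rewrite /= lee_fin sqrtrM// NE.
have -> : Num.sqrt (n.+1%:R^-1) = n.+1%:R `^ (- 2^-1) :> R.
  by rewrite powRN powR12_sqrt ?ler0n// sqrtrV.
have /andP[d0 _] := hdelta.
apply: ler_pM; rewrite ?sqrtr_ge0 ?powR_ge0//; first by rewrite lerDl.
by rewrite ler_powR// lerDl ltW.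
Qed.
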